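(* Let $1<p<\infty$, let $\{R_\ell\}_{\ell=1}^d$ be the collection of Riesz transforms on $\mathbb{R}^d$, and let $U$ and $V$ be any $m\times m$ matrix weights (not necessarily $\mathrm{A}_p$). If $B$ is any locally integrable $m\times m$ matrix valued function, then $$\max\left\{\|B\|_{\widetilde{\mathrm{BMO}}^p_{V,U}},\ \|B\|_{\widetilde{\mathrm{BMO}}^{p'}_{U',V'}}\right\}\le C\max_{1\le\ell\le d}\|[M_B,R_\ell\otimes\mathbf{I}_m]\|_{L^p(U)\to L^p(V)},$$ where $C$ depends only on $m,d,p$ (and not on $U,V,B$).
   Context: $\frac1p+\frac1{p'}=1$. $\fint_Q$ denotes the unweighted average over $Q$. $\|\cdot\|$ on matrices is the operator norm. An $m\times m$ matrix weight is a measurable $m\times m$ matrix valued function $W$ on $\mathbb{R}^d$ that is positive definite a.e. $L^p(W)$ is the space of $\mathbb{C}^m$ valued functions $\vec f$ with $\|\vec f\|_{L^p(W)}=\left(\int_{\mathbb{R}^d}|W^{1/p}(x)\vec f(x)|^p\,dx\right)^{1/p}<\infty$. $R_\ell$ is the Calderón–Zygmund operator with kernel $K_\ell(x,y)=\frac{x_\ell-y_\ell}{|x-y|^{d+1}}$. $R_\ell\otimes\mathbf{I}_m$ acts on $\mathbb{C}^m$ valued functions componentwise; $M_B$ is pointwise multiplication by $B$; $[M_B,S]=M_BS-SM_B$; $\|\cdot\|_{L^p(U)\to L^p(V)}$ is the operator norm ($+\infty$ if the operator is not bounded). With suprema over all cubes $Q\subset\mathbb{R}^d$, $$\|B\|_{\widetilde{\mathrm{BMO}}^p_{V,U}}=\sup_Q\left(\fint_Q\left(\fint_Q\|V^{1/p}(x)(B(x)-B(y))U^{-1/p}(y)\|^{p'}\,dy\right)^{p/p'}dx\right)^{1/p},$$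 $$\|B\|_{\widetilde{\mathrm{BMO}}^{p'}_{U',V'}}=\sup_Q\left(\fint_Q\left(\fint_Q\|V^{1/p}(x)(B(x)-B(y))U^{-1/p}(y)\|^{p}\,dx\right)^{p'/p}dy\right)^{1/p'}.$$ (The second is the quantity of the first type for the dual weights $U'=U^{-p'/p}$, $V'=V^{-p'/p}$, exponent $p'$, and symbol $B^*$.) *)

(* Defs.v *)
From HB Require Import structures.
From mathcomp Require Import all_boot all_order all_algebra.
From mathcomp Require Import all_classical all_reals all_analysis.
From mathcomp.real_closed Require Import complex.

Set Implicit Arguments.
Unset Strict Implicit.
Unset Printing Implicit Defensive.

Import Order.TTheory GRing.Theory Num.Theory.
Import numFieldNormedType.Exports.

Local Open Scope classical_set_scope.
Local Open Scope ring_scope.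

(* R^d is [d.-tuple (measurableTypeR R)], with the product sigma-algebra of
   the library (i.e. the Borel sets).  The library has no Lebesgue measure on
   tuples, so it is built by iterating the binary product measure; [leb_box]
   below characterizes it. *)

Notation Rd R d := (d.-tuple (measurableTypeR R)).

Section leb_cons.
Context (R : realType) (n : nat).
Variable mu : {sigma_finite_measure set (Rd R n) -> \bar R}.
Local Open Scope ereal_scope.

Let cons2 (z : measurableTypeR R * Rd R n) : Rd R n.+1 := [tuple of z.1 :: z.2].

Let mcons2 : measurable_fun [set: measurableTypeR R * Rd R n] cons2.
Proof. exact: measurable_cons. Qed.

Definition leb_cons : set (Rd R n.+1) -> \bar R :=
  fun A => (@lebesgue_measure R \x mu)
    [set z : measurableTypeR R * Rd R n | A [tuple of z.1 :: z.2]].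

Let leb_consE A : leb_cons A = pushforward (@lebesgue_measure R \x mu) cons2 A.
Proof. by []. Qed.

Let mpre A : measurable A -> measurable (cons2 @^-1` A).
Proof. by move=> mA; rewrite -[X in measurable X]setTI; exact: mcons2. Qed.

Let leb_cons0 : leb_cons set0 = 0.
Proof. by rewrite leb_consE /pushforward preimage_set0 measure0. Qed.

Let leb_cons_ge0 A : 0 <= leb_cons A.
Proof. exact: measure_ge0. Qed.

Let leb_cons_sigma_additive : semi_sigma_additive leb_cons.
Proof.
move=> F mF tF mUF.
have -> : leb_cons = pushforward (@lebesgue_measure R \x mu) cons2 by [].
rewrite /pushforward preimage_bigcup; apply: measure_semi_sigma_additive.
- by move=> k; exact: mpre.
- apply/trivIsetP => /= i j _ _ ij; rewrite -preimage_setI.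
  by move/trivIsetP : tF => /(_ _ _ _ _ ij) ->//; rewrite preimage_set0.
- by rewrite -preimage_bigcup; exact: mpre.
Qed.

HB.instance Definition _ := isMeasure.Build _ _ _ leb_cons
  leb_cons0 leb_cons_ge0 leb_cons_sigma_additive.

Let split2 (t : Rd R n.+1) : measurableTypeR R * Rd R n :=
  (thead t, [tuple of behead t]).

Let msplit2 : measurable_fun [set: Rd R n.+1] split2.
Proof.
apply/measurable_fun_pairP; split => /=.
- exact: measurable_tnth.
- exact: measurable_behead.
Qed.

Let cons2K : cancel cons2 split2.
Proof. by move=> [x t]; rewrite /split2 theadE; congr pair; exact: val_inj. Qed.

Let leb_cons_sigma_finite : sigma_finite setT leb_cons.
Proof.
have /sigma_finiteP[F [TF ndF Foo]] := sigma_finiteT (@lebesgue_measure R).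
have /sigma_finiteP[G [TG ndG Goo]] := sigma_finiteT mu.
exists (fun k => split2 @^-1` (F k `*` G k)).
  apply/esym/seteqP; split => // t _.
  have [i _ Fi] : (\bigcup_i F i) (split2 t).1 by rewrite -TF.
  have [j _ Gj] : (\bigcup_i G i) (split2 t).2 by rewrite -TG.
  exists (maxn i j) => //; split.
  - by move: Fi; exact/subsetPset/ndF/leq_maxl.
  - by move: Gj; exact/subsetPset/ndG/leq_maxr.
move=> k; have [mF Fk] := Foo k; have [mG Gk] := Goo k; split.
  by rewrite -[X in measurable X]setTI; apply: msplit2 => //; exact: measurableX.
rewrite leb_consE /pushforward -comp_preimage.
rewrite (_ : split2 \o cons2 = id) ?preimage_id; last first.
  by apply/funext => z /=; rewrite cons2K.
by rewrite product_measure1E// lte_mul_pinfty// ge0_fin_numE.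
Qed.

HB.instance Definition _ := Measure_isSigmaFinite.Build _ _ _ leb_cons
  leb_cons_sigma_finite.

End leb_cons.

Fixpoint leb (R : realType) (d : nat) :
    {sigma_finite_measure set (Rd R d) -> \bar R} :=
  match d with
  | 0 => dirac [tuple]
  | n.+1 => leb_cons (leb R n)
  end.

Lemma leb_box (R : realType) (d : nat) (a b : 'I_d -> R) :
  (forall i, a i <= b i) ->
  leb R d [set x | forall i, a i <= tnth x i <= b i] =
  (\prod_i (b i - a i))%:E.
Proof.
elim: d a b => [|d IH] a b ab.
  by rewrite big_ord0 /= /dirac indicE mem_set //= => -[].
rewrite big_ord_recl.
pose a' i := a (lift ord0 i); pose b' i := b (lift ord0 i).
set A := (X in leb _ _ X).
have -> : leb R d.+1 A = (@lebesgue_measure R \x leb R d)%E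
    (`[a ord0, b ord0] `*` [set x | forall i, a' i <= tnth x i <= b' i]).
  rewrite [LHS]/= /leb_cons; congr (_ _); apply/seteqP; split => -[x t] /=.
    move=> H; split; first by have := H ord0; rewrite in_itv.
    by move=> i; have := H (lift ord0 i); rewrite tnthS.
  move=> [H1 H2] i; case: (unliftP ord0 i) => [j|] ->.
    by rewrite tnthS; exact: H2.
  by move: H1; rewrite in_itv.
have mB : measurable [set x : Rd R d | forall i, a' i <= tnth x i <= b' i].
  have -> : [set x : Rd R d | forall i, a' i <= tnth x i <= b' i] =
    \bigcap_(i in [set: 'I_d]) ((fun x => tnth x i) @^-1` `[a' i, b' i]).
    apply/seteqP; split => x /= H i; first by move=> _ /=; rewrite in_itv /=.
    by have := H i Logic.I; rewrite /= in_itv.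
  apply: fin_bigcap_measurable => // i _.
  by rewrite -[X in measurable X]setTI; apply: measurable_tnth.
rewrite product_measure1E // IH; last by move=> i; exact: ab.
have E0 : (@lebesgue_measure R `[a ord0, b ord0] = (b ord0 - a ord0)%:E)%E.
  rewrite lebesgue_measure_itv /= lte_fin.
  have := ab ord0; rewrite le_eqVlt => /orP[/eqP ->|->].
    by rewrite ltxx subrr.
  by rewrite -EFinB.
by rewrite [X in (X * _)%E]E0 -EFinM.
Qed.

Section weights.
Context (R : realType).
Local Notation C := R[i].

(* The default norm on matrices in the library is the max norm; this is the
   Euclidean one *)
Definition vnorm m (v : 'cV[C]_m) : R :=
  Num.sqrt (\sum_i Normc.normc (v i 0) ^+ 2).

Definition opnorm m (A : 'M[C]_m) : R :=
  sup [set vnorm (A *m v) | v in [set v | vnorm v <= 1]].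

(* In the order of R[i], 0 < z says that z is real and positive *)
Definition posdefmx m (A : 'M[C]_m) : Prop :=
  A \is hermsymmx /\
  forall v : 'cV[C]_m, v != 0 -> 0 < ((map_mx Num.conj v)^T *m A *m v) 0 0.

(* The power A^a of a positive definite A; complex.Re only casts the (real)
   eigenvalues to R *)
Definition mxpow m (A : 'M[C]_m) (a : R) : 'M[C]_m :=
  invmx (spectralmx A)
    *m diag_mx (map_mx (fun z : C => (complex.Re z `^ a)%:C%C) (spectral_diag A))
    *m spectralmx A.

Context (d : nat).
Local Notation E := (Rd R d).
Local Notation mu := (leb R d).

Definition borel_mx m n (f : E -> 'M[C]_(m, n)) : Prop :=
  forall i j, measurable_fun setT (fun x => complex.Re (f x i j)) /\
              measurable_fun setT (fun x => complex.Im (f x i j)).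

(* Lebesgue (rather than only Borel) measurability.  Integrals of such functions
   are unaffected by the Borel modification: the integral of the library is, on
   nonnegative functions, a supremum over simple functions below. *)
Definition lmeasurable_mx m n (f : E -> 'M[C]_(m, n)) : Prop :=
  exists g, borel_mx g /\ {ae mu, forall x, f x = g x}.

Definition matrix_weight m (W : E -> 'M[C]_m) : Prop :=
  lmeasurable_mx W /\ {ae mu, forall x, posdefmx (W x)}.

Definition cube (a : E) (s : R) : set E :=
  [set x | forall i, tnth a i <= tnth x i <= tnth a i + s].

Definition cubes : set (set E) :=
  [set Q | exists a s, 0 < s /\ Q = cube a s].

Definition loc_integrable_mx m (B : E -> 'M[C]_m) : Prop :=
  lmeasurable_mx B /\
  forall Q, cubes Q -> (\int[mu]_(x in Q) (opnorm (B x))%:E < +oo)%E.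

Definition average (Q : set E) (f : E -> \bar R) : \bar R :=
  ((fine (mu Q))^-1%:E * \int[mu]_(x in Q) f x)%E.

Definition wLnorm (p : R) m (W : E -> 'M[C]_m) (f : E -> 'cV[C]_m) : \bar R :=
  Lnorm mu p%:E (fun x => (vnorm (mxpow (W x) p^-1 *m f x))%:E).

Definition bmo_kernel (p : R) m (V U B : E -> 'M[C]_m) (x y : E) : R :=
  opnorm (mxpow (V x) p^-1 *m (B x - B y) *m mxpow (U y) (- p^-1)).

Definition bmo (p p' : R) m (V U B : E -> 'M[C]_m) : \bar R :=
  ereal_sup [set
    (average Q (fun x =>
       average Q (fun y => (bmo_kernel p V U B x y `^ p')%:E) `^ (p / p'))
     `^ p^-1)%E | Q in cubes].

Definition bmo_dual (p p' : R) m (V U B : E -> 'M[C]_m) : \bar R :=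
  ereal_sup [set
    (average Q (fun y =>
       average Q (fun x => (bmo_kernel p V U B x y `^ p)%:E) `^ (p' / p))
     `^ p'^-1)%E | Q in cubes].

Definition norm2 (x : E) : R := Num.sqrt (\sum_i tnth x i ^+ 2).

Definition dist2 (x y : E) : R :=
  Num.sqrt (\sum_i (tnth x i - tnth y i) ^+ 2).

Definition riesz_kernel (l : 'I_d) (x y : E) : R :=
  (tnth x l - tnth y l) / dist2 x y ^+ d.+1.

(* Principal value; for u in L^1 with compact support, the only case used below,
   the limit exists at almost every x *)
Definition riesz (l : 'I_d) (u : E -> R) (x : E) : R :=
  lim ((\int[mu]_(y in [set y | e < dist2 x y]) (riesz_kernel l x y * u y))
       @[e --> 0^'+]).

Definition riesz_vec (l : 'I_d) m (f : E -> 'cV[C]_m) : E -> 'cV[C]_m :=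
  fun x => \col_i (riesz l (fun y => complex.Re (f y i 0)) x
                   +i* riesz l (fun y => complex.Im (f y i 0)) x)%C.

Definition mulop m (B : E -> 'M[C]_m) (f : E -> 'cV[C]_m) : E -> 'cV[C]_m :=
  fun x => B x *m f x.

Definition commutator m (S T : (E -> 'cV[C]_m) -> (E -> 'cV[C]_m))
    (f : E -> 'cV[C]_m) : E -> 'cV[C]_m :=
  fun x => S (T f) x - T (S f) x.

Definition bounded_compact_supp m (f : E -> 'cV[C]_m) : Prop :=
  [/\ lmeasurable_mx f,
      exists M, forall x, vnorm (f x) <= M &
      exists r, forall x, r < norm2 x -> f x = 0].

(* The norm L^p(U) -> L^p(V) of an operator given on bounded functions of compact
   support.  These are dense in L^p(U) for every matrix weight U, and for f among
   them f and B f are in L^1 with compact support when B is locally integrable,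
   whereas [M_B, R_l (x) I] f need not make sense for all f in L^p(U) when the
   weights are arbitrary. *)
Definition Lp_opnorm (p : R) m (U V : E -> 'M[C]_m)
    (T : (E -> 'cV[C]_m) -> (E -> 'cV[C]_m)) : \bar R :=
  ereal_sup [set wLnorm p V (T f) | f in
    [set f | bounded_compact_supp f /\ (wLnorm p U f <= 1)%E]].

End weights.

(* Main.v *)
Require Import Defs.
From mathcomp Require Import all_boot all_order all_algebra.
From mathcomp Require Import all_classical all_reals all_analysis.
From mathcomp Require Import measurable_realfun.
From mathcomp.real_closed Require Import complex.
From mathcomp Require Import ring lra zify.
Set Implicit Arguments.
Unset Strict Implicit.
Unset Printing Implicit Defensive.
Import Order.TTheory GRing.Theory Num.Theory.
Import numFieldNormedType.Exports HBNNSimple.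
Local Open Scope classical_set_scope.
Local Open Scope ring_scope.

(** Why the theorem is true.  Write k(x, y) = V^(1/p)(x) (B(x) - B(y)) U^(-1/p)(y)
    and let N bound the norms of all the commutators.  Only pairs of disjoint
    cells X, Y that are far apart compared with their size are used.  If f is
    supported in Y then near X the principal value is an ordinary integral, so
    that V^(1/p) [M_B, R_l] U^(-1/p) acts from Y to X as the integral operator
    with kernel K_l(x, y) k(x, y), and it is bounded by N from L^p to L^p
    ([test_fun_bound], [Re_entry_commutator]).  For the coordinate l in which X
    and Y are farthest apart, K_l is almost constant on X x Y
    ([riesz_fun_stable]), so up to a small relative error the operator with
    kernel k is bounded by N / |K_l|, which is about N |X|.

    A bound on an operator does not in general control the mixed norm
    L^p(dx; L^p'(dy)) of its kernel.  It does for the real kernels Re (c k_ij),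
    |c| = 1, because these have finite rank: expanding the matrix product
    writes them as sums of 4m products a(x) b(y) ([entry_kernelE]).  For a
    kernel of rank n, a basis of nearly maximal determinant
    ([near_maximal_basis]) balances the factors, so that those in x have norm at
    most 4N and those in y at most 2 ([finite_rank_factor]).  This yields both
    mixed norms, in the order (x, y) and in the order (y, x), with a constant
    that depends on n only.  Hence the error K_l / K0 - 1, with K0 the value at
    the corners of the cells, can be absorbed
    ([perturbed_op_bound_mixed_bound]).  Absorption needs the mixed norm to be
    finite beforehand, so everything is first restricted to sets on which all
    factors are bounded, and the restriction is removed by monotone convergence
    ([mixed_integral_exhaust], [pair_bound]).

    It remains to pass from pairs of separated cells to Q x Q.  Off the diagonal,
    Q x Q is covered by pairs of dyadic cells of side |Q|^(1/d) 2^(-n) whose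
    offset, in units of their side, lies between M and 2M + 3.  At each scale
    there are boundedly many offsets, and the mixed norms of the scales decay
    geometrically because the averages compare |X|^p with |Q|^p
    ([whitney_sum]).  Adding up the entries and the two values c = 1, -i gives
    both suprema ([average_mixed_le], [borel_bmo_le], [borel_bmo_dual_le]).

    Throughout, the weights and B are replaced by Borel representatives, which
    changes none of the quantities ([borel_weight], [ae_congr_bmo],
    [ae_congr_Lp_opnorm]); that fractional powers of Borel weights are again
    Borel is [mxmeas_mxpow]. *)

(** * Integrals of nonnegative functions, measurable or not *)

Section integral_facts.
Context d (T : measurableType d) (R : realType).
Variable mu : {measure set T -> \bar R}.
Local Open Scope ereal_scope.

(** The integral of a nonnegative function is a supremum over the simple functions
    below it, so it is monotone even where measurability is not known. *)
Lemma ge0_le_lower_integral (D : set T) (f g : T -> \bar R) :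
  (forall x, D x -> 0 <= f x) -> (forall x, D x -> f x <= g x) ->
  \int[mu]_(x in D) f x <= \int[mu]_(x in D) g x.
Proof.
move=> f0 fg.
have g0 x : D x -> 0 <= g x by move=> Dx; exact: le_trans (f0 _ Dx) (fg _ Dx).
rewrite !ge0_integralE//; apply: ge_ereal_sup => _ [h hf <-].
apply: ereal_sup_ubound; exists h => // x; apply: (le_trans (hf x)).
rewrite /patch; case: ifPn => [/set_mem Dx|_]; [exact: fg | exact: lexx].
Qed.

(** A simple function below f can be cut off on a null set, which puts it below g and
    leaves its integral unchanged. *)
Lemma le_lower_integral_ae (D : set T) (f g : T -> \bar R) :
  (forall x, D x -> 0 <= f x) -> (forall x, D x -> 0 <= g x) ->
  {ae mu, forall x, D x -> f x = g x} ->
  \int[mu]_(x in D) f x <= \int[mu]_(x in D) g x.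
Proof.
move=> f0 g0 [N [mN N0 sN]].
rewrite !ge0_integralE//; apply: ge_ereal_sup => _ [h hf <-].
have mNc : measurable (~` N) by exact: measurableC.
pose h' := proj_nnsfun h mNc.
have h'E x : h' x = (h x * \1_(~` N) x)%R by [].
rewrite -(_ : sintegral mu h' = sintegral mu h); last first.
  rewrite -!integralT_nnsfun.
  apply: ae_eq_integral => //; [exact/measurable_EFinP|exact/measurable_EFinP|].
  exists N; split => // x /= H; apply: contrapT => Nx; apply: H => _.
  by rewrite /= /mindic indicE mem_set// mulr1.
apply: ereal_sup_ubound; exists h' => // x.
rewrite h'E indicE; case: (boolP (x \in ~` N)) => [/set_mem /= Nx|_]; last first.
  by rewrite mulr0 /patch; case: ifPn => // /set_mem; exact: g0.
rewrite mulr1; apply: (le_trans (hf x)).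
rewrite /patch; case: ifPn => [/set_mem Dx|_]; last exact: lexx.
rewrite (_ : f x = g x) ?lexx//.
by apply: contrapT => H; apply: Nx; apply: sN => /= H'; apply: H; exact: H'.
Qed.

(** As f and g are arbitrary, this applies to integrands built from weights that
    are only Lebesgue measurable. *)
Lemma ae_congr_integral (D : set T) (f g : T -> \bar R) :
  {ae mu, forall x, D x -> f x = g x} ->
  \int[mu]_(x in D) f x = \int[mu]_(x in D) g x.
Proof.
have pos (f1 g1 : T -> \bar R) : (forall x, D x -> 0 <= f1 x) ->
    (forall x, D x -> 0 <= g1 x) -> {ae mu, forall x, D x -> f1 x = g1 x} ->
    \int[mu]_(x in D) f1 x = \int[mu]_(x in D) g1 x.
  move=> f0 g0 fg; apply/eqP; rewrite eq_le !le_lower_integral_ae//.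
  by apply: filterS fg => x /= H Dx; rewrite H.
move=> fg; rewrite integralE [RHS]integralE; congr (_ - _); apply: pos => //.
- by apply: filterS fg => x /= H Dx; rewrite !funeposE H.
- by apply: filterS fg => x /= H Dx; rewrite !funenegE H.
Qed.

Lemma integral_vanish_off (D : set T) (f : T -> \bar R) :
  (forall x, ~ D x -> f x = 0) -> \int[mu]_(x in D) f x = \int[mu]_x f x.
Proof.
move=> f0; rewrite integral_mkcond; apply: eq_integral => x _.
by rewrite /patch; case: ifPn => // /negP xD; rewrite f0// => Dx; apply/xD/mem_set.
Qed.

End integral_facts.

Section param_integral.
Context d1 d2 (T1 : measurableType d1) (T2 : measurableType d2) (R : realType).
Variable mu : {sigma_finite_measure set T2 -> \bar R}.
Local Open Scope ereal_scope.

Lemma measurable_param_integral (f : T1 * T2 -> \bar R) :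
  measurable_fun [set: T1 * T2] f ->
  measurable_fun [set: T1] (fun x => \int[mu]_y f (x, y)).
Proof.
move=> mf.
under eq_fun do rewrite integralE.
apply: emeasurable_funB.
- rewrite (_ : (fun x => _) = fubini_F mu f^\+).
    exact: measurable_fun_fubini_tonelli_F (measurable_funepos mf) (funepos_ge0 f).
  by apply/funext => x; apply: eq_integral => y _; rewrite !funeposE.
- rewrite (_ : (fun x => _) = fubini_F mu f^\-).
    exact: measurable_fun_fubini_tonelli_F (measurable_funeneg mf) (funeneg_ge0 f).
  by apply/funext => x; apply: eq_integral => y _; rewrite !funenegE.
Qed.

End param_integral.

(** * Powers of sums of extended reals *)

Section powers_of_sums.
Context (R : realType).
Local Open Scope ereal_scope.

Lemma le_poweR (a b : \bar R) (r : R) : (0 <= r)%R -> 0 <= a -> a <= b ->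
  a `^ r <= b `^ r.
Proof.
move=> r0 a0 ab; apply: gt0_ler_poweR => //; rewrite in_itv/= ?a0 ?leey// (le_trans a0 ab)// leey.
Qed.

(** The exponent may be less than 1 or greater, so convexity gives way to comparing
    every term with the largest one. *)
Lemma poweR_sum_le (J : finType) (c : J -> \bar R) (r : R) : (0 < r)%R ->
  (forall j, 0 <= c j) ->
  (\sum_j c j) `^ r <= (#|J|%:R `^ r)%:E * \sum_j c j `^ r.
Proof.
move=> r0 c0.
have [J0|J0] := posnP #|J|.
  by rewrite !big_pred0 ?poweR0r ?gt_eqF ?mule0// => j;
    have := max_card (pred1 j); rewrite card1 J0.
have [j1 _] : exists j, j \in J by apply/existsP; rewrite -lt0n.
have [j0 cj] : exists j0, forall j, c j <= c j0.
  by case: (@arg_maxP _ _ _ j1 xpredT c) => // j0 _ H; exists j0 => j; exact: H.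
apply: (@le_trans _ _ ((#|J|%:R%:E * c j0) `^ r)).
  apply: le_poweR; [exact: ltW | by apply: sume_ge0 |].
  apply: (@le_trans _ _ (\sum_(j : J) c j0)); first by apply: lee_sum.
  by rewrite big_const -Monoid.iteropE /= mule_natl.
rewrite poweRM ?lee_fin// poweR_EFin; apply: lee_pmul.
- by rewrite lee_fin powR_ge0.
- exact: poweR_ge0.
- by [].
- rewrite (bigD1 j0)//=; apply: leeDl; apply: sume_ge0 => *; exact: poweR_ge0.
Qed.

Lemma poweRK (a : \bar R) (r : R) : (0 < r)%R -> 0 <= a -> (a `^ r) `^ r^-1 = a.
Proof. by move=> r0 a0; rewrite -poweRrM divff ?gt_eqF// poweRe1. Qed.

Lemma poweRVK (a : \bar R) (r : R) : (0 < r)%R -> 0 <= a -> (a `^ r^-1) `^ r = a.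
Proof. by move=> r0 a0; rewrite -poweRrM mulVf ?gt_eqF// poweRe1. Qed.

(** A substitute for the triangle inequality in L^r that also works for r < 1: with
    A the last series, each w_k c_k is at most A^(1/r), and the weights 1 / w_k are
    summable. *)
Lemma poweR_nneseries_le (c : nat -> \bar R) (w : nat -> R) (S r : R) :
  (0 < r)%R -> (forall k, 0 <= c k) -> (forall k, (0 < w k)%R) ->
  \sum_(k <oo) (w k)^-1%:E <= S%:E ->
  (\sum_(k <oo) c k) `^ r <=
    (S `^ r)%:E * \sum_(k <oo) (w k `^ r)%:E * c k `^ r.
Proof.
move=> r0 c0 w0 wS.
set A := \sum_(k <oo) (w k `^ r)%:E * c k `^ r.
have t0 k : 0 <= (w k `^ r)%:E * c k `^ r.
  by rewrite mule_ge0 ?lee_fin ?powR_ge0 ?poweR_ge0.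
have A0 : 0 <= A by apply: nneseries_ge0.
have S0 : (0 <= S)%R.
  rewrite -lee_fin; apply: le_trans wS; apply: nneseries_ge0 => k _ _.
  by rewrite lee_fin invr_ge0 ltW.
have S1 : (0 < S)%R.
  rewrite -lte_fin; apply: lt_le_trans wS.
  apply: (@lt_le_trans _ _ (w 0%N)^-1%:E); first by rewrite lte_fin invr_gt0.
  rewrite (nneseriesD1 (n := 0%N))//; last first.
    by move=> k _; rewrite lee_fin invr_ge0 ltW.
  by apply: leeDl; apply: nneseries_ge0 => k _ _; rewrite lee_fin invr_ge0 ltW.
have [Aoo|Afin] := eqVneq A +oo.
  by rewrite Aoo gt0_muley ?leey// lte_fin powR_gt0.
have key k : c k <= A `^ r^-1 * (w k)^-1%:E.
  have : (w k)%:E * c k <= A `^ r^-1.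
    rewrite -[leLHS](@poweRK _ r)//; last by rewrite mule_ge0 ?lee_fin// ltW.
    apply: le_poweR; [by rewrite invr_ge0 ltW | exact: poweR_ge0 |].
    rewrite poweRM ?lee_fin//; last by rewrite ltW.
    rewrite /A (nneseriesD1 (n := k))//=; apply: leeDl.
    by apply: nneseries_ge0.
  by rewrite muleC -lee_pdivlMr ?invr_gt0 ?invrK.
apply: (@le_trans _ _ ((A `^ r^-1 * S%:E) `^ r)).
  apply: le_poweR; [exact: ltW | by apply: nneseries_ge0 |].
  apply: (@le_trans _ _ (\sum_(k <oo) A `^ r^-1 * (w k)^-1%:E)).
    by apply: lee_nneseries => // k _.
  have {}Afin : A `^ r^-1 \is a fin_num.
    by apply: fin_num_poweR; rewrite ge0_fin_numE// ltey.
  rewrite -(fineK Afin) nneseriesZl//; last first.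
    by move=> k _; rewrite lee_fin invr_ge0 ltW.
  by apply: lee_wpmul2l => //; rewrite fineK// poweR_ge0.
by rewrite poweRM ?lee_fin ?poweR_ge0// poweRVK// muleC.
Qed.

End powers_of_sums.

(** * Monotone convergence for iterated integrals *)

Section monotone_iterated.
Context d1 d2 (T1 : measurableType d1) (T2 : measurableType d2) (R : realType).
Variable mu1 : {measure set T1 -> \bar R}.
Variable mu2 : {sigma_finite_measure set T2 -> \bar R}.
Local Open Scope ereal_scope.

(** Monotone convergence for the inner integral, then for the outer one. *)
Lemma mixed_integral_sup (k : nat -> T1 * T2 -> \bar R) (r : R) (M : \bar R) :
  (0 < r)%R ->
  (forall n, measurable_fun [set: T1 * T2] (k n)) ->
  (forall n z, 0 <= k n z) ->
  (forall z, nondecreasing_seq (k ^~ z)) ->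
  (forall n, \int[mu1]_x (\int[mu2]_y k n (x, y)) `^ r <= M) ->
  \int[mu1]_x (\int[mu2]_y limn (k ^~ (x, y))) `^ r <= M.
Proof.
move=> r0 mk k0 ndk kM.
have mF n : measurable_fun [set: T1] (fun x => \int[mu2]_y k n (x, y)).
  exact: measurable_param_integral.
have ndF x : nondecreasing_seq (fun n => \int[mu2]_y k n (x, y)).
  by move=> a b ab; apply: ge0_le_lower_integral => // y _; exact: ndk.
have F0 n x : 0 <= \int[mu2]_y k n (x, y) by exact: integral_ge0.
have ndFr x : nondecreasing_seq (fun n => (\int[mu2]_y k n (x, y)) `^ r).
  by move=> a b ab; apply: le_poweR; [exact: ltW|exact: F0|exact: ndF].
apply: (@le_trans _ _
    (\int[mu1]_x limn (fun n => (\int[mu2]_y k n (x, y)) `^ r))).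
  apply: ge0_le_lower_integral => x _; first exact: poweR_ge0.
  rewrite monotone_convergence//; last first.
    by move=> n; exact: measurable_fun_pair2.
  set S := limn _; set S' := limn _.
  have S'0 : 0 <= S'.
    apply: lime_ge; first exact: ereal_nondecreasing_is_cvgn.
    by apply: nearW => n; exact: poweR_ge0.
  have S0 : 0 <= S.
    by apply: lime_ge; [exact: ereal_nondecreasing_is_cvgn|exact: nearW].
  rewrite -[leRHS](@poweRVK _ _ r)//; apply: le_poweR => //; first exact: ltW.
  apply: lime_le; first exact: ereal_nondecreasing_is_cvgn.
  apply: nearW => n; rewrite -[leLHS](@poweRK _ _ r)//.
  apply: le_poweR; [by rewrite invr_ge0 ltW|exact: poweR_ge0|].
  rewrite /S' (cvg_lim _ (ereal_nondecreasing_cvgn (ndFr x)))//.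
  by apply: ereal_sup_ubound; exists n.
rewrite monotone_convergence//; last 2 first.
- move=> n; exact: (measurableT_comp (measurable_poweR r) (mF n)).
- by move=> n x _; exact: poweR_ge0.
apply: lime_le.
  apply: ereal_nondecreasing_is_cvgn => a b ab.
  by apply: ge0_le_lower_integral => x _; [exact: poweR_ge0|exact: ndFr].
exact: nearW.
Qed.

(** Removes a truncation to X_n x Y_n once a bound uniform in n is known. *)
Lemma mixed_integral_exhaust (k : T1 * T2 -> \bar R) (X : nat -> set T1)
    (Y : nat -> set T2) (A : set T1) (B : set T2) (r : R) (M : \bar R) :
  (0 < r)%R -> measurable_fun [set: T1 * T2] k -> (forall z, 0 <= k z) ->
  (forall n, measurable (X n)) -> (forall n, measurable (Y n)) ->
  (forall n n', (n <= n')%N -> X n `<=` X n') ->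
  (forall n n', (n <= n')%N -> Y n `<=` Y n') ->
  (forall x, A x -> exists n, X n x) -> (forall y, B y -> exists n, Y n y) ->
  (forall n, \int[mu1]_x (\int[mu2]_y
    ((\1_(X n) x * \1_(Y n) y)%:E * k (x, y))) `^ r <= M) ->
  \int[mu1]_(x in A) (\int[mu2]_(y in B) k (x, y)) `^ r <= M.
Proof.
move=> r0 mk k0 mX mY ndX ndY AX BY kM.
pose kn n (z : T1 * T2) := (\1_(X n) z.1 * \1_(Y n) z.2)%:E * k z.
have kn0 n z : 0 <= kn n z by rewrite mule_ge0 ?lee_fin ?mulr_ge0.
have ndkn z : nondecreasing_seq (kn ^~ z).
  move=> n n' nn'; apply: lee_wpmul2r => //; rewrite lee_fin !indicE.
  have mon (T : Type) (Z Z' : set T) t : Z `<=` Z' ->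
      ((t \in Z)%:R <= (t \in Z')%:R :> R)%R.
    move=> ZZ'; rewrite ler_nat; case: (boolP (t \in Z)) => // /set_mem Zt.
    by rewrite mem_set//; exact: ZZ'.
  by apply: ler_pM => //; apply: mon; [exact: ndX|exact: ndY].
apply: le_trans (mixed_integral_sup r0 _ kn0 ndkn kM); last first.
  move=> n; apply: emeasurable_funM => //; apply/measurable_EFinP.
  have mXn : measurable_fun [set: T1] (\1_(X n) : T1 -> R).
    exact: measurable_indic.
  have mYn : measurable_fun [set: T2] (\1_(Y n) : T2 -> R).
    exact: measurable_indic.
  apply: measurable_funM.
  - exact: (measurableT_comp mXn measurable_fst).
  - exact: (measurableT_comp mYn measurable_snd).
have limkn0 z : 0 <= limn (kn ^~ z).
  apply: lime_ge; first exact: ereal_nondecreasing_is_cvgn.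
  exact: nearW.
rewrite integral_mkcond; apply: ge0_le_lower_integral => x _.
  by rewrite /patch; case: ifP => // _; exact: poweR_ge0.
rewrite {1}/patch; case: ifPn => [/set_mem Ax|_]; last exact: poweR_ge0.
apply: le_poweR; [exact: ltW|exact: integral_ge0|].
rewrite integral_mkcond; apply: ge0_le_lower_integral => y _.
  by rewrite /patch; case: ifP.
rewrite {1}/patch; case: ifPn => [/set_mem By|_]; last exact: limkn0.
have [n1 Xx] := AX x Ax; have [n2 Yy] := BY y By.
apply: lime_ge; first exact: ereal_nondecreasing_is_cvgn.
exists (maxn n1 n2) => // n /= nn; rewrite /kn /= !indicE !mem_set ?mulr1 ?mul1e//.
- by apply: ndY Yy; exact: leq_trans (leq_maxr _ _) nn.
- by apply: ndX Xx; exact: leq_trans (leq_maxl _ _) nn.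
Qed.

End monotone_iterated.

(** * Bases of nearly maximal determinant *)

Section near_maximal.
Context (R : realType).

Lemma normr_det_le n (K : R) (A : 'M[R]_n) :
  (forall i j, `|A i j| <= K) -> `|\det A| <= n`!%:R * K ^+ n.
Proof.
move=> AK; rewrite /determinant; apply: (le_trans (ler_norm_sum _ _ _)).
rewrite -[in leRHS]perm.card_Sn mulr_natl -sumr_const.
apply: ler_sum => s _; rewrite normrM normrX normrN1 expr1n mul1r normr_prod.
rewrite -[X in K ^+ X]card_ord -prodr_const; apply: ler_prod => i _.
by rewrite normr_ge0 AK.
Qed.

(** Cramer's rule: the coordinates of c in the basis of the rows of V are quotients
    of determinants. *)
Lemma det_row_subst n (V : 'M[R]_n) (c : 'rV[R]_n) i :
  V \in unitmx ->
  \det (\matrix_(k, l) if k == i then c 0 l else V k l) =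
  (c *m invmx V) 0 i * \det V.
Proof.
move=> uV; rewrite /invmx uV (expand_det_row _ i) -scalemxAr [RHS]mulrC [X in _ * X]mxE.
rewrite mulrA mulrV -?unitmxE// mul1r mxE.
apply: eq_bigr => j _; rewrite !mxE eqxx; congr (_ * _).
rewrite /cofactor; congr (_ * \det _); apply/matrixP => k l; rewrite !mxE.
by rewrite eq_sym (negbTE (neq_lift _ _)).
Qed.

(** Take rows in D whose determinant is at least half of the supremum; by Cramer's
    rule the coordinates of a vector of D are then at most 2.  The multiples of
    the unit vectors in D make the supremum positive, and the bound K makes it finite. *)
Lemma near_maximal_basis n (D : set 'rV[R]_n) (K e : R) :
  0 < e -> (forall c i, D c -> `|c 0 i| <= K) ->
  (forall i, D (e *: delta_mx 0 i)) ->
  exists V : 'M[R]_n, [/\ V \in unitmx, forall i, D (row i V) &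
    forall c i, D c -> `|(c *m invmx V) 0 i| <= 2].
Proof.
move=> e0 DK De.
pose S := [set `|\det V| | V in [set V : 'M[R]_n | forall i, D (row i V)]].
have Se : S `|\det (e%:M : 'M[R]_n)|.
  exists e%:M => // i.
  rewrite (_ : row i _ = e *: delta_mx 0 i)//.
  by rewrite -scalemx1 linearZ/= row1.
have supS : has_sup S.
  split; first by exists `|\det (e%:M : 'M[R]_n)|.
  exists (n`!%:R * K ^+ n) => _ [V DV <-]; apply: normr_det_le => i j.
  by have := DK _ j (DV i); rewrite mxE.
have S0 : 0 < sup S.
  apply: lt_le_trans (ub_le_sup supS.2 Se).
  by rewrite det_scalar normr_gt0 expf_neq0// gt_eqF.
have [_ [V DV <-] VS] := sup_adherent (divr_gt0 S0 (ltr0n _ 2)) supS.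
have {}VS : sup S < 2 * `|\det V| by lra.
have V0 : 0 < `|\det V| by lra.
have uV : V \in unitmx by rewrite unitmxE unitfE -normr_gt0.
exists V; split => // c i Dc.
rewrite -(ler_pM2r V0) -normrM -det_row_subst//; apply: (le_trans _ (ltW VS)).
apply: ub_le_sup; first by case: supS.
exists (\matrix_(k, l) if k == i then c 0 l else V k l) => // k.
have [->|ki] := eqVneq k i.
  by rewrite (_ : row i _ = c)//; apply/rowP => l; rewrite !mxE eqxx.
rewrite (_ : row k _ = row k V); first exact: DV.
by apply/rowP => l; rewrite !mxE (negbTE ki).
Qed.

End near_maximal.

(** * Bounded functions supported in sets of finite measure *)

Section nice.
Context d (T : measurableType d) (R : realType).
Variable mu : {measure set T -> \bar R}.

(** A class closed under sums and products in which all powers are integrable, so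
    that no integrability has to be carried along. *)
Definition nice (f : T -> R) := [/\ measurable_fun [set: T] f,
  exists M, forall x, `|f x| <= M &
  exists A, [/\ measurable A, (mu A < +oo)%E & forall x, ~ A x -> f x = 0]].

Definition pint (q : R) (f : T -> R) : \bar R := \int[mu]_x (`|f x| `^ q)%:E.

Lemma pint_ge0 q f : (0 <= pint q f)%E.
Proof. by apply: integral_ge0 => x _; rewrite lee_fin powR_ge0. Qed.

Lemma nice_mul (f h : T -> R) : nice f -> measurable_fun [set: T] h ->
  (exists M, forall x, `|h x| <= M) -> nice (fun x => h x * f x).
Proof.
move=> [mf [M fM] [A [mA Aoo A0]]] mh [N hN]; split.
- exact: measurable_funM.
- exists (N * M) => x; rewrite normrM; apply: ler_pM => //.
- by exists A; split => // x Ax; rewrite A0 ?mulr0.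
Qed.

Lemma niceZ c (f : T -> R) : nice f -> nice (fun x => c * f x).
Proof.
move=> nf; apply: (nice_mul nf (h := fun=> c)); first exact: measurable_cst.
by exists `|c|.
Qed.

Lemma nice0 : nice (fun=> 0).
Proof.
split; [exact: measurable_cst | by exists 0 => x; rewrite normr0 |].
by exists set0; split => //; rewrite measure0.
Qed.

Lemma niceD (f h : T -> R) : nice f -> nice h -> nice (fun x => f x + h x).
Proof.
move=> [mf [M fM] [A [mA Aoo A0]]] [mh [N hN] [B [mB Boo B0]]]; split.
- exact: measurable_funD.
- by exists (M + N) => x; apply: (le_trans (ler_normD _ _)); exact: lerD.
- exists (A `|` B); split => //; first exact: measurableU.
    apply: le_lt_trans (measureU2 mu mA mB) _; exact: lte_add_pinfty.
  by move=> x /not_orP[? ?]; rewrite A0// B0// addr0.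
Qed.

Lemma nice_sum (J : Type) (s : seq J) (f : J -> T -> R) :
  (forall j, nice (f j)) -> nice (fun x => \sum_(j <- s) f j x).
Proof.
move=> nf; elim: s => [|j s IH].
  by under eq_fun do rewrite big_nil; exact: nice0.
by under eq_fun do rewrite big_cons; exact: niceD.
Qed.

Lemma measurable_powR_norm (q : R) (f : T -> R) : measurable_fun [set: T] f ->
  measurable_fun [set: T] (fun x => `|f x| `^ q).
Proof.
by move=> mf; apply: (measurableT_comp (measurable_powR q)); exact: measurableT_comp.
Qed.

Lemma nice_powR (q : R) (f : T -> R) : 0 < q -> nice f ->
  nice (fun x => `|f x| `^ q).
Proof.
move=> q0 [mf [M fM] [A [mA Aoo A0]]]; split.
- exact: measurable_powR_norm.
- exists (M `^ q) => x; rewrite ger0_norm ?powR_ge0//.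
  have M0 : 0 <= M by exact: le_trans (fM x).
  by apply: ge0_ler_powR; rewrite ?nnegrE// ltW.
- by exists A; split => // x Ax; rewrite A0// normr0 powR0 ?gt_eqF.
Qed.

Lemma nice_integrable (f : T -> R) : nice f ->
  mu.-integrable [set: T] (EFin \o f).
Proof.
move=> [mf [M fM] [A [mA Aoo A0]]]; apply/integrableP; split.
  exact/measurable_EFinP.
rewrite -(integral_vanish_off _ (D := A)); last first.
  by move=> x Ax /=; rewrite A0// normr0.
apply: (@le_lt_trans _ _ (\int[mu]_(x in A) (cst (M%:E)) x)%E).
  by apply: ge0_le_lower_integral => x _ //=; rewrite lee_fin.
rewrite integral_cst//; have [->|mu0] := eqVneq (mu A) 0%E; first by rewrite mule0.
by rewrite -(@fineK _ (mu A)) ?ltry// ge0_fin_numE.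
Qed.

Lemma nice_pint_fin (q : R) (f : T -> R) : 0 < q -> nice f ->
  pint q f \is a fin_num.
Proof.
by move=> q0 nf; apply: integrable_fin_num => //; exact: nice_integrable (nice_powR q0 nf).
Qed.

Lemma nice_Rintegral_sum (J : finType) (c : J -> R) (f : J -> T -> R) :
  (forall j, nice (f j)) ->
  \int[mu]_x (\sum_j c j * f j x) = \sum_j c j * \int[mu]_x f j x.
Proof.
move=> nf.
have H (s : seq J) : \int[mu]_x (\sum_(j <- s) c j * f j x) =
    \sum_(j <- s) c j * \int[mu]_x f j x.
  elim: s => [|j s IH].
    under eq_Rintegral do rewrite big_nil.
    by rewrite big_nil Rintegral_cst// mul0r.
  under eq_Rintegral do rewrite big_cons.
  rewrite big_cons -IH RintegralD//.
  - by rewrite RintegralZl//; exact: nice_integrable.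
  - exact: nice_integrable (niceZ _ (nf j)).
  - by apply: nice_integrable; apply: nice_sum => i; exact: niceZ.
exact: H.
Qed.

Lemma pintZ (q c : R) (f : T -> R) : measurable_fun [set: T] f ->
  (pint q (fun x => (c * f x)%R) = (`|c| `^ q)%:E * pint q f)%E.
Proof.
move=> mf; rewrite /pint -ge0_integralZl//.
- by apply: eq_integral => x _; rewrite normrM powRM.
- exact/measurable_EFinP/measurable_powR_norm.
Qed.

End nice.

(** * Duality of power integrals *)

Section duality.
Context d (T : measurableType d) (R : realType).
Variable mu : {measure set T -> \bar R}.
Variables p q : R.
Hypotheses (p1 : 1 < p) (q1 : 1 < q) (pq : p^-1 + q^-1 = 1).
Local Notation nice := (nice mu).
Local Notation pint := (pint mu).

Lemma conj_mulB1 : p * (q - 1) = q.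
Proof.
have p0 : p != 0 by rewrite gt_eqF// (lt_trans _ p1).
have q0 : q != 0 by rewrite gt_eqF// (lt_trans _ q1).
have : p * q * (p^-1 + q^-1) = p * q by rewrite pq mulr1.
rewrite (_ : p * q * (p^-1 + q^-1) = q + p); last by field; rewrite p0 q0.
by move=> H; rewrite mulrBr mulr1 -H; ring.
Qed.

Lemma nice_hoelder (f g : T -> R) : nice f -> nice g -> (pint p g <= 1)%E ->
  (`|\int[mu]_x (f x * g x)|%:E <= pint q f `^ q^-1)%E.
Proof.
move=> nf ng g1.
have [mf bf _] := nf; have [mg bg _] := ng.
have nfg := nice_mul ng mf bf.
have p0 : 0 < p by exact: lt_trans p1.
have q0 : 0 < q by exact: lt_trans q1.
rewrite EFin_normr_Rintegral//; last exact: nice_integrable.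
apply: (le_trans (le_abse_integral _ _ _)) => //.
  by apply/measurable_EFinP; case: nfg.
have := hoelder mu mf mg q0 p0; rewrite addrC => /(_ pq).
rewrite Lnorm1 unlock => /le_trans; apply.
rewrite (_ : (\int[mu]_x `|(EFin \o f) x| `^ q)%E = pint q f); last first.
  by apply: eq_integral => x _.
rewrite (_ : (\int[mu]_x `|(EFin \o g) x| `^ p)%E = pint p g); last first.
  by apply: eq_integral => x _.
rewrite -[leRHS]mule1; apply: lee_pmul => //; try exact: poweR_ge0.
rewrite -(poweR1r p^-1); apply: le_poweR => //; first by rewrite invr_ge0 ltW.
exact: pint_ge0.
Qed.

(** Test against a multiple of f |f|^(q-2); niceness makes the integral of |f|^q
    finite, so that one may divide by it. *)
Lemma nice_dual_norm (f : T -> R) (c : R) : 0 <= c -> nice f ->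
  (forall g, nice g -> (pint p g <= 1)%E -> `|\int[mu]_x (f x * g x)| <= c) ->
  (pint q f <= (c `^ q)%:E)%E.
Proof.
move=> c0 nf H.
have p0 : 0 < p by exact: lt_trans p1.
have q0 : 0 < q by exact: lt_trans q1.
have [mf [M fM] [A [mA Aoo A0]]] := nf.
have Ifin := nice_pint_fin q0 nf.
set I := fine (pint q f).
have IE : pint q f = I%:E by rewrite fineK.
rewrite IE lee_fin.
have I0 : 0 <= I by rewrite fine_ge0// pint_ge0.
have [->|I1] := eqVneq I 0; first exact: powR_ge0.
have {I1}I0 : 0 < I by rewrite lt_def I1.
pose h x := f x * `|f x| `^ (q - 2).
have hE x : `|h x| = `|f x| `^ (q - 1).
  rewrite normrM (ger0_norm (powR_ge0 _ _)).
  have [->|fx] := eqVneq (f x) 0; first by rewrite normr0 mul0r powR0// subr_eq0 gt_eqF.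
  rewrite -{1}(@powRr1 _ `|f x|)// -powRD; last by rewrite normr_eq0 fx implybT.
  by congr (_ `^ _); ring.
have fhE x : f x * h x = `|f x| `^ q.
  rewrite -[LHS]ger0_norm; last first.
    by rewrite /h mulrA mulr_ge0 ?powR_ge0// -expr2 sqr_ge0.
  by rewrite normrM hE mulr_powRB1.
have nh : nice h.
  split.
  - by apply: measurable_funM => //; exact: measurable_powR_norm.
  - exists (M `^ (q - 1)) => x; rewrite hE; have M0 : 0 <= M by exact: le_trans (fM x).
    by apply: ge0_ler_powR; rewrite ?nnegrE// subr_ge0 ltW.
  - by exists A; split => // x Ax; rewrite /h A0// mul0r.
pose g x := I `^ (- p^-1) * h x.
have ng : nice g by exact: niceZ.
have pg : pint p g = 1%E.
  rewrite pintZ//; last by case: nh.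
  rewrite ger0_norm ?powR_ge0// -powRrM mulNr mulVf ?gt_eqF// powR_inv1 ?ltW//.
  rewrite (_ : pint p h = I%:E); first by rewrite -EFinM mulVf// gt_eqF.
  by rewrite -IE; apply: eq_integral => x _; rewrite hE -powRrM mulrC conj_mulB1.
have := H g ng; rewrite pg lexx => /(_ isT).
have -> : \int[mu]_x (f x * g x) = I `^ (q^-1).
  under eq_Rintegral do rewrite /g mulrCA fhE.
  rewrite RintegralZl//; last exact: nice_integrable (nice_powR q0 nf).
  rewrite (_ : \int[mu]_x `|f x| `^ q = I)//.
  rewrite -{2}(@powRr1 _ I) ?ltW// -powRD ?(gt_eqF I0) ?implybT//.
  by congr (_ `^ _); rewrite -pq; ring.
rewrite ger0_norm ?powR_ge0// => Ic.
rewrite -(@powRr1 _ I) ?(ltW I0)// -[X in _ `^ X](@mulVf _ q) ?gt_eqF// powRrM.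
by apply: ge0_ler_powR; rewrite ?nnegrE ?powR_ge0 ?(ltW q0).
Qed.

End duality.

Lemma powR_sum_le (R : realType) (J : finType) (c : J -> R) (r : R) : 0 < r ->
  (forall j, 0 <= c j) ->
  (\sum_j c j) `^ r <= #|J|%:R `^ r * \sum_j c j `^ r.
Proof.
move=> r0 c0; have /(_ (fun j => c0 j)) := @poweR_sum_le R J (EFin \o c) r r0.
by rewrite /= !sumEFin poweR_EFin -EFinM lee_fin.
Qed.

(** * Mixed norms of kernels of finite rank *)

Section mixed_norm.
Context d1 d2 (T1 : measurableType d1) (T2 : measurableType d2) (R : realType).
Variable mu1 : {measure set T1 -> \bar R}.
Variable mu2 : {measure set T2 -> \bar R}.

(** For r = p / q this is the p-th power of the norm of k in L^p(L^q). *)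
Definition mixed (q r : R) (k : T1 -> T2 -> R) : \bar R :=
  (\int[mu1]_x (\int[mu2]_y (`|k x y| `^ q)%:E) `^ r)%E.

(** The crude bound by the n terms of the sum; it is useful only once the factors
    are balanced. *)
Lemma mixed_finite_rank_le n (A : 'I_n -> T1 -> R) (B : 'I_n -> T2 -> R)
    (p q a b : R) :
  1 < p -> 1 < q -> p^-1 + q^-1 = 1 -> 0 <= a -> 0 <= b ->
  (forall i, measurable_fun [set: T1] (A i)) ->
  (forall i, measurable_fun [set: T2] (B i)) ->
  (forall i, (pint mu1 p (A i) <= (a `^ p)%:E)%E) ->
  (forall i, (pint mu2 q (B i) <= (b `^ q)%:E)%E) ->
  (mixed q (p - 1) (fun x y => (\sum_i A i x * B i y)%R) <=
    ((n%:R ^+ 2 * a * b) `^ p)%:E)%E.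
Proof.
move=> p1 q1 pq a0 b0 mA mB Aa Bb.
have p0 : 0 < p by exact: lt_trans p1.
have q0 : 0 < q by exact: lt_trans q1.
have r0 : 0 < p - 1 by rewrite subr_gt0.
have qr : q * (p - 1) = p by rewrite conj_mulB1// addrC.
pose N : R := n%:R.
have N0 : 0 <= N by exact: ler0n.
have inner x : (\int[mu2]_y (`|\sum_i A i x * B i y| `^ q)%:E <=
    ((N * b) `^ q)%:E * \sum_i (`|A i x| `^ q)%:E)%E.
  apply: (@le_trans _ _ (\int[mu2]_y ((N `^ q)%:E *
      (\sum_i (`|A i x| `^ q)%:E * (`|B i y| `^ q)%:E)))%E).
    apply: ge0_le_lower_integral => y _; first by rewrite lee_fin powR_ge0.
    rewrite (eq_bigr (fun i => (`|A i x| `^ q * `|B i y| `^ q)%:E)); last by [].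
    rewrite sumEFin -EFinM lee_fin.
    apply: (@le_trans _ _ ((\sum_i `|A i x * B i y|) `^ q)).
      apply: ge0_ler_powR; rewrite ?nnegrE ?(ltW q0)//; first exact: sumr_ge0.
      exact: ler_norm_sum.
    apply: (le_trans (powR_sum_le q0 _)) => //.
    rewrite card_ord; apply: ler_wpM2l; first exact: powR_ge0.
    by apply: ler_sum => i _; rewrite normrM powRM.
  have mBq i : measurable_fun [set: T2] (fun y => (`|B i y| `^ q)%:E).
    exact/measurable_EFinP/measurable_powR_norm.
  have c0 z w : (0 <= (`|z : R| `^ w)%:E)%E by rewrite lee_fin powR_ge0.
  rewrite ge0_integralZl//; last 3 first.
  - by apply: emeasurable_sum => i; exact: measurable_funeM.
  - by move=> y _; apply: sume_ge0 => i _; exact: mule_ge0.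
  - by rewrite lee_fin powR_ge0.
  rewrite ge0_integral_sum//; last by move=> i; exact: measurable_funeM.
  rewrite powRM// EFinM -muleA; apply: lee_wpmul2l; first by rewrite lee_fin powR_ge0.
  rewrite ge0_sume_distrr//; apply: lee_sum => i _.
  rewrite ge0_integralZl// muleC; apply: lee_wpmul2r => //; exact: Bb.
apply: (@le_trans _ _ (\int[mu1]_x (((N * b) `^ p)%:E *
    ((N `^ (p - 1))%:E * \sum_i (`|A i x| `^ p)%:E)))%E).
  apply: ge0_le_lower_integral => x _; first exact: poweR_ge0.
  apply: (@le_trans _ _ ((((N * b) `^ q)%:E * (\sum_i (`|A i x| `^ q)%:E)) `^ (p - 1))%E).
    apply: le_poweR; [exact: ltW | | exact: inner].
    by apply: integral_ge0 => y _; rewrite lee_fin powR_ge0.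
  rewrite poweRM ?lee_fin ?powR_ge0//; last first.
    by apply: sume_ge0 => i _; rewrite lee_fin powR_ge0.
  rewrite poweR_EFin -powRrM qr; apply: lee_wpmul2l; first by rewrite lee_fin powR_ge0.
  apply: (le_trans (poweR_sum_le r0 _)); first by move=> j; rewrite lee_fin powR_ge0.
  rewrite card_ord; apply: lee_wpmul2l; first by rewrite lee_fin powR_ge0.
  by apply: lee_sum => i _; rewrite poweR_EFin -powRrM qr.
have mAp i : measurable_fun [set: T1] (fun y => (`|A i y| `^ p)%:E).
  exact/measurable_EFinP/measurable_powR_norm.
have msum : measurable_fun [set: T1] (fun x => \sum_i (`|A i x| `^ p)%:E)%E.
  exact: emeasurable_sum.
have s0 x : (0 <= \sum_i (`|A i x| `^ p)%:E)%E.
  by apply: sume_ge0 => i _; rewrite lee_fin powR_ge0.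
rewrite ge0_integralZl//; last 3 first.
- exact: measurable_funeM.
- by move=> x _; rewrite mule_ge0// lee_fin powR_ge0.
- by rewrite lee_fin powR_ge0.
rewrite ge0_integralZl//; last by rewrite lee_fin powR_ge0.
rewrite ge0_integral_sum//.
apply: (@le_trans _ _ (((N * b) `^ p)%:E * ((N `^ (p - 1))%:E * (\sum_(i < n) (a `^ p)%:E)))%E).
  apply: lee_wpmul2l; first by rewrite lee_fin powR_ge0.
  apply: lee_wpmul2l; first by rewrite lee_fin powR_ge0.
  by apply: lee_sum => i _; exact: Aa.
have E : N `^ p = N * N `^ (p - 1) by rewrite mulr_powRB1.
rewrite sumEFin -!EFinM lee_fin sumr_const card_ord -[a `^ p *+ n]mulr_natl -/N.
rewrite (_ : N ^+ 2 * a * b = N * b * (N * a)); last by ring.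
rewrite [leRHS]powRM ?mulr_ge0// [(N * a) `^ p]powRM// E.
by rewrite le_eqVlt; apply/orP; left; apply/eqP; ring.
Qed.

End mixed_norm.

Section finite_rank.
Context d1 d2 (T1 : measurableType d1) (T2 : measurableType d2) (R : realType).
Variable mu1 : {measure set T1 -> \bar R}.
Variable mu2 : {measure set T2 -> \bar R}.

(** The vectors of the integrals of be_i g, for g in the unit ball, enlarged by a cube
    of radius e so that they span R^n, form a bounded set D.  In a basis of nearly
    maximal determinant of D the coordinates of D are at most 2, which by duality
    bounds the new factors in y; and since the basis vectors come from functions g
    in the unit ball, the new factors in x are values of the operator, up to the
    perturbation by e. *)
Lemma finite_rank_factor n (al : 'I_n -> T1 -> R) (be : 'I_n -> T2 -> R)
    (p q N : R) :
  1 < p -> 1 < q -> p^-1 + q^-1 = 1 -> 0 < N ->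
  (forall i, nice mu1 (al i)) -> (forall i, nice mu2 (be i)) ->
  (forall g, nice mu2 g -> (pint mu2 p g <= 1)%E ->
    (pint mu1 p (fun x => (\sum_i al i x * \int[mu2]_y (be i y * g y))%R)
      <= (N `^ p)%:E)%E) ->
  exists (A : 'I_n -> T1 -> R) (B : 'I_n -> T2 -> R),
  [/\ forall i, nice mu1 (A i), forall i, nice mu2 (B i),
      forall x y, \sum_i al i x * be i y = \sum_i A i x * B i y,
      forall i, (pint mu1 p (A i) <= ((4 * N) `^ p)%:E)%E &
      forall i, (pint mu2 q (B i) <= (2 `^ q)%:E)%E].
Proof.
move=> p1 q1 pq N0 nal nbe H.
have p0 : 0 < p by exact: lt_trans p1.
have q0 : 0 < q by exact: lt_trans q1.
have nn0 : (0 : R) <= n%:R by exact: ler0n.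
(* R0 bounds the effect of the coefficients v, of size at most 1, so that e can be
   chosen with e^p R0 <= N^p. *)
pose R0 : R := n%:R `^ p * \sum_i fine (pint mu1 p (al i)).
have R00 : 0 <= R0.
  by rewrite mulr_ge0 ?powR_ge0// sumr_ge0// => i _; rewrite fine_ge0// pint_ge0.
have rho (v : 'I_n -> R) : (forall i, `|v i| <= 1) ->
    (pint mu1 p (fun x => \sum_i al i x * v i)%R <= R0%:E)%E.
  move=> v1; apply: (@le_trans _ _ (\int[mu1]_x ((n%:R `^ p)%:E *
      \sum_i (`|al i x| `^ p)%:E))%E).
    apply: ge0_le_lower_integral => x _; first by rewrite lee_fin powR_ge0.
    rewrite sumEFin -EFinM lee_fin.
    apply: (@le_trans _ _ ((\sum_i `|al i x|) `^ p)).
      apply: ge0_ler_powR; rewrite ?nnegrE ?(ltW p0)//; first exact: sumr_ge0.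
      apply: (le_trans (ler_norm_sum _ _ _)); apply: ler_sum => i _.
      by rewrite normrM ler_piMr.
    by apply: (le_trans (powR_sum_le p0 _)) => //; rewrite card_ord.
  have mal i : measurable_fun [set: T1] (fun y => (`|al i y| `^ p)%:E).
    by apply/measurable_EFinP/measurable_powR_norm; case: (nal i).
  rewrite ge0_integralZl//; last 2 first.
  - exact: emeasurable_sum.
  - by move=> x _; apply: sume_ge0 => i _; rewrite lee_fin powR_ge0.
  rewrite ge0_integral_sum//.
  rewrite /R0 EFinM -sumEFin; apply: lee_wpmul2l; first by rewrite lee_fin powR_ge0.
  apply: lee_sum => i _; rewrite fineK//; exact: nice_pint_fin.
pose e := N / (R0 + 1) `^ p^-1.
have R1 : 0 < R0 + 1 by rewrite ltr_wpDl.
have e0 : 0 < e by rewrite divr_gt0// powR_gt0.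
have eR0 : e `^ p * R0 <= N `^ p.
  rewrite powRM ?(ltW N0)// ?invr_ge0 ?powR_ge0// -powR_inv1 ?powR_ge0//.
  rewrite -!powRrM mulN1r mulrN mulVf ?gt_eqF// powR_inv1 ?(ltW R1)//.
  rewrite -mulrA ler_piMr ?powR_ge0// mulrC ler_pdivrMr// mul1r; lra.
pose cf (g : T2 -> R) : 'rV[R]_n := \row_i \int[mu2]_y (be i y * g y).
pose D : set 'rV[R]_n := [set c | exists g v, [/\ nice mu2 g, (pint mu2 p g <= 1)%E,
  forall i, `|v i| <= 1 & c = cf g + e *: \row_i v i]].
have pint0 : (pint mu2 p (fun=> 0%R) <= 1)%E.
  rewrite /pint (eq_integral (cst 0%E)); first by rewrite integral0.
  by move=> x _ /=; rewrite normr0 powR0// gt_eqF.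
have cf0 : cf (fun=> 0) = 0.
  apply/rowP => i; rewrite !mxE; under eq_Rintegral do rewrite mulr0.
  by rewrite Rintegral_cst// mul0r.
pose K := \sum_i fine (pint mu2 q (be i)) `^ q^-1 + e.
have DK c i : D c -> `|c 0 i| <= K.
  move=> [g [v [ng g1 v1 ->]]]; rewrite !mxE; apply: (le_trans (ler_normD _ _)).
  apply: lerD; last by rewrite normrM gtr0_norm// ler_piMr// ltW.
  have := nice_hoelder p1 q1 pq (nbe i) ng g1.
  rewrite -[pint _ _ _]fineK ?nice_pint_fin// poweR_EFin lee_fin => /le_trans; apply.
  rewrite (bigD1 i)//= lerDl; apply: sumr_ge0 => j _; exact: powR_ge0.
have De i : D (e *: delta_mx 0 i).
  exists (fun=> 0), (fun j => (j == i)%:R); split => //; first exact: nice0.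
    by move=> j; case: (j == i); rewrite ?normr1 ?normr0.
  by rewrite cf0 add0r; congr (_ *: _); apply/rowP => j; rewrite !mxE eqxx.
have [V [uV DV V2]] := near_maximal_basis e0 DK De.
exists (fun i x => \sum_k V i k * al k x).
exists (fun i y => \sum_k (invmx V) k i * be k y).
have nB i : nice mu2 (fun y => \sum_k (invmx V) k i * be k y).
  by apply: nice_sum => k; exact: niceZ.
split=> //.
- by move=> i; apply: nice_sum => k; exact: niceZ.
- move=> x y.
  transitivity (((\row_k be k y) *m invmx V *m V *m (\col_k al k x)) 0 0).
    rewrite mulmxKV// mxE; apply: eq_bigr => k _; rewrite !mxE; exact: mulrC.
  rewrite -mulmxA mxE; apply: eq_bigr => k _; rewrite mulrC !mxE; congr (_ * _).
    by apply: eq_bigr => j _; rewrite !mxE.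
  by apply: eq_bigr => j _; rewrite !mxE mulrC.
- move=> i; have [g [v [ng g1 v1 rV]]] := DV i.
  have Vk k : V i k = \int[mu2]_y (be k y * g y) + e * v k.
    by have := congr1 (fun c : 'rV_n => c 0 k) rV; rewrite !mxE.
  pose u x := \sum_k al k x * \int[mu2]_y (be k y * g y).
  pose w x := \sum_k al k x * v k.
  have mu_ : measurable_fun [set: T1] u.
    apply: measurable_sum => k; apply: measurable_funM; last exact: measurable_cst.
    by case: (nal k).
  have mw : measurable_fun [set: T1] w.
    apply: measurable_sum => k; apply: measurable_funM; last exact: measurable_cst.
    by case: (nal k).
  apply: (@le_trans _ _ (\int[mu1]_x ((2 `^ p)%:E * ((`|u x| `^ p)%:E + (`|e * w x| `^ p)%:E)))%E).
    apply: ge0_le_lower_integral => x _; first by rewrite lee_fin powR_ge0.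
    rewrite -EFinD -EFinM lee_fin.
    have -> : \sum_k V i k * al k x = u x + e * w x.
      rewrite /u /w mulr_sumr -big_split; apply: eq_bigr => k _ /=.
      by rewrite Vk; ring.
    apply: (@le_trans _ _ ((`|u x| + `|e * w x|) `^ p)).
      by apply: ge0_ler_powR; rewrite ?nnegrE ?(ltW p0) ?addr_ge0// ler_normD.
    have := @powR_sum_le R bool (fun b => if b then `|u x| else `|e * w x|) p p0.
    by rewrite !big_bool card_bool; apply; case.
  have m1 : measurable_fun [set: T1] (fun x => (`|u x| `^ p)%:E).
    exact/measurable_EFinP/measurable_powR_norm.
  have m2 : measurable_fun [set: T1] (fun x => (`|e * w x| `^ p)%:E).
    by apply/measurable_EFinP/measurable_powR_norm; exact: measurable_funM.
  rewrite ge0_integralZl//; last 2 first.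
  - exact: emeasurable_funD.
  - by move=> x _; rewrite adde_ge0// lee_fin powR_ge0.
  rewrite ge0_integralD//.
  have -> : (\int[mu1]_x (`|e * w x| `^ p)%:E = (e `^ p)%:E * pint mu1 p w)%E.
    by rewrite -[LHS]/(pint mu1 p (fun x => e * w x)) pintZ// gtr0_norm.
  apply: (@le_trans _ _ ((2 `^ p)%:E * ((N `^ p)%:E + (N `^ p)%:E))%E).
    apply: lee_wpmul2l; first by rewrite lee_fin powR_ge0.
    apply: leeD; first exact: H.
    apply: (@le_trans _ _ ((e `^ p)%:E * R0%:E)%E); last by rewrite -EFinM lee_fin.
    by apply: lee_wpmul2l; [rewrite lee_fin powR_ge0|exact: rho].
  rewrite -EFinD -EFinM lee_fin.
  have -> : 4 * N = 2 * (2 * N) by ring.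
  rewrite powRM ?mulr_ge0 ?(ltW N0)//; apply: ler_wpM2l; first exact: powR_ge0.
  have two : 2 <= 2 `^ p :> R.
    by rewrite -{1}(@powRr1 _ 2)// ler_powR ?(ltW p1)//; lra.
  rewrite powRM ?(ltW N0)//; have Np := powR_ge0 N p.
  nra.
- move=> i; apply: (nice_dual_norm p1 q1 pq) => // g ng g1.
  have Dg : D (cf g).
    exists g, (fun=> 0); split => //; first by move=> k; rewrite normr0.
    by rewrite (_ : \row__ _ = 0) ?scaler0 ?addr0//; apply/rowP => k; rewrite !mxE.
  have := V2 _ i Dg.
  rewrite (_ : (cf g *m _) 0 i =
    \int[mu2]_x ((\sum_k invmx V k i * be k x) * g x))//.
  under eq_Rintegral do rewrite mulr_suml.
  under eq_Rintegral do under eq_bigr do rewrite -mulrA.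
  rewrite nice_Rintegral_sum.
    by rewrite mxE; apply: eq_bigr => k _; rewrite mxE mulrC.
  by move=> k; apply: nice_mul => //; case: (nbe k).
Qed.

End finite_rank.

Lemma nice_common_bound d (T : measurableType d) (R : realType)
    (mu : {measure set T -> \bar R}) n (f : 'I_n -> T -> R) (r : R) :
  0 < r -> (forall i, nice mu (f i)) ->
  exists2 b, 0 <= b & forall i, (pint mu r (f i) <= (b `^ r)%:E)%E.
Proof.
move=> r0 nf; pose S := \sum_i fine (pint mu r (f i)).
have f0 i : 0 <= fine (pint mu r (f i)) by rewrite fine_ge0// pint_ge0.
have S0 : 0 <= S by exact: sumr_ge0.
exists (S `^ r^-1); first exact: powR_ge0.
move=> i; rewrite -powRrM mulVf ?gt_eqF// powRr1//.
rewrite -[pint _ _ _]fineK ?nice_pint_fin// lee_fin /S (bigD1 i)//= lerDl.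
exact: sumr_ge0.
Qed.

(** * From operator bounds to mixed norms *)

Section absorption.
Context d1 d2 (T1 : measurableType d1) (T2 : measurableType d2) (R : realType).
Variable mu1 : {sigma_finite_measure set T1 -> \bar R}.
Variable mu2 : {sigma_finite_measure set T2 -> \bar R}.
Variables (n : nat) (al : 'I_n -> T1 -> R) (be : 'I_n -> T2 -> R).
Variables (p q : R).
Hypotheses (p1 : 1 < p) (q1 : 1 < q) (pq : p^-1 + q^-1 = 1).
Hypotheses (nal : forall i, nice mu1 (al i)) (nbe : forall i, nice mu2 (be i)).
Let a x y := \sum_i al i x * be i y.
Let c : R := 16 * n%:R ^+ 2.
Let p0 : 0 < p. Proof. exact: lt_trans p1. Qed.
Let q0 : 0 < q. Proof. exact: lt_trans q1. Qed.
Let pqC : q^-1 + p^-1 = 1. Proof. by rewrite addrC. Qed.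

(** For arbitrary kernels the norm of the operator does not control the mixed norm;
    for kernels of rank n it does, at the cost of a constant of order n^2. *)
Lemma op_bound_mixed_bound (N : R) : 0 < N ->
  (forall g, nice mu2 g -> (pint mu2 p g <= 1)%E ->
    (pint mu1 p (fun x => (\sum_i al i x * \int[mu2]_y (be i y * g y))%R)
      <= (N `^ p)%:E)%E) ->
  (mixed mu1 mu2 q (p - 1) a <= ((c / 2 * N) `^ p)%:E)%E /\
  (mixed mu2 mu1 p (q - 1) (fun y x => a x y) <= ((c / 2 * N) `^ q)%:E)%E.
Proof.
move=> N0 H.
have [A [B [nA nB AB Ap Bq]]] := finite_rank_factor p1 q1 pq N0 nal nbe H.
have mA i : measurable_fun [set: T1] (A i) by case: (nA i).
have mB i : measurable_fun [set: T2] (B i) by case: (nB i).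
have N40 : 0 <= 4 * N by rewrite mulr_ge0// ltW.
split.
- have -> : a = fun x y => \sum_i A i x * B i y.
    apply/funext => x; apply/funext => y; exact: AB.
  have -> : c / 2 * N = n%:R ^+ 2 * (4 * N) * 2 by rewrite /c; field.
  exact: mixed_finite_rank_le.
- have -> : (fun y x => a x y) = fun y x => \sum_i B i y * A i x.
    apply/funext => y; apply/funext => x; rewrite [LHS]AB.
    by apply: eq_bigr => i _; rewrite mulrC.
  have -> : c / 2 * N = n%:R ^+ 2 * 2 * (4 * N) by rewrite /c; field.
  exact: mixed_finite_rank_le.
Qed.

Variables (X : set T1) (Y : set T2) (rho : T1 -> T2 -> R) (e : R).
Hypothesis alX : forall i x, ~ X x -> al i x = 0.
Hypothesis beY : forall i y, ~ Y y -> be i y = 0.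
Hypothesis mrho : measurable_fun [set: T1 * T2] (fun z => rho z.1 z.2).
Hypothesis rho1 : forall x y, X x -> Y y -> `|1 - rho x y| <= e.
Hypotheses (e0 : 0 <= e) (ec : c * e <= 2^-1).

Let ma : measurable_fun [set: T1 * T2] (fun z => a z.1 z.2).
Proof.
apply: measurable_sum => i; apply: measurable_funM.
- by apply: (measurableT_comp _ measurable_fst); case: (nal i).
- by apply: (measurableT_comp _ measurable_snd); case: (nbe i).
Qed.

Let na x : nice mu2 (a x).
Proof. by apply: nice_sum => i; exact: niceZ. Qed.

Let nar x : nice mu2 (fun y => (1 - rho x y) * a x y).
Proof.
have [_ [M aM] [A [mA Aoo aA]]] := na x; split.
- apply: measurable_funM; last by case: (na x).
  apply: measurable_funB => //.
  exact: (@measurable_fun_pair2 _ _ _ _ _ _ (fun z => rho z.1 z.2) x mrho).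
- exists (e * M) => y; rewrite normrM.
  have [Xx|Xx] := pselect (X x); last first.
    rewrite [a x y]big1; last by move=> i _; rewrite alX// mul0r.
    by rewrite normr0 mulr0 mulr_ge0// (le_trans _ (aM y)).
  have [Yy|Yy] := pselect (Y y); last first.
    rewrite [a x y]big1; last by move=> i _; rewrite beY// mulr0.
    by rewrite normr0 mulr0 mulr_ge0// (le_trans _ (aM y)).
  by apply: ler_pM => //; exact: rho1.
- by exists A; split => // y Ay; rewrite aA// mulr0.
Qed.

(** The operator with kernel a differs from the one with kernel rho a by at most
    e times the mixed norm H of a.  Hence H <= C (N + e H) with C depending on n
    only, and the last term is absorbed because H is finite.  The other mixed norm
    then follows from the bound on the operator with kernel a. *)
Lemma perturbed_op_bound_mixed_bound (N : R) : 0 < N ->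
  (forall g, nice mu2 g -> (pint mu2 p g <= 1)%E ->
    (pint mu1 p (fun x => (\int[mu2]_y (rho x y * a x y * g y))%R)
      <= (N `^ p)%:E)%E) ->
  (mixed mu1 mu2 q (p - 1) a <= ((2 * c * N) `^ p)%:E)%E /\
  (mixed mu2 mu1 p (q - 1) (fun y x => a x y) <= ((2 * c * N) `^ q)%:E)%E.
Proof.
move=> N0 H.
have c0 : 0 <= c by rewrite mulr_ge0// sqr_ge0.
have r0 : 0 < p - 1 by rewrite subr_gt0.
set h := mixed mu1 mu2 q (p - 1) a.
have h0 : (0 <= h)%E by apply: integral_ge0 => x _; exact: poweR_ge0.
have hfin : h \is a fin_num.
  have [b1 b10 H1] := nice_common_bound p0 nal.
  have [b2 b20 H2] := nice_common_bound q0 nbe.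
  rewrite ge0_fin_numE//; apply: le_lt_trans (ltry _).
  apply: (mixed_finite_rank_le p1 q1 pq b10 b20) => // i.
  - by case: (nal i).
  - by case: (nbe i).
pose h1 := fine h.
have hE : h = h1%:E by rewrite fineK.
have h10 : 0 <= h1 by rewrite fine_ge0.
pose F x : \bar R := (\int[mu2]_y (`|a x y| `^ q)%:E)%E.
have F0 x : (0 <= F x)%E by apply: integral_ge0 => y _; rewrite lee_fin powR_ge0.
have mF : measurable_fun [set: T1] F.
  apply: (measurable_param_integral mu2 (f := fun z => (`|a z.1 z.2| `^ q)%:E)).
  exact/measurable_EFinP/measurable_powR_norm.
have mFr : measurable_fun [set: T1] (fun x => F x `^ (p - 1))%E.
  exact: (measurableT_comp (measurable_poweR _)).
have step g : nice mu2 g -> (pint mu2 p g <= 1)%E ->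
    (pint mu1 p (fun x => (\sum_i al i x * \int[mu2]_y (be i y * g y))%R)
      <= (2 `^ p * (N `^ p + e `^ p * h1))%:E)%E.
  move=> ng g1; pose u x := \int[mu2]_y (rho x y * a x y * g y).
  have mg : measurable_fun [set: T2] g by case: ng.
  have mu_ : measurable_fun [set: T1] u.
    rewrite /u /Rintegral; apply: (measurableT_comp (f := fine)); first exact: fine_measurable.
    apply: (measurable_param_integral mu2
      (f := fun z => (rho z.1 z.2 * a z.1 z.2 * g z.2)%:E)).
    apply/measurable_EFinP; apply: measurable_funM; first exact: measurable_funM.
    exact: (measurableT_comp mg measurable_snd).
  have mup : measurable_fun [set: T1] (fun x => (`|u x| `^ p)%:E).
    exact/measurable_EFinP/measurable_powR_norm.
  apply: (@le_trans _ _ (\int[mu1]_x ((2 `^ p)%:E *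
      ((`|u x| `^ p)%:E + (e `^ p)%:E * F x `^ (p - 1))))%E).
    apply: ge0_le_lower_integral => x _; first by rewrite lee_fin powR_ge0.
    set v := \sum_i _.
    have vE : v = \int[mu2]_y (a x y * g y).
      rewrite /v -nice_Rintegral_sum; last first.
        by move=> i; apply: nice_mul => //; [case: (nbe i)|case: (nbe i)].
      apply: eq_Rintegral => y _; rewrite mulr_suml.
      by apply: eq_bigr => i _; rewrite mulrA.
    have nag : nice mu2 (fun y => a x y * g y).
      by apply: nice_mul => //; case: (na x).
    have nrag : nice mu2 (fun y => (1 - rho x y) * a x y * g y).
      by apply: nice_mul => //; case: (nar x).
    have vu : v - u x = \int[mu2]_y ((1 - rho x y) * a x y * g y).
      have -> : u x = \int[mu2]_y (a x y * g y + (-1) * ((1 - rho x y) * a x y * g y)).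
        by apply: eq_Rintegral => y _; ring.
      rewrite RintegralD//; last 2 first.
      - exact: nice_integrable.
      - by apply: nice_integrable; exact: niceZ.
      rewrite RintegralZl//; last exact: nice_integrable.
      by rewrite -vE; ring.
    have vub : (`|v - u x|%:E <= e%:E * F x `^ q^-1)%E.
      rewrite vu; apply: (le_trans (nice_hoelder p1 q1 pq (nar x) ng g1)).
      rewrite -[e%:E](@poweRK _ _ q)// ?lee_fin// -poweRM//; last exact: poweR_ge0.
      apply: le_poweR; [by rewrite invr_ge0 ltW|exact: pint_ge0|].
      have eq0 : (0 <= (e `^ q)%:E)%E by rewrite lee_fin powR_ge0.
      rewrite poweR_EFin -ge0_integralZl//; last first.
        by apply/measurable_EFinP/measurable_powR_norm; case: (na x).
      apply: ge0_le_lower_integral => y _; first by rewrite lee_fin powR_ge0.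
      rewrite -EFinM lee_fin -powRM// ; apply: ge0_ler_powR; rewrite ?nnegrE ?(ltW q0)//.
        by rewrite mulr_ge0.
      rewrite normrM.
      have [Xx|Xx] := pselect (X x); last first.
        rewrite [a x y]big1 ?normr0 ?mulr0//; last by move=> i _; rewrite alX// mul0r.
      have [Yy|Yy] := pselect (Y y); last first.
        rewrite [a x y]big1 ?normr0 ?mulr0//; last by move=> i _; rewrite beY// mulr0.
      by apply: ler_wpM2r => //; exact: rho1.
    have vub' : ((`|v - u x| `^ p)%:E <= (e `^ p)%:E * F x `^ (p - 1))%E.
      rewrite -poweR_EFin; apply: (le_trans (le_poweR (ltW p0) _ vub)).
        by rewrite lee_fin.
      rewrite poweRM ?lee_fin ?poweR_ge0// poweR_EFin -poweRrM.
      have -> : q^-1 * p = p - 1.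
        by rewrite -[X in q^-1 * X](conj_mulB1 q1 p1 pqC) mulKf// gt_eqF.
      by [].
    apply: (@le_trans _ _ ((2 `^ p)%:E * ((`|u x| `^ p)%:E + (`|v - u x| `^ p)%:E))%E).
      rewrite -EFinD -EFinM lee_fin.
      apply: (@le_trans _ _ ((`|u x| + `|v - u x|) `^ p)).
        apply: ge0_ler_powR; rewrite ?nnegrE ?(ltW p0) ?addr_ge0//.
        by rewrite -{1}[v](subrK (u x)) addrC ler_normD.
      have := @powR_sum_le R bool (fun b => if b then `|u x| else `|v - u x|) p p0.
      by rewrite !big_bool card_bool; apply; case.
    apply: lee_wpmul2l; first by rewrite lee_fin powR_ge0.
    exact: leeD2l.
  rewrite ge0_integralZl//; last 2 first.
  - by apply: emeasurable_funD => //; exact: measurable_funeM.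
  - by move=> x _; rewrite adde_ge0 ?mule_ge0 ?lee_fin ?powR_ge0 ?poweR_ge0.
  rewrite ge0_integralD//; last 2 first.
  - by move=> x _; rewrite mule_ge0 ?lee_fin ?powR_ge0 ?poweR_ge0.
  - exact: measurable_funeM.
  rewrite ge0_integralZl//; last 2 first.
  - by move=> x _; exact: poweR_ge0.
  - by rewrite lee_fin powR_ge0.
  rewrite EFinM EFinD EFinM; apply: lee_wpmul2l; first by rewrite lee_fin powR_ge0.
  by apply: leeD; [exact: H|rewrite -hE].
(* The bound on the operator with kernel a, still in terms of h1. *)
pose M := (2 `^ p * (N `^ p + e `^ p * h1)) `^ p^-1.
have Mp : M `^ p = 2 `^ p * (N `^ p + e `^ p * h1).
  rewrite -powRrM mulVf ?gt_eqF// powRr1//.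
  by rewrite mulr_ge0 ?addr_ge0 ?mulr_ge0 ?powR_ge0.
have Np : 0 < N `^ p by exact: powR_gt0.
have M0 : 0 < M.
  by rewrite powR_gt0// mulr_gt0 ?powR_gt0// ltr_wpDr// mulr_ge0 ?powR_ge0.
have [|Hp Hq] := @op_bound_mixed_bound M M0.
  by move=> g ng g1; rewrite Mp; exact: step.
have half : (2^-1 : R) `^ p <= 2^-1.
  by rewrite -[leRHS](@powRr1 _ 2^-1)// ger_powR ?(ltW p1)//; lra.
have ecp : c `^ p * e `^ p <= 2^-1.
  rewrite -powRM//; apply: le_trans half.
  by apply: ge0_ler_powR; rewrite ?nnegrE ?(ltW p0) ?mulr_ge0//; lra.
have Hb : h1 <= 2 * (c `^ p * N `^ p).
  move: Hp; rewrite -/h hE lee_fin powRM ?(ltW M0)//; last by rewrite mulr_ge0.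
  rewrite Mp mulrA -powRM// ?mulr_ge0// divfK// => Hp.
  have : c `^ p * e `^ p * h1 <= 2^-1 * h1 by exact: ler_wpM2r.
  by move: Hp; rewrite mulrDr mulrA; lra.
have two : 2 <= 2 `^ p :> R.
  by rewrite -{1}(@powRr1 _ 2)// ler_powR ?(ltW p1)//; lra.
have hb : h1 <= (2 * c * N) `^ p.
  rewrite -mulrA powRM ?mulr_ge0 ?(ltW N0)// powRM ?(ltW N0)//.
  apply: (le_trans Hb); apply: ler_wpM2r => //.
  by rewrite mulr_ge0 ?powR_ge0.
split; first by rewrite -/h hE lee_fin.
apply: (le_trans Hq); rewrite lee_fin.
apply: ge0_ler_powR; rewrite ?nnegrE ?(ltW q0) ?mulr_ge0 ?(ltW M0) ?(ltW N0)//.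
(* With h1 bounded, M is at most 4 N, which bounds the other mixed norm. *)
suff M4 : M <= 4 * N.
  have -> : 2 * c * N = c / 2 * (4 * N) by field.
  by apply: ler_wpM2l => //; rewrite mulr_ge0.
rewrite -[leRHS](@powRr1 _ (4 * N)) ?mulr_ge0 ?(ltW N0)//.
rewrite -[X in _ <= _ `^ X](@mulfV _ p) ?gt_eqF// powRrM.
apply: ge0_ler_powR; rewrite ?nnegrE ?invr_ge0 ?(ltW p0) ?powR_ge0//.
  by rewrite -Mp powR_ge0.
have -> : 4 * N = 2 * (2 * N) by ring.
rewrite powRM ?mulr_ge0 ?(ltW N0)//; apply: ler_wpM2l; first exact: powR_ge0.
rewrite powRM ?(ltW N0)//.
have : e `^ p * h1 <= N `^ p.
  have : e `^ p * h1 <= e `^ p * (2 * (c `^ p * N `^ p)).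
    by apply: ler_wpM2l => //; exact: powR_ge0.
  have : c `^ p * e `^ p * N `^ p <= 2^-1 * N `^ p by apply: ler_wpM2r => //; exact: ltW.
  by rewrite [e `^ p * (2 * _)](_ : _ = 2 * (c `^ p * e `^ p * N `^ p)); [lra|ring].
nra.
Qed.

End absorption.

(** * Functional calculus of positive definite matrices *)

Section diagonalized.
Context (F : fieldType) (m : nat) (P : 'M[F]_m).
Hypothesis uP : P \in unitmx.
Implicit Types u v : 'rV[F]_m.

Definition diagonalized u := invmx P *m diag_mx u *m P.

Lemma diagonalizedE u i j :
  diagonalized u i j = \sum_k u 0 k * (invmx P i k * P k j).
Proof.
rewrite /diagonalized mul_mx_diag [LHS]mxE; apply: eq_bigr => k _.
by rewrite mxE mulrCA mulrA.
Qed.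

Lemma diagonalizedM u v :
  diagonalized u *m diagonalized v = diagonalized (\row_k (u 0 k * v 0 k)).
Proof.
rewrite /diagonalized !mulmxA mulmxK//.
by rewrite -(mulmxA (invmx P) (diag_mx u)) mulmx_diag.
Qed.

Lemma diagonalizedD u v : diagonalized u + diagonalized v = diagonalized (u + v).
Proof.
by rewrite /diagonalized [diag_mx (u + v)]raddfD mulmxDr mulmxDl.
Qed.

Lemma diagonalized_cst c : diagonalized (const_mx c) = c%:M.
Proof.
rewrite /diagonalized diag_const_mx scalar_mxC -mulmxA mulVmx//.
by rewrite mulmx1.
Qed.

Lemma diagonalized_entry u k :
  (row k P *m diagonalized u *m col k (invmx P)) 0 0 = u 0 k.
Proof.
rewrite rowE colE /diagonalized !mulmxA mulmxK// mulmxK//.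
by rewrite -mulmxA -colE -rowE !mxE eqxx mulr1n.
Qed.

End diagonalized.

Section functional_calculus.
Context (R : realType).
Local Notation C := R[i].

Lemma Re_mulc (z w : C) : complex.Re (z * w) =
  complex.Re z * complex.Re w - complex.Im z * complex.Im w.
Proof. by case: z w => [a b] [c e]. Qed.

Lemma Im_mulc (z w : C) : complex.Im (z * w) =
  complex.Re z * complex.Im w + complex.Im z * complex.Re w.
Proof. by case: z w => [a b] [c e]. Qed.

Lemma Re_invc (z : C) : complex.Re z^-1 =
  complex.Re z * (complex.Re z ^+ 2 + complex.Im z ^+ 2)^-1.
Proof. by case: z => a b. Qed.

Lemma Im_invc (z : C) : complex.Im z^-1 =
  - complex.Im z * (complex.Re z ^+ 2 + complex.Im z ^+ 2)^-1.
Proof. by case: z => a b /=; rewrite mulNr. Qed.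

(** The value of f at A, computed on the eigenvalues; for positive definite A these
    are positive reals. *)
Definition mxfun m (f : R -> R) (A : 'M[C]_m) : 'M[C]_m :=
  diagonalized (spectralmx A) (\row_k (f (complex.Re (spectral_diag A 0 k)))%:C%C).

Context (m : nat).
Implicit Types A : 'M[C]_m.

Lemma mxpowE A a : mxpow A a = mxfun (fun t => t `^ a) A.
Proof.
rewrite /mxpow /mxfun; apply: (congr1 (diagonalized (spectralmx A))).
by apply/rowP => k; rewrite [LHS]mxE [RHS]mxE.
Qed.

Lemma mxfunE f A i j : mxfun f A i j =
  \sum_k (f (complex.Re (spectral_diag A 0 k)))%:C%C *
         (invmx (spectralmx A) i k * spectralmx A k j).
Proof.
apply: etrans (diagonalizedE _ _ _ _) _; apply: eq_bigr => k _.
by apply: (congr1 (fun c => c * _)); rewrite mxE.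
Qed.

Lemma mxfunM f g A : mxfun f A *m mxfun g A = mxfun (fun t => f t * g t) A.
Proof.
apply: etrans (diagonalizedM (spectral_unit A) _ _) _.
apply: (congr1 (diagonalized (spectralmx A))).
by apply/rowP => k; rewrite [LHS]mxE [RHS]mxE rmorphM mxE mxE.
Qed.

Lemma mxfunD f g A : mxfun f A + mxfun g A = mxfun (fun t => f t + g t) A.
Proof.
apply: etrans (diagonalizedD _ _ _) _.
apply: (congr1 (diagonalized (spectralmx A))).
by apply/rowP => k; rewrite [LHS]mxE [RHS]mxE rmorphD mxE mxE.
Qed.

Lemma mxfun_cst c A : mxfun (fun=> c) A = (c%:C%C)%:M.
Proof.
apply: etrans (diagonalized_cst (spectral_unit A) _).
apply: (congr1 (diagonalized (spectralmx A))).
by apply/rowP => k; rewrite [LHS]mxE [RHS]mxE.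
Qed.

(** The k-th eigenvalue is the value of the form of A at the k-th eigenvector. *)
Lemma posdef_spectrum A : posdefmx A -> forall k,
  0 < complex.Re (spectral_diag A 0 k) /\
  (complex.Re (spectral_diag A 0 k))%:C%C = spectral_diag A 0 k.
Proof.
move=> [hA pA] k.
have : A = diagonalized (spectralmx A) (spectral_diag A).
  exact: (orthomx_spectralP (hermitian_normalmx hA)).
have := spectral_unitarymx A.
move: (spectralmx A) (spectral_diag A) => P D uP AE.
have iP := invmx_unitary uP.
pose v := col k (invmx P).
have uP' : P \in unitmx by exact: unitarymx_unit.
have v0 : v != 0.
  apply/eqP => vk; have := diagonalized_entry uP' (const_mx 1) k.
  rewrite -/v vk mulmx0 [LHS]mxE [RHS]mxE => /esym/eqP.
  by rewrite oner_eq0.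
have vP : (map_mx Num.conj v)^T = row k P.
  apply/rowP => j; rewrite [LHS]mxE [LHS]mxE [X in Num.conj X]mxE iP.
  by rewrite [X in Num.conj X]mxE [X in Num.conj (Num.conj X)]mxE conjCK mxE.
have := pA v v0.
have -> : ((map_mx Num.conj v)^T *m A *m v) 0 0 = D 0 k.
  by rewrite vP AE; exact: diagonalized_entry.
rewrite ltcE /= => /andP[/eqP im re]; split; first exact: re.
by case: (D 0 k) im => a b /= ->.
Qed.

Lemma eq_mxfun f g A : posdefmx A -> (forall t, 0 < t -> f t = g t) ->
  mxfun f A = mxfun g A.
Proof.
move=> pA fg; apply: (congr1 (diagonalized (spectralmx A))).
apply/rowP => k; rewrite [LHS]mxE [RHS]mxE.
by rewrite fg//; have [] := posdef_spectrum pA k.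
Qed.

Lemma mxfun_id A : posdefmx A -> mxfun id A = A.
Proof.
move=> pA.
apply: etrans (esym (orthomx_spectralP (hermitian_normalmx pA.1))).
apply: (congr1 (diagonalized (spectralmx A))).
apply/rowP => k; rewrite [LHS]mxE.
by have [] := posdef_spectrum pA k.
Qed.

Lemma mxfunMV f g A : posdefmx A -> (forall t, 0 < t -> f t * g t = 1) ->
  mxfun f A *m mxfun g A = 1%:M.
Proof.
move=> pA fg; apply: etrans (mxfunM f g A) _.
by apply: etrans (eq_mxfun pA fg) _; apply: etrans (mxfun_cst 1 A) _.
Qed.

Lemma mxfun_inv f A : posdefmx A -> (forall t, 0 < t -> f t != 0) ->
  mxfun f A \in unitmx /\ mxfun (fun t => (f t)^-1) A = invmx (mxfun f A).
Proof.
move=> pA f0.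
have E : mxfun f A *m mxfun (fun t => (f t)^-1) A = 1%:M.
  by apply: mxfunMV => // t t0; rewrite divff ?f0.
have [uf _] := mulmx1_unit E; split; first exact: uf.
by apply: etrans (esym (mulKmx uf _)) _; rewrite E mulmx1.
Qed.

Lemma mxpowVr A a : posdefmx A -> mxpow A a *m mxpow A (- a) = 1%:M.
Proof.
move=> pA; rewrite mxpowE mxpowE; apply: mxfunMV => // t t0.
by rewrite powRN divff// gt_eqF// powR_gt0.
Qed.

End functional_calculus.

(** * Measurability of matrix functions and of their powers *)

Section measurable_complex.
Context d (T : measurableType d) (R : realType).
Local Notation C := R[i].

Definition cmeas (h : T -> C) :=
  measurable_fun [set: T] (fun x => complex.Re (h x)) /\
  measurable_fun [set: T] (fun x => complex.Im (h x)).

Definition mxmeas m n (W : T -> 'M[C]_(m, n)) := forall i j, cmeas (fun x => W x i j).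

Lemma measurable_funV_ge0 (h : T -> R) : (forall x, 0 <= h x) ->
  measurable_fun [set: T] h -> measurable_fun [set: T] (fun x => (h x)^-1).
Proof.
move=> h0 mh; rewrite (_ : (fun x => _) = (fun x => h x `^ (-1))).
  exact: (measurableT_comp (measurable_powR _)).
by apply/funext => x; rewrite powR_inv1.
Qed.

Lemma cmeas_cst c : cmeas (fun=> c).
Proof. by split; exact: measurable_cst. Qed.

Lemma cmeasD h k : cmeas h -> cmeas k -> cmeas (fun x => h x + k x).
Proof.
move=> [h1 h2] [k1 k2]; split.
- by under eq_fun do rewrite raddfD; exact: measurable_funD.
- by under eq_fun do rewrite raddfD; exact: measurable_funD.
Qed.

Lemma cmeasM h k : cmeas h -> cmeas k -> cmeas (fun x => h x * k x).
Proof.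
move=> [h1 h2] [k1 k2]; split.
- by under eq_fun do rewrite Re_mulc; apply: measurable_funB; exact: measurable_funM.
- by under eq_fun do rewrite Im_mulc; apply: measurable_funD; exact: measurable_funM.
Qed.

Lemma cmeasV h : cmeas h -> cmeas (fun x => (h x)^-1).
Proof.
move=> [h1 h2].
have mn : measurable_fun [set: T]
    (fun x => (complex.Re (h x) ^+ 2 + complex.Im (h x) ^+ 2)^-1).
  apply: measurable_funV_ge0; first by move=> x; rewrite addr_ge0 ?sqr_ge0.
  by apply: measurable_funD; exact: measurable_funX.
split.
- by under eq_fun do rewrite Re_invc; exact: measurable_funM.
- under eq_fun do rewrite Im_invc; apply: measurable_funM => //.
  exact: measurable_funN.
Qed.

Lemma cmeas_sum (J : Type) (s : seq J) (h : J -> T -> C) :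
  (forall j, cmeas (h j)) -> cmeas (fun x => \sum_(j <- s) h j x).
Proof.
move=> mh; elim: s => [|j s IH].
  by under eq_fun do rewrite big_nil; exact: cmeas_cst.
by under eq_fun do rewrite big_cons; exact: cmeasD.
Qed.

Lemma cmeas_prod (J : Type) (s : seq J) (h : J -> T -> C) :
  (forall j, cmeas (h j)) -> cmeas (fun x => \prod_(j <- s) h j x).
Proof.
move=> mh; elim: s => [|j s IH].
  by under eq_fun do rewrite big_nil; exact: cmeas_cst.
by under eq_fun do rewrite big_cons; exact: cmeasM.
Qed.

Lemma mxmeasM m n q (U : T -> 'M[C]_(m, n)) (V : T -> 'M[C]_(n, q)) :
  mxmeas U -> mxmeas V -> mxmeas (fun x => U x *m V x).
Proof.
move=> mU mV i j; under eq_fun do rewrite mxE.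
by apply: cmeas_sum => k; exact: cmeasM.
Qed.

Lemma mxmeasD m n (U V : T -> 'M[C]_(m, n)) :
  mxmeas U -> mxmeas V -> mxmeas (fun x => U x + V x).
Proof. by move=> mU mV i j; under eq_fun do rewrite mxE; exact: cmeasD. Qed.

Lemma cmeas_det m (W : T -> 'M[C]_m) : mxmeas W -> cmeas (fun x => \det (W x)).
Proof.
move=> mW; rewrite /determinant; apply: cmeas_sum => s.
by apply: cmeasM; [exact: cmeas_cst|exact: cmeas_prod].
Qed.

Lemma mxmeas_inv m (W : T -> 'M[C]_m) : mxmeas W ->
  (forall x, W x \in unitmx) -> mxmeas (fun x => invmx (W x)).
Proof.
move=> mW uW i j.
under eq_fun => x do rewrite /invmx uW mxE [X in _ * X]mxE.
apply: cmeasM; first by apply: cmeasV; exact: cmeas_det.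
apply: cmeasM; first exact: cmeas_cst.
by apply: cmeas_det => k l; under eq_fun do rewrite !mxE.
Qed.

Lemma cmeas_cvg (h : nat -> T -> C) (k : T -> C) :
  (forall n, cmeas (h n)) ->
  (forall x, (fun n => complex.Re (h n x)) @ \oo --> complex.Re (k x)) ->
  (forall x, (fun n => complex.Im (h n x)) @ \oo --> complex.Im (k x)) ->
  cmeas k.
Proof.
move=> mh hR hI; split.
- by apply: (measurable_fun_cvg (h := fun n x => complex.Re (h n x))) => // n; case: (mh n).
- by apply: (measurable_fun_cvg (h := fun n x => complex.Im (h n x))) => // n; case: (mh n).
Qed.

End measurable_complex.

Lemma cvg_sum_scaled (R : realType) (J : finType) (u : nat -> J -> R) (l c : J -> R) :
  (forall j, (fun n => u n j) @ \oo --> l j) ->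
  (fun n => \sum_j u n j * c j) @ \oo --> \sum_j l j * c j.
Proof.
move=> ul; have H (r : seq J) : (fun n => \sum_(j <- r) u n j * c j) @ \oo -->
    \sum_(j <- r) l j * c j.
  elim: r => [|j r IH].
    by under eq_fun do rewrite big_nil; rewrite big_nil; exact: cvg_cst.
  under eq_fun do rewrite big_cons; rewrite big_cons.
  by apply: cvgD => //; apply: cvgMl; exact: ul.
exact: H.
Qed.

(** The error of the iteration at least halves at each step. *)
Lemma heron_dist (R : realType) (t : R) (X : nat -> R) : 0 < t -> X 0%N = 1 + t ->
  (forall n, X n.+1 = (X n + t * (X n)^-1) * 2^-1) ->
  forall n, Num.sqrt t <= X n /\ X n - Num.sqrt t <= (1 + t) * 2^-1 ^+ n.
Proof.
move=> t0 X0 XS; set s := Num.sqrt t.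
have s0 : 0 < s by rewrite sqrtr_gt0.
have ss : t = s ^+ 2 by rewrite sqr_sqrtr// ltW.
elim=> [|n [IH1 IH2]].
  rewrite X0 expr0 mulr1 gerBl (ltW s0); split => //.
  by rewrite ss; have := sqr_ge0 (s - 2^-1); nra.
have Xn0 : 0 < X n by exact: lt_le_trans IH1.
have E : X n.+1 - s = (X n - s) ^+ 2 / (X n * 2).
  by rewrite XS ss; field; rewrite gt_eqF.
split; first by rewrite -subr_ge0 E divr_ge0 ?sqr_ge0// mulr_ge0// ltW.
have -> : (1 + t) * 2^-1 ^+ n.+1 = 2^-1 * ((1 + t) * 2^-1 ^+ n).
  by rewrite exprS; ring.
apply: (@le_trans _ _ (2^-1 * (X n - s))); last by rewrite ler_pM2l// invr_gt0.
by rewrite E ler_pdivrMr ?mulr_gt0//; nra.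
Qed.

Section measurable_calculus.
Context d (T : measurableType d) (R : realType) (m : nat).
Local Notation C := R[i].
Variable W : T -> 'M[C]_m.
Hypotheses (mW : mxmeas W) (pW : forall x, posdefmx (W x)).

Let S (f : R -> R) := mxmeas (fun x => mxfun f (W x)).

Lemma eq_mxmeas n q (U V : T -> 'M[C]_(n, q)) :
  (forall x, U x = V x) -> mxmeas U -> mxmeas V.
Proof. by move=> /funext ->. Qed.

Let S_eq f g : (forall x, mxfun f (W x) = mxfun g (W x)) -> S f -> S g.
Proof. exact: (@eq_mxmeas m m (fun x => mxfun f (W x)) (fun x => mxfun g (W x))). Qed.

Let S_cst c : S (fun=> c).
Proof.
apply: (@eq_mxmeas m m (fun=> (c%:C%C)%:M) (fun x => mxfun (fun=> c) (W x))).
  by move=> x; exact: esym (mxfun_cst c (W x)).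
by move=> i j; exact: cmeas_cst.
Qed.

Let S_id : S id.
Proof.
exact: (@eq_mxmeas m m W (fun x => mxfun id (W x))
  (fun x => esym (mxfun_id (pW x))) mW).
Qed.

Let S_M f g : S f -> S g -> S (fun t => f t * g t).
Proof.
move=> Sf Sg.
exact: (@eq_mxmeas m m (fun x => mxfun f (W x) *m mxfun g (W x))
  (fun x => mxfun (fun t => f t * g t) (W x))
  (fun x => mxfunM f g (W x)) (mxmeasM Sf Sg)).
Qed.

Let S_D f g : S f -> S g -> S (fun t => f t + g t).
Proof.
move=> Sf Sg.
exact: (@eq_mxmeas m m (fun x => mxfun f (W x) + mxfun g (W x))
  (fun x => mxfun (fun t => f t + g t) (W x))
  (fun x => mxfunD f g (W x)) (mxmeasD Sf Sg)).
Qed.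

Let S_V f : (forall t, 0 < t -> f t != 0) -> S f -> S (fun t => (f t)^-1).
Proof.
move=> f0 Sf.
exact: (@eq_mxmeas m m (fun x => invmx (mxfun f (W x)))
  (fun x => mxfun (fun t => (f t)^-1) (W x))
  (fun x => esym (mxfun_inv (pW x) f0).2)
  (mxmeas_inv Sf (fun x => (mxfun_inv (pW x) f0).1))).
Qed.

Let S_cvg (f : nat -> R -> R) g : (forall n, S (f n)) ->
  (forall t, 0 < t -> f ^~ t @ \oo --> g t) -> S g.
Proof.
move=> Sf fg i j.
have E (h : R -> R) x : complex.Re (mxfun h (W x) i j) =
    \sum_k h (complex.Re (spectral_diag (W x) 0 k)) *
      complex.Re (invmx (spectralmx (W x)) i k * spectralmx (W x) k j) /\
    complex.Im (mxfun h (W x) i j) =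
    \sum_k h (complex.Re (spectral_diag (W x) 0 k)) *
      complex.Im (invmx (spectralmx (W x)) i k * spectralmx (W x) k j).
  rewrite mxfunE !raddf_sum; split; apply: eq_bigr => k _ /=.
  - by rewrite Re_mulc /= mul0r subr0.
  - by rewrite Im_mulc /= mul0r addr0.
apply: (cmeas_cvg (h := fun n x => mxfun (f n) (W x) i j)).
- by move=> n; exact: Sf.
- move=> x; under eq_fun do rewrite (E _ _).1.
  rewrite (E _ _).1; apply: cvg_sum_scaled => k.
  by apply: fg; have [] := posdef_spectrum (pW x) k.
- move=> x; under eq_fun do rewrite (E _ _).2.
  rewrite (E _ _).2; apply: cvg_sum_scaled => k.
  by apply: fg; have [] := posdef_spectrum (pW x) k.
Qed.

Let S_sqrt (f : R -> R) : (forall t : R, 0 < t -> 0 < f t) -> S f -> S (fun t => Num.sqrt (f t)).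
Proof.
move=> f0 Sf.
(* Heron's iteration for the square root of f t, started at 1 + f t. *)
pose X := fix X (n : nat) : R -> R := if n is n'.+1 then
   fun t : R => (X n' t + f t * (X n' t)^-1) * 2^-1 else fun t : R => 1 + f t.
have XE (t : R) (t0 : 0 < t) n :=
  @heron_dist R (f t) (fun n => X n t) (f0 t t0) erefl (fun n => erefl) n.
have X0 n (t : R) : 0 < t -> X n t != 0.
  move=> t0; rewrite gt_eqF//; apply: lt_le_trans ((XE t t0 n).1).
  by rewrite sqrtr_gt0 f0.
have SX n : S (X n).
  elim: n => [|n IH]; first exact: (S_D (f := fun=> 1) (g := f) (S_cst 1) Sf).
  have XE' : X n.+1 = fun t => (X n t + f t * (X n t)^-1) * 2^-1 by [].
  have SV : S (fun t => (X n t)^-1) by apply: S_V => // t; exact: X0.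
  have SD := S_D IH (S_M Sf SV).
  by rewrite XE'; exact: (S_M SD (S_cst 2^-1)).
apply: (S_cvg SX) => t t0.
apply/cvgrPdist_le => e e0.
have g0 : (fun n => (1 + f t) * 2^-1 ^+ n) @ \oo --> (0 : R).
  rewrite -(mulr0 (1 + f t)); apply: cvgMr; apply: cvg_expr.
  by rewrite ger0_norm; lra.
have /cvgrPdist_le /(_ e e0) := g0; apply: filterS => n /=.
rewrite sub0r normrN => H; have [H1 H2] := XE t t0 n.
rewrite distrC ger0_norm ?subr_ge0//; apply: (le_trans H2).
by apply: le_trans H; exact: ler_norm.
Qed.

Let S_dyadic n : S (fun t => t `^ (2^-1 ^+ n)).
Proof.
have S1 : forall f g, (forall t, 0 < t -> f t = g t) -> S f -> S g.
  by move=> f g fg; exact: (S_eq (fun x => eq_mxfun (pW x) fg)).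
elim: n => [|n IH].
  by apply: (S1 _ _ _ S_id) => t t0; rewrite expr0 powRr1// ltW.
apply: (S1 _ _ _ (S_sqrt _ IH)); last by move=> t t0; exact: powR_gt0.
by move=> t t0; rewrite -powR12_sqrt ?powR_ge0// -powRrM exprSr.
Qed.

Let S_pow_nneg a : 0 <= a -> S (fun t => t `^ a).
Proof.
move=> a0.
pose k n := Num.truncn (a * 2 ^+ n).
apply: (@S_cvg (fun n t => t `^ ((k n)%:R * 2^-1 ^+ n))).
  move=> n; have H : forall j, S (fun t => t `^ (j%:R * 2^-1 ^+ n)).
    elim=> [|j IH].
      have E0 (t : R) : 0 < t -> 1 = t `^ (0%:R * 2^-1 ^+ n) by rewrite mul0r powRr0.
      exact: (S_eq (fun x => eq_mxfun (pW x) E0) (S_cst 1)).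
    have ES (t : R) : 0 < t -> t `^ (j%:R * 2^-1 ^+ n) * t `^ (2^-1 ^+ n) =
        t `^ (j.+1%:R * 2^-1 ^+ n).
      move=> t0; rewrite -powRD ?gt_eqF ?implybT// -[j.+1%:R]natr1 mulrDl.
      by rewrite mul1r.
    exact: (S_eq (fun x => eq_mxfun (pW x) ES) (S_M IH (S_dyadic n))).
  exact: H.
move=> t t0.
have kc : (fun n => (k n)%:R * 2^-1 ^+ n) @ \oo --> a.
  apply/cvgrPdist_le => e e0.
  have g0 : (fun n => (2^-1 : R) ^+ n) @ \oo --> (0 : R).
    by apply: cvg_expr; rewrite ger0_norm; lra.
  have /cvgrPdist_le /(_ e e0) := g0; apply: filterS => n /=.
  rewrite sub0r normrN => H; apply: le_trans H.
  have w0 : 0 < (2 : R) ^+ n by rewrite exprn_gt0.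
  have /truncn_itv/andP[] : 0 <= a * 2 ^+ n by rewrite mulr_ge0// ltW.
  rewrite -/(k n) -[(k n).+1%:R]natr1 exprVn; move: (k n)%:R (2 ^+ n : R) w0 => K w w0 H1 H2.
  rewrite (_ : a - K / w = (a * w - K) / w); last by field; rewrite gt_eqF.
  by rewrite normrM ler_piMl// ler_norml; lra.
rewrite (_ : (fun n => _) = (fun n => expR ((k n)%:R * 2^-1 ^+ n * ln t))); last first.
  by apply/funext => n; rewrite /powR gt_eqF.
rewrite /powR gt_eqF//.
apply: (cvg_comp (fun n => (k n)%:R * 2^-1 ^+ n * ln t) expR); last first.
  exact: continuous_expR.
exact: cvgMl kc.
Qed.

(** The diagonalization of W(x) is an arbitrary choice for each x and need not be
    measurable.  But sums, products, inverses and limits of measurable matrix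
    functions are measurable.  Heron's iteration gives square roots, hence powers with
    dyadic exponents, and a limit of these gives the exponent a. *)
Lemma mxmeas_mxpow a : mxmeas (fun x => mxpow (W x) a).
Proof.
suff Sa : S (fun t => t `^ a).
  exact: (@eq_mxmeas m m (fun x => mxfun (fun t => t `^ a) (W x))
    (fun x => mxpow (W x) a) (fun x => esym (mxpowE (W x) a)) Sa).
have [a0|a0] := leP 0 a; first exact: S_pow_nneg.
have na0 : 0 <= - a by rewrite oppr_ge0 ltW.
have p0 (t : R) : 0 < t -> t `^ (- a) != 0 by move=> t0; rewrite gt_eqF// powR_gt0.
have E (t : R) : 0 < t -> (t `^ (- a))^-1 = t `^ a by rewrite powRN invrK.
exact: (S_eq (fun x => eq_mxfun (pW x) E) (S_V p0 (S_pow_nneg na0))).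
Qed.

End measurable_calculus.

(** * Boxes and cubes *)

Section boxes.
Context (R : realType) (d : nat).
Local Notation E := (Rd R d).
Local Notation mu := (leb R d).

(** Half-open, so that distinct dyadic boxes of equal size are disjoint. *)
Definition hbox (c : 'I_d -> R) (h : R) : set E :=
  [set x | forall i, c i <= tnth x i < c i + h].

Lemma measurable_forall_coord (A : 'I_d -> set R) :
  (forall i, measurable (A i)) -> measurable [set x : E | forall i, A i (tnth x i)].
Proof.
move=> mA; have -> : [set x : E | forall i, A i (tnth x i)] =
    \bigcap_(i in [set: 'I_d]) ((fun x : E => tnth x i) @^-1` (A i)).
  by apply/seteqP; split => x /= H i; [move=> _; exact: H|exact: H].
apply: fin_bigcap_measurable => // i _.
by rewrite -[X in measurable X]setTI; apply: measurable_tnth => //; exact: mA.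
Qed.

Lemma measurable_hbox c h : measurable (hbox c h).
Proof.
have := @measurable_forall_coord (fun i => `[c i, c i + h[%classic)
  (fun i => measurable_itv _).
congr measurable; apply/seteqP; split => x /= H i; have := H i; by rewrite in_itv.
Qed.

Lemma measurable_cube (a : E) s : measurable (cube a s).
Proof.
have := @measurable_forall_coord (fun i => `[tnth a i, tnth a i + s]%classic)
  (fun i => measurable_itv _).
congr measurable; apply/seteqP; split => x /= H i; have := H i; by rewrite in_itv.
Qed.

Lemma leb_cube (a : E) s : 0 <= s -> mu (cube a s) = (s ^+ d)%:E.
Proof.
move=> s0; rewrite /cube (leb_box (a := tnth a) (b := fun i => tnth a i + s)).
  by rewrite (eq_bigr (fun=> s)) ?prodr_const ?card_ord// => i _; rewrite addrC addKr.
by move=> i; rewrite lerDl.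
Qed.

Lemma leb_hbox_lty c h : (mu (hbox c h) < +oo)%E.
Proof.
have [h0|h0] := leP 0 h; last first.
  have [i|d0] := pickP (fun _ : 'I_d => true).
    move=> _; rewrite (_ : hbox c h = set0) ?measure0//.
    by apply/seteqP; split => // x /(_ i); lra.
  rewrite (_ : hbox c h = cube [tuple c i | i < d] 0) ?leb_cube ?ltry//.
  by apply/seteqP; split => x _ i; have := d0 i.
apply: (@le_lt_trans _ _ (mu (cube [tuple c i | i < d] h))).
  apply: le_measure; rewrite ?inE; [exact: measurable_hbox|exact: measurable_cube|].
  by move=> x H i; rewrite tnth_mktuple; have /andP[-> /ltW ->] := H i.
by rewrite leb_cube// ltry.
Qed.

(** This is why the diagonal can be left out of the decomposition. *)
Lemma leb_set1 (x : E) : (0 < d)%N -> measurable [set x] /\ mu [set x] = 0%E.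
Proof.
move=> d0; have -> : [set x] = cube x 0.
  apply/seteqP; split => [y -> i|y H]; first by rewrite addr0 lexx.
  apply/eq_from_tnth => i; have := H i; rewrite addr0 => /le_anti ->//.
split; first exact: measurable_cube.
by rewrite leb_cube// expr0n gtn_eqF.
Qed.

End boxes.

(** * Whitney decomposition of a product of cubes *)

Section whitney.
Context (R : realType) (d : nat).
Local Notation E := (Rd R d).
Local Notation mu := (leb R d).
Hypothesis d0 : (0 < d)%N.

Lemma nneseries_geometric_le (z : R) : 0 <= z -> z < 1 ->
  (\sum_(k <oo) (z ^+ k)%:E <= ((1 - z)^-1)%:E)%E.
Proof.
move=> z0 z1; apply: lime_le.
  by apply: is_cvg_nneseries => k _ _; rewrite lee_fin exprn_ge0.
apply: nearW => n; rewrite sumEFin lee_fin big_mkord.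
rewrite -[leRHS]mul1r ler_pdivlMr ?subr_gt0// mulrC.
have := subrX1 z n => H.
have := exprn_ge0 n z0; lra.
Qed.

Lemma sum_EFin_cst (J : finType) (c : R) :
  (\sum_(j : J) c%:E = (#|J|%:R * c)%:E)%E.
Proof. by rewrite sumEFin sumr_const mulr_natl. Qed.

(** A sum with at most one nonzero term, as happens for disjoint cells, loses nothing
    in a power. *)
Lemma poweR_sum_single (J : finType) (c : J -> \bar R) (r : R) : 0 < r ->
  (forall i j, i != j -> c i = 0%E \/ c j = 0%E) ->
  ((\sum_j c j) `^ r = \sum_j c j `^ r)%E.
Proof.
move=> r0 cc; have [j0|c0] := pickP (fun j => c j != 0%E).
  move=> cj0; have z j : j != j0 -> c j = 0%E.
    by move=> jj0; have [//|cj] := cc j j0 jj0; rewrite cj eqxx in cj0.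
  rewrite (bigD1 j0)//= [in RHS](bigD1 j0)//= !big1 ?adde0// => j /z//.
  by move=> ->; rewrite poweR0r// gt_eqF.
rewrite !big1 ?poweR0r ?gt_eqF// => j _; have := c0 j => /negbFE/eqP ->//.
by rewrite poweR0r// gt_eqF.
Qed.

Lemma powR_exprn (z r : R) n : 0 <= z -> (z ^+ n) `^ r = (z `^ r) ^+ n.
Proof.
by move=> z0; rewrite -powR_mulrn// powRAC powR_mulrn// powR_ge0.
Qed.

(** There are about 2^(nd) cells of side s 2^(-n), and each contributes its volume to
    the power 1 + r; the surplus power r is what makes the sum over n converge. *)
Lemma powR_dyadic_volume (s r : R) n : 0 <= s -> 0 < r ->
  ((s * 2^-1 ^+ n) ^+ d) `^ (1 + r) <=
    (s ^+ d) `^ (1 + r) * ((2 ^+ n) ^+ d)^-1 * (2^-1 ^+ n) `^ r.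
Proof.
move=> s0 r0; have z0 : 0 < (2^-1 : R) ^+ n by rewrite exprn_gt0// invr_gt0.
rewrite exprMn powRM ?exprn_ge0 ?(ltW z0)//.
rewrite -mulrA; apply: ler_wpM2l; first exact: powR_ge0.
rewrite powRD; last by rewrite (gt_eqF (exprn_gt0 d z0)) implybT.
rewrite powRr1 ?exprn_ge0 ?(ltW z0)// -exprVn -exprVn.
apply: ler_wpM2l; first by rewrite exprn_ge0// ltW.
apply: ge0_ler_powR; rewrite ?nnegrE ?(ltW r0) ?exprn_ge0 ?(ltW z0)//.
rewrite -[leRHS]expr1; apply: ler_wiXn2l; rewrite ?(ltW z0)//.
by rewrite exprn_ile1// ?invr_ge0// invf_le1// ler1n.
Qed.

Variables (M : nat).
Hypothesis M1 : (0 < M)%N.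
Let L := (2 * M + 3)%N.

(** k is the first scale at which the two points differ by M + 1 cells in some
    coordinate; as this fails one scale earlier, they differ by less than 2M + 2 cells. *)
Lemma whitney_scale (u v : 'I_d -> R) :
  (forall j, 0 <= u j <= 1) -> (forall j, 0 <= v j <= 1) -> (exists j, u j != v j) ->
  exists (k : nat) (i : 'I_d -> nat) (o : 'I_d -> int),
  [/\ forall j, (i j < (2 ^ k).+1)%N,
      forall j, (i j)%:R <= u j * 2 ^+ k < (i j)%:R + 1,
      forall j, (i j)%:R + (o j)%:~R <= v j * 2 ^+ k < (i j)%:R + (o j)%:~R + 1,
      exists j, M%:R <= `|(o j)%:~R : R| & forall j, `|(o j)%:~R : R| <= L%:R].
Proof.
move=> u01 v01 [j0 uv].
pose P k := [exists j, (M%:R + 1 <= `|u j - v j| * 2 ^+ k)].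
have exP : exists k, P k.
  have r0 : 0 < `|u j0 - v j0| by rewrite normr_gt0 subr_eq0.
  pose k := (Num.truncn ((M%:R + 1) / `|u j0 - v j0|)).+1.
  exists k; apply/existsP; exists j0; rewrite mulrC -ler_pdivrMr//.
  apply: (@le_trans _ _ k%:R).
    by rewrite ltW// truncnS_gt.
  by rewrite -natrX ler_nat ltnW// ltn_expl.
have [k Pk kmin] := ex_minnP exP.
have kn0 : k != 0%N.
  apply: contraTneq Pk => ->; apply/existsP => -[j].
  have M10 : (1 : R) <= M%:R by rewrite ler1n.
  have /andP[? ?] := u01 j; have /andP[? ?] := v01 j.
  have : `|u j - v j| <= 1 by rewrite ler_norml; lra.
  by rewrite expr0; lra.
have up j : `|u j - v j| * 2 ^+ k < 2 * (M%:R + 1).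
  rewrite ltNge; apply/negP => H.
  have : P k.-1.
    apply/existsP; exists j; move: H; rewrite -{1}(prednK (n := k)) ?lt0n// exprS; lra.
  by move=> /kmin; rewrite leqNgt prednK ?lt0n// leqnn.
have w0 : 0 < (2 : R) ^+ k by rewrite exprn_gt0.
pose i j := Num.truncn (u j * 2 ^+ k).
pose i' j := Num.truncn (v j * 2 ^+ k).
have iP j : (i j)%:R <= u j * 2 ^+ k < (i j)%:R + 1.
  rewrite natr1; apply: truncn_itv; rewrite mulr_ge0 ?(ltW w0)//.
  by have /andP[] := u01 j.
have i'P j : (i' j)%:R <= v j * 2 ^+ k < (i' j)%:R + 1.
  rewrite natr1; apply: truncn_itv; rewrite mulr_ge0 ?(ltW w0)//.
  by have /andP[] := v01 j.
exists k, i, (fun j => (i' j)%:Z - (i j)%:Z); split.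
- move=> j; rewrite ltnS -(ler_nat R) natrX; have /andP[H _] := iP j.
  apply: (le_trans H); rewrite ler_piMl ?(ltW w0)//; by have /andP[] := u01 j.
- exact: iP.
- move=> j; rewrite intrB /= addrC subrK; exact: i'P.
- have /existsP[j Hj] := Pk; exists j; move: (iP j) (i'P j) Hj.
  rewrite -[2 ^+ k](ger0_norm (ltW w0)) -normrM mulrBl (ger0_norm (ltW w0)) intrB -!pmulrn.
  move: (u j * _) (v j * _) => a b /andP[H1 H2] /andP[H3 H4].
  by rewrite !ler_normr => /orP[] H; apply/orP; [right|left]; lra.
- move=> j; move: (iP j) (i'P j) (up j).
  rewrite -[2 ^+ k](ger0_norm (ltW w0)) -normrM mulrBl (ger0_norm (ltW w0)) intrB -!pmulrn.
  rewrite /L natrD natrM.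
  move: (u j * _) (v j * _) => a b /andP[H1 H2] /andP[H3 H4].
  by rewrite ltr_norml ler_norml => /andP[H5 H6]; lra.
Qed.

(** A finite type of integer vectors, so that sums over all offsets make sense. *)
Definition offset (f : {ffun 'I_d -> 'I_(2 * L).+1}) (j : 'I_d) : int :=
  (f j : nat)%:Z - L%:Z.

Lemma offset_onto (o : 'I_d -> int) : (forall j, `|(o j)%:~R : R| <= L%:R) ->
  exists f, offset f = o.
Proof.
move=> oL.
have H j : exists2 n : nat, (n < (2 * L).+1)%N & n%:Z - L%:Z = o j.
  have := oL j; rewrite ler_norml [L%:R]pmulrn -mulrNz !ler_int => /andP[H1 H2].
  by exists (absz (o j + L%:Z)); lia.
exists [ffun j => inord (absz (o j + L%:Z))]; apply/funext => j.
have [n nL nE] := H j; rewrite /offset ffunE inordK -nE; lia.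
Qed.

Variables (r D : R) (k : E * E -> \bar R).
Hypotheses (r0 : 0 < r) (D0 : 0 <= D).
Hypothesis mk : measurable_fun [set: E * E] k.
Hypothesis k0 : forall z, (0 <= k z)%E.

Definition shifted (c : 'I_d -> R) (h : R) (o : 'I_d -> int) : 'I_d -> R :=
  fun j => c j + h * (o j)%:~R.

Hypothesis cells : forall c h (o : 'I_d -> int), 0 < h ->
  (exists j, M%:R <= `|(o j)%:~R : R|) -> (forall j, `|(o j)%:~R : R| <= L%:R) ->
  (\int[mu]_(x in hbox c h) (\int[mu]_(y in hbox (shifted c h o) h) k (x, y)) `^ r <=
   (D * (h ^+ d) `^ (1 + r))%:E)%E.

Let O := {ffun 'I_d -> 'I_(2 * L).+1}.

(** The factors come from the weights of the scales, the number of offsets (once from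
    the power r of their sum), the number of cells of a scale and the series over n. *)
Definition whitney_const : R :=
  3 `^ r * #|O|%:R `^ r * #|O|%:R * 2 ^+ d * (1 - (3 / 4) `^ r)^-1.

(** On each scale the first cells are disjoint and there are boundedly many offsets,
    so the cells add up to a multiple of D s^(d(1+r)) 2^(-nr).  The scales are added with
    the weights (3/2)^n: their inverses are summable, and (3/2)^(nr) 2^(-nr) still decays. *)
Lemma whitney_sum (a : E) (s : R) : 0 < s ->
  (\int[mu]_(x in cube a s) (\int[mu]_(y in cube a s) k (x, y)) `^ r <=
   (whitney_const * D * (s ^+ d) `^ (1 + r))%:E)%E.
Proof.
move=> s0.
pose h n : R := s * 2^-1 ^+ n.
have h0 n : 0 < h n by rewrite mulr_gt0// exprn_gt0// invr_gt0.
pose I n := {ffun 'I_d -> 'I_(2 ^ n).+1}.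
pose c n (i : I n) : 'I_d -> R := fun j => tnth a j + (i j : nat)%:R * h n.
(* The type O also contains offsets that are too small; adm excludes them. *)
pose adm (o : O) := `[< exists j, M%:R <= `|(offset o j)%:~R : R| >] &&
  `[< forall j, `|(offset o j)%:~R : R| <= L%:R >].
pose X n (i : I n) := hbox (c n i) (h n).
pose Y n (i : I n) (o : O) := hbox (shifted (c n i) (h n) (offset o)) (h n).
pose G n (x y : E) : \bar R := (\sum_(o : O) \sum_(i : I n)
  (((adm o)%:R * \1_(X n i) x * \1_(Y n i o) y)%:E * k (x, y)))%E.
have w0 n i o x y : 0 <= (adm o)%:R * \1_(X n i) x * \1_(Y n i o) y :> R.
  by rewrite !mulr_ge0.
have G0 n x y : (0 <= G n x y)%E.
  by apply: sume_ge0 => o _; apply: sume_ge0 => i _; rewrite mule_ge0// lee_fin.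
have mX n i : measurable_fun [set: E] (\1_(X n i) : E -> R).
  exact: measurable_indic (measurable_hbox _ _).
have mY n i o : measurable_fun [set: E] (\1_(Y n i o) : E -> R).
  exact: measurable_indic (measurable_hbox _ _).
have mterm n i o : measurable_fun [set: E * E]
    (fun z => ((adm o)%:R * \1_(X n i) z.1 * \1_(Y n i o) z.2)%:E * k z)%E.
  apply: emeasurable_funM => //; apply/measurable_EFinP; apply: measurable_funM.
  - by apply: measurable_funM => //; exact: (measurableT_comp (mX n i) measurable_fst).
  - exact: (measurableT_comp (mY n i o) measurable_snd).
have mG n : measurable_fun [set: E * E] (fun z => G n z.1 z.2).
  apply: emeasurable_sum => o; apply: emeasurable_sum => i.
  by have := mterm n i o; congr measurable_fun; apply/funext => -[].
have mGx n x : measurable_fun [set: E] (G n x).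
  exact: (measurable_fun_pair2 x (mG n)).
have mkx x : measurable_fun [set: E] (fun y => k (x, y)).
  exact: (measurable_fun_pair2 x mk).
pose cc n x : \bar R := (\int[mu]_y G n x y)%E.
have mcc n : measurable_fun [set: E] (cc n).
  exact: (measurable_param_integral mu (mG n)).
have cc0 n x : (0 <= cc n x)%E by exact: integral_ge0.
(* Every point off the diagonal lies in a pair of cells of some scale. *)
have cover x : cube a s x ->
    (\int[mu]_(y in cube a s) k (x, y) <= \sum_(n <oo) cc n x)%E.
  move=> Qx; rewrite /cc -integral_nneseries//.
  rewrite (@ae_congr_integral _ _ _ mu (cube a s) (fun y => k (x, y))
    (fun y => if y == x then 0%E else k (x, y))); last first.
    have [mx x0] := leb_set1 x d0.
    exists [set x]; split => // y /= H; apply: contrapT => yx; apply: H => _.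
    by case: eqP.
  rewrite integral_mkcond; apply: ge0_le_lower_integral => y _.
    by rewrite /patch; case: ifP => // _; case: ifP.
  have S0 : (0 <= \sum_(n <oo) G n x y)%E by exact: nneseries_ge0.
  rewrite /patch; case: ifPn => [/set_mem Qy|//]; case: eqP => // /eqP yx.
  pose u j := (tnth x j - tnth a j) / s; pose v j := (tnth y j - tnth a j) / s.
  have u01 j : 0 <= u j <= 1.
    have := Qx j => /andP[H1 H2]; rewrite /u divr_ge0 ?subr_ge0 ?(ltW s0)//=.
    by rewrite ler_pdivrMr// mul1r lerBlDl.
  have v01 j : 0 <= v j <= 1.
    have := Qy j => /andP[H1 H2]; rewrite /v divr_ge0 ?subr_ge0 ?(ltW s0)//=.
    by rewrite ler_pdivrMr// mul1r lerBlDl.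
  have uv : exists j, u j != v j.
    apply: contrapT => H; move/eqP: yx; apply; apply/eq_from_tnth => j.
    have [//|xy] := eqVneq (tnth y j) (tnth x j); exfalso; apply: H; exists j.
    apply: contra xy => /eqP /(congr1 ( *%R^~ s)); rewrite /u /v !divfK ?(gt_eqF s0)//.
    by move=> e; rewrite (addIr _ e).
  case: (whitney_scale u01 v01 uv) => n [] i0 [] o0 [] i2 iu vo oM oL.
  have [f fo] := offset_onto oL.
  pose i1 : I n := [ffun j => Ordinal (i2 j)].
  have E1 z (j : 'I_d) : z * 2 ^+ n * h n = z * s.
    by rewrite /h mulrCA -!mulrA -exprMn mulfV ?expr1n ?mulr1 1?mulrC// pnatr_eq0.
  have Xx : \1_(X n i1) x = 1 :> R.
    rewrite indicE mem_set// => j; rewrite /c ffunE /=; have /andP[H1 H2] := iu j.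
    have -> : tnth x j = tnth a j + u j * 2 ^+ n * h n.
      by rewrite E1// /u divfK ?(gt_eqF s0)// addrC subrK.
    by rewrite -addrA lerD2l ltrD2l ler_pM2r// H1 /=; have := h0 n; nra.
  have Yy : \1_(Y n i1 f) y = 1 :> R.
    rewrite indicE mem_set// => j; rewrite /shifted /c ffunE /= fo; have /andP[H1 H2] := vo j.
    have -> : tnth y j = tnth a j + v j * 2 ^+ n * h n.
      by rewrite E1// /v divfK ?(gt_eqF s0)// addrC subrK.
    rewrite [h n * _]mulrC -addrA -mulrDl -addrA lerD2l ltrD2l.
    by rewrite ler_pM2r// H1 /=; have := h0 n; nra.
  have af : adm f by rewrite /adm; apply/andP; split; apply/asboolP; rewrite fo.
  apply: (@le_trans _ _ (G n x y)); last first.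
    by rewrite (nneseriesD1 (n := n))//; apply: leeDl; exact: nneseries_ge0.
  rewrite /G (bigD1 f)//= (bigD1 i1)//= Xx Yy af !mul1r mul1e -addeA; apply: leeDl.
  rewrite adde_ge0//; apply: sume_ge0 => ? _; rewrite ?mule_ge0 ?lee_fin//.
  by apply: sume_ge0 => ? _; rewrite mule_ge0 ?lee_fin.
have XI n (i i' : I n) x : X n i x -> X n i' x -> i = i'.
  move=> H H'; apply/ffunP => j; apply/val_inj/eqP => /=.
  have /andP[H1 H2] := H j; have /andP[H3 H4] := H' j.
  have : (i j : nat)%:R * h n < ((i' j).+1)%:R * h n.
    by rewrite -natr1 mulrDl mul1r; move: H1 H4; rewrite /c; lra.
  have : (i' j : nat)%:R * h n < ((i j).+1)%:R * h n.
    by rewrite -natr1 mulrDl mul1r; move: H2 H3; rewrite /c; lra.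
  by rewrite !ltr_pM2r// !ltr_nat !ltnS => ? ?; rewrite eqn_leq; apply/andP.
have patchI (A : set E) (f : E -> \bar R) y : (f \_ A) y = ((\1_A y)%:E * f y)%E.
  by rewrite patchE indicE; case: ifPn => _; rewrite ?mul1e ?mul0e.
pose J n i o x : \bar R := (\int[mu]_(y in Y n i o) k (x, y))%E.
have J0 n i o x : (0 <= J n i o x)%E by exact: integral_ge0.
have JE n i o x : J n i o x = (\int[mu]_y ((\1_(Y n i o) y)%:E * k (x, y)))%E.
  by rewrite /J integral_mkcond; apply: eq_integral => y _; exact: patchI.
have mJ n i o : measurable_fun [set: E] (J n i o).
  rewrite (_ : J n i o = fun x => (\int[mu]_y ((\1_(Y n i o) y)%:E * k (x, y)))%E); last first.
    by apply/funext => x; exact: JE.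
  apply: (measurable_param_integral mu (f := fun z => ((\1_(Y n i o) z.2)%:E * k z)%E)).
  apply: emeasurable_funM => //; apply/measurable_EFinP.
  exact: (measurableT_comp (mY n i o) measurable_snd).
have ccE n x : cc n x = (\sum_(o : O) \sum_(i : I n)
    (((adm o)%:R * \1_(X n i) x)%:E * \int[mu]_(y in Y n i o) k (x, y)))%E.
  rewrite /cc /G ge0_integral_sum//; last 2 first.
  - move=> o; apply: emeasurable_sum => i.
    exact: (measurable_fun_pair2 x (mterm n i o)).
  - by move=> o y _; apply: sume_ge0 => i _; rewrite mule_ge0 ?lee_fin.
  apply: eq_bigr => o _; rewrite ge0_integral_sum//; last 2 first.
  - by move=> i; exact: (measurable_fun_pair2 x (mterm n i o)).
  - by move=> i y _; rewrite mule_ge0 ?lee_fin.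
  apply: eq_bigr => i _.
  rewrite -/(J n i o x) JE -ge0_integralZl//.
  - by apply: eq_integral => y _; rewrite EFinM -muleA.
  - apply: emeasurable_funM => //; apply/measurable_EFinP; exact: mY.
  - by move=> y _; rewrite mule_ge0 ?lee_fin.
have ccr n x : (cc n x `^ r <= (#|O|%:R `^ r)%:E * \sum_(o : O) \sum_(i : I n)
    (((adm o)%:R * \1_(X n i) x)%:E * (\int[mu]_(y in Y n i o) k (x, y)) `^ r))%E.
  have bb (b b' : bool) : (b%:R * b'%:R : R) `^ r = b%:R * b'%:R.
    by case: b; case: b'; rewrite ?mulr1 ?mulr0 ?mul0r ?powR1 ?powR0 ?(gt_eqF r0).
  rewrite ccE; apply: (le_trans (poweR_sum_le r0 _)).
    by move=> o; apply: sume_ge0 => i _; rewrite mule_ge0 ?integral_ge0// lee_fin mulr_ge0.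
  apply: lee_wpmul2l; first by rewrite lee_fin powR_ge0.
  apply: lee_sum => o _; rewrite poweR_sum_single//.
    apply: lee_sum => i _; rewrite poweRM ?integral_ge0 ?lee_fin ?mulr_ge0//.
    by rewrite indicE poweR_EFin bb.
  move=> i i' ii'.
  have [Xi|Xi] := pselect (X n i x); last first.
    by left; rewrite indicE memNset// mulr0 mul0e.
  right; rewrite indicE memNset ?mulr0 ?mul0e// => Xi'.
  by move/eqP: ii'; apply; exact: XI Xi Xi'.
have card_I n : (#|I n|%:R <= 2 ^+ d * (2 ^+ n) ^+ d :> R).
  rewrite card_ffun !card_ord natrX -exprMn lerXn2r ?nnegrE ?mulr_ge0 ?exprn_ge0//.
  have H1 : (1 : R) <= 2 ^+ n by rewrite exprn_ege1// ler1n.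
  by rewrite -[(2 ^ n).+1%:R]natr1 natrX; lra.
have int_cc n : (\int[mu]_x cc n x `^ r <=
    (#|O|%:R `^ r * #|O|%:R * 2 ^+ d * D * (s ^+ d) `^ (1 + r) * (2^-1 ^+ n) `^ r)%:E)%E.
  apply: (@le_trans _ _ (\int[mu]_x ((#|O|%:R `^ r)%:E * \sum_(o : O) \sum_(i : I n)
    (((adm o)%:R * \1_(X n i) x)%:E * J n i o x `^ r)))%E).
    by apply: ge0_le_lower_integral => x _; [exact: poweR_ge0|exact: ccr].
  have aX0 i o x : (0 <= ((adm o)%:R * \1_(X n i) x : R)%:E)%E.
    by rewrite lee_fin mulr_ge0.
  have mt i o : measurable_fun [set: E]
      (fun x => ((adm o)%:R * \1_(X n i) x)%:E * J n i o x `^ r)%E.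
    apply: emeasurable_funM.
      by apply/measurable_EFinP; exact: measurable_funM.
    exact: (measurableT_comp (measurable_poweR r) (mJ n i o)).
  have t0 i o x : (0 <= ((adm o)%:R * \1_(X n i) x)%:E * J n i o x `^ r)%E.
    by rewrite mule_ge0 ?poweR_ge0.
  rewrite ge0_integralZl//; last 2 first.
  - by apply: emeasurable_sum => o; exact: emeasurable_sum.
  - by move=> x _; apply: sume_ge0 => o _; exact: sume_ge0.
  rewrite ge0_integral_sum//; last 2 first.
  - by move=> o; exact: emeasurable_sum.
  - by move=> o x _; exact: sume_ge0.
  have bound i o : (\int[mu]_x (((adm o)%:R * \1_(X n i) x)%:E * J n i o x `^ r) <=
      (D * (h n ^+ d) `^ (1 + r))%:E)%E.
    have [/andP[/asboolP a1 /asboolP a2]|na] := boolP (adm o); last first.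
      rewrite (eq_integral (cst 0%E)) ?integral0 ?lee_fin ?mulr_ge0 ?powR_ge0//.
      by move=> x _; rewrite mul0r mul0e.
    rewrite (eq_integral ((fun x => J n i o x `^ r) \_ (X n i))%E); last first.
      by move=> x _; rewrite patchI mul1r.
    by rewrite -integral_mkcond; exact: cells.
  apply: (@le_trans _ _ ((#|O|%:R `^ r)%:E * \sum_(o : O) \sum_(i : I n)
      (D * (h n ^+ d) `^ (1 + r))%:E)%E).
    apply: lee_wpmul2l; first by rewrite lee_fin powR_ge0.
    apply: lee_sum => o _; rewrite ge0_integral_sum//.
    by apply: lee_sum => i _; exact: bound.
  rewrite (eq_bigr (fun=> (#|I n|%:R * (D * (h n ^+ d) `^ (1 + r)))%:E)); last first.
    by move=> o _; exact: sum_EFin_cst.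
  rewrite sum_EFin_cst -EFinM lee_fin.
  have E2 := powR_dyadic_volume n (ltW s0) r0.
  have c0 := card_I n; have Or : 0 <= #|O|%:R `^ r by exact: powR_ge0.
  have w1 : 0 < (2 ^+ n) ^+ d :> R by rewrite !exprn_gt0.
  apply: (@le_trans _ _ (#|O|%:R `^ r * (#|O|%:R * (2 ^+ d * (2 ^+ n) ^+ d * (D *
     ((s ^+ d) `^ (1 + r) * ((2 ^+ n) ^+ d)^-1 * (2^-1 ^+ n) `^ r)))))).
    apply: ler_wpM2l => //; apply: ler_wpM2l => //.
    apply: ler_pM => //; first by rewrite mulr_ge0 ?powR_ge0.
    by apply: ler_wpM2l.
  rewrite le_eqVlt; apply/orP; left; apply/eqP; field.
  by rewrite gt_eqF.
pose K : R := #|O|%:R `^ r * #|O|%:R * 2 ^+ d * D * (s ^+ d) `^ (1 + r).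
have K0 : 0 <= K by rewrite !mulr_ge0 ?powR_ge0 ?exprn_ge0.
(* Any ratio strictly between 1 and 2 would do: w^-1 has to be summable, and
   w^r 2^(-nr) as well. *)
pose w n : R := (3 / 2) ^+ n.
have wp n : 0 < w n by rewrite exprn_gt0//; lra.
have wS : (\sum_(n <oo) (w n)^-1%:E <= 3%:E)%E.
  rewrite (eq_eseriesr (g := fun n => ((2 / 3) ^+ n)%:E)); last first.
    by move=> n _; rewrite /w -exprVn invf_div.
  apply: (le_trans (nneseries_geometric_le _ _)); [lra|lra|].
  have -> : (1 - 2 / 3)^-1 = 3 :> R by field.
  by rewrite lee_fin.
have rho0 : 0 <= (3 / 4 : R) `^ r by exact: powR_ge0.
have rho1 : (3 / 4 : R) `^ r < 1.
  by have := @gt0_ltr_powR R r r0 (3 / 4) 1; rewrite powR1 !nnegrE; apply; lra.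
apply: (@le_trans _ _ (\int[mu]_x ((3 `^ r)%:E * \sum_(n <oo) (w n `^ r)%:E * cc n x `^ r))%E).
  rewrite integral_mkcond; apply: ge0_le_lower_integral => x _.
    by rewrite patchI mule_ge0 ?poweR_ge0 ?lee_fin.
  rewrite /patch; case: ifPn => [/set_mem Qx|_]; last first.
    rewrite mule_ge0 ?lee_fin ?powR_ge0// nneseries_ge0// => n _ _.
    by rewrite mule_ge0 ?lee_fin ?powR_ge0 ?poweR_ge0.
  apply: le_trans (poweR_nneseries_le r0 (fun n => cc0 n x) wp wS).
  by apply: le_poweR; [exact: ltW|exact: integral_ge0|exact: cover].
have mccr n : measurable_fun [set: E] (fun x => (w n `^ r)%:E * cc n x `^ r)%E.
  by apply: measurable_funeM; exact: (measurableT_comp (measurable_poweR r) (mcc n)).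
have ccr0 n x : (0 <= (w n `^ r)%:E * cc n x `^ r)%E.
  by rewrite mule_ge0 ?lee_fin ?powR_ge0 ?poweR_ge0.
rewrite ge0_integralZl//; last 2 first.
- by apply: ge0_emeasurable_sum.
- by move=> x _; exact: nneseries_ge0.
rewrite integral_nneseries//.
apply: (@le_trans _ _ ((3 `^ r)%:E * \sum_(n <oo) (K%:E * (((3 / 4) `^ r) ^+ n)%:E))%E).
  apply: lee_wpmul2l; first by rewrite lee_fin powR_ge0.
  apply: lee_nneseries => [n _ _|n _].
    by apply: integral_ge0 => x _; exact: ccr0.
  rewrite ge0_integralZl//; last 3 first.
  - exact: (measurableT_comp (measurable_poweR r) (mcc n)).
  - by move=> x _; exact: poweR_ge0.
  - by rewrite lee_fin powR_ge0.
  apply: (@le_trans _ _ ((w n `^ r)%:E * (K * (2^-1 ^+ n) `^ r)%:E)%E).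
    by apply: lee_wpmul2l; [rewrite lee_fin powR_ge0|exact: int_cc].
  rewrite -!EFinM lee_fin mulrCA; apply: ler_wpM2l => //.
  rewrite -powRM ?exprn_ge0 ?(ltW (wp n))// ?invr_ge0// /w -exprMn.
  by rewrite (_ : 3 / 2 * 2^-1 = 3 / 4 :> R) ?powR_exprn//; field.
rewrite nneseriesZl; last by move=> n _; rewrite lee_fin exprn_ge0.
apply: (@le_trans _ _ ((3 `^ r)%:E * (K%:E * ((1 - (3 / 4) `^ r)^-1)%:E))%E).
  apply: lee_wpmul2l; first by rewrite lee_fin powR_ge0.
  by apply: lee_wpmul2l; [rewrite lee_fin|exact: nneseries_geometric_le].
rewrite -!EFinM lee_fin /whitney_const -/O /K le_eqVlt; apply/orP; left; apply/eqP; ring.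
Qed.

End whitney.

(** * The Riesz kernels at large offsets *)

Section kernel.
Context (R : realType) (d : nat).
Local Notation E := (Rd R d).

Definition sqnorm (w : 'I_d -> R) : R := \sum_j w j ^+ 2.

(** The kernel as a function of x - y. *)
Definition riesz_fun (l : 'I_d) (w : 'I_d -> R) : R :=
  w l / Num.sqrt (sqnorm w) ^+ d.+1.

Lemma riesz_kernelE l (x y : E) :
  riesz_kernel l x y = riesz_fun l (fun j => tnth x j - tnth y j).
Proof. by []. Qed.

Lemma sqr_le_sqnorm w l : w l ^+ 2 <= sqnorm w.
Proof.
by rewrite /sqnorm (bigD1 l)//= lerDl; apply: sumr_ge0 => j _; exact: sqr_ge0.
Qed.

Lemma sqnormZ h w : sqnorm (fun j => h * w j) = h ^+ 2 * sqnorm w.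
Proof. by rewrite /sqnorm mulr_sumr; apply: eq_bigr => j _; rewrite exprMn. Qed.

Lemma riesz_funZ l h w : 0 < h ->
  riesz_fun l (fun j => h * w j) = h ^- d * riesz_fun l w.
Proof.
move=> h0; rewrite /riesz_fun sqnormZ sqrtrM ?sqr_ge0// sqrtr_sqr gtr0_norm//.
rewrite exprMn invfM mulrACA; congr (_ * _).
by rewrite exprS invfM mulrA divff ?mul1r// gt_eqF.
Qed.

Lemma near_one_exp (t e : R) n : 0 <= e <= 1 -> `|t - 1| <= e ->
  `|t ^+ n - 1| <= (2 ^+ n - 1) * e.
Proof.
move=> /andP[e0 e1] te; elim: n => [|n IH].
  by rewrite !expr0 !subrr normr0 mul0r.
have t2 : `|t| <= 2.
  rewrite -[t](subrK 1); apply: (le_trans (ler_normD _ _)); rewrite normr1; lra.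
rewrite exprS (_ : t * t ^+ n - 1 = t * (t ^+ n - 1) + (t - 1)); last by ring.
apply: (le_trans (ler_normD _ _)); rewrite normrM.
have : `|t| * `|t ^+ n - 1| <= 2 * ((2 ^+ n - 1) * e) by apply: ler_pM.
by rewrite exprS; lra.
Qed.

Lemma near_one_mul (f t e e' : R) : `|f - 1| <= e -> `|t - 1| <= e' -> e <= 1 ->
  `|1 - f * t| <= e + 2 * e'.
Proof.
move=> fe te e1.
have f2 : `|f| <= 2.
  rewrite -[f](subrK 1); apply: (le_trans (ler_normD _ _)); rewrite normr1; lra.
rewrite (_ : 1 - f * t = - (f * (t - 1) + (f - 1))); last by ring.
rewrite normrN; apply: (le_trans (ler_normD _ _)); rewrite normrM.
have : `|f| * `|t - 1| <= 2 * e' by apply: ler_pM.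
lra.
Qed.

Lemma sqrt_ratio_near_one (S S' t : R) : 0 < S -> `|S' - S| <= t * S -> t <= 2^-1 ->
  `|Num.sqrt S / Num.sqrt S' - 1| <= 2 * t.
Proof.
move=> S0 SS t2; move: (SS); rewrite ler_norml => /andP[H1 H2].
have t0 : 0 <= t by move: (le_trans (normr_ge0 _) SS); rewrite pmulr_lge0.
have S'0 : 0 < S' by nra.
set a := Num.sqrt S; set b := Num.sqrt S'.
have a0 : 0 < a by rewrite sqrtr_gt0.
have b0 : 0 < b by rewrite sqrtr_gt0.
have aS : a ^+ 2 = S by rewrite sqr_sqrtr// ltW.
have bS : b ^+ 2 = S' by rewrite sqr_sqrtr// ltW.
rewrite (_ : a / b - 1 = (a - b) / b); last by field; rewrite gt_eqF.
rewrite normrM normfV (gtr0_norm b0) ler_pdivrMr// ler_norml.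
rewrite -bS -aS in H1 H2.
have ab0 : 0 < a + b by exact: addr_gt0.
have a2 : 0 <= a ^+ 2 by exact: sqr_ge0.
have ta : t * a ^+ 2 <= 2^-1 * a ^+ 2 by exact: ler_wpM2r.
have tab : t * a ^+ 2 <= t * (2 * b ^+ 2) by apply: ler_wpM2l => //; lra.
have p0 : 0 <= t * a * b by rewrite !mulr_ge0 ?(ltW a0) ?(ltW b0).
by apply/andP; split; rewrite -(ler_pM2r ab0); lra.
Qed.

(** Take for l the largest coordinate b = |w_l| of w.  Moving w by 1 changes w_l by
    a relative amount of at most 1 / b, and the square of the norm of w by a
    relative amount of at most 3d / b. *)
Lemma riesz_fun_stable (e : R) : 0 < e -> exists M : nat, (1 < M)%N /\
  forall w : 'I_d -> R, (exists j, M%:R <= `|w j|) ->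
  exists l, M%:R <= `|w l| /\ forall w' : 'I_d -> R, (forall j, `|w' j - w j| <= 1) ->
    `|1 - riesz_fun l w' / riesz_fun l w| <= e.
Proof.
move=> e0.
(* T makes 2 t 2^(d+2) <= e, where t = 3 d / b is the relative variation. *)
pose T : R := 6 * d%:R * (1 + 2 ^+ d.+2 / e) + 6 * d%:R * 2.
have dd0 : 0 <= d%:R :> R by exact: ler0n.
have q0 : 0 < 2 ^+ d.+2 / e by rewrite divr_gt0// exprn_gt0.
exists (Num.truncn T).+2; split=> // w [j0 wj0].
set M := (Num.truncn T).+2 in wj0 *.
have TM : T < M%:R by apply: (lt_trans (truncnS_gt T)); rewrite ltr_nat.
have [l _ wl] := @arg_maxP _ _ _ j0 xpredT (fun j => `|w j|) erefl.
have wl' j : `|w j| <= `|w l| by exact: wl.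
have lM : M%:R <= `|w l| by apply: le_trans wj0 (wl' j0).
exists l; split=> // w' ww'.
have d1 : 1 <= d%:R :> R.
  by rewrite ler1n; case: (d) l {wl wl' lM} => [[]|].
pose b := `|w l|.
have b1 : 1 <= b by apply: le_trans lM; rewrite ler1n.
have b0 : 0 < b by lra.
pose t := 3 * d%:R / b.
have t0 : 0 <= t by rewrite divr_ge0 ?mulr_ge0// ltW.
have tb : t * b = 3 * d%:R by rewrite /t divfK// gt_eqF.
have Tb : T <= b by apply: le_trans lM; exact: ltW.
have t4 : 2 * t <= 1.
  have : 2 * t * b <= b by rewrite -mulrA tb; move: Tb; rewrite /T; nra.
  by rewrite -{2}[b]mul1r ler_pM2r.
have te : 2 * t * 2 ^+ d.+2 <= e.
  rewrite -ler_pdivlMr ?exprn_gt0//.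
  have : 2 * t * (2 ^+ d.+2 / e) <= 1.
    have : 2 * t * (2 ^+ d.+2 / e) * b <= 1 * b.
      rewrite mul1r mulrAC -[2 * t * b]mulrA tb; move: Tb; rewrite /T; nra.
    by rewrite ler_pM2r.
  rewrite -ler_pdivlMr// div1r invf_div; exact.
have S0 : 0 < sqnorm w.
  apply: lt_le_trans (sqr_le_sqnorm w l).
  by rewrite -real_normK ?num_real// exprn_gt0.
have bS : b ^+ 2 <= sqnorm w.
  by rewrite /b real_normK ?num_real//; exact: sqr_le_sqnorm.
have SS : `|sqnorm w' - sqnorm w| <= t * sqnorm w.
  apply: (@le_trans _ _ (t * b ^+ 2)); last exact: ler_wpM2l.
  rewrite expr2 mulrA tb /sqnorm -sumrB; apply: (le_trans (ler_norm_sum _ _ _)).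
  apply: (@le_trans _ _ (\sum_(j < d) (3 * b))); last first.
    by rewrite sumr_const card_ord -mulr_natl; lra.
  apply: ler_sum => j _; rewrite subr_sqr normrM.
  apply: (@le_trans _ _ (1 * `|w' j + w j|)); first exact: ler_wpM2r.
  rewrite mul1r (_ : w' j + w j = (w' j - w j) + 2 * w j); last by ring.
  apply: (le_trans (ler_normD _ _)); rewrite normrM ger0_norm//.
  have := ww' j; have := wl' j; rewrite -/b; lra.
have wl0 : w l != 0 by rewrite -normr_gt0.
rewrite /riesz_fun; set a := Num.sqrt (sqnorm w); set a' := Num.sqrt (sqnorm w').
have a0 : 0 < a by rewrite sqrtr_gt0.
rewrite (_ : _ / _ = (w' l / w l) * (a / a') ^+ d.+1); last first.
  rewrite expr_div_n invfM invrK; move: (a' ^- d.+1) (a ^+ d.+1) => z z'; field.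
  exact: wl0.
have f1 : `|w' l / w l - 1| <= 2 * t.
  rewrite (_ : _ - 1 = (w' l - w l) / w l); last by field.
  rewrite normrM normfV ler_pdivrMr ?normr_gt0// -/b -mulrA tb.
  by have := ww' l; lra.
have t22 : t <= 2^-1 by lra.
have := near_one_exp d.+1 _ (sqrt_ratio_near_one S0 SS t22).
rewrite -/a -/a' mulr_ge0// t4 => /(_ isT) H.
apply: (le_trans (near_one_mul f1 H t4)).
apply: le_trans te; rewrite [2 ^+ d.+2]exprS; nra.
Qed.

Lemma riesz_fun_lower l (w : 'I_d -> R) (L : R) : 1 <= `|w l| ->
  (forall j, `|w j| <= L) -> (d%:R * L) ^- d.+1 <= `|riesz_fun l w|.
Proof.
move=> w1 wL.
have L1 : 1 <= L by exact: le_trans (wL l).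
have d1 : 1 <= d%:R :> R.
  by rewrite ler1n; case: (d) l {wL w1} w => [[]|].
have S0 : 0 < sqnorm w.
  apply: lt_le_trans (sqr_le_sqnorm w l).
  by rewrite -real_normK ?num_real// exprn_gt0//; lra.
have a0 : 0 < Num.sqrt (sqnorm w) by rewrite sqrtr_gt0.
have aL : Num.sqrt (sqnorm w) <= d%:R * L.
  have dL : 0 <= d%:R * L by nra.
  rewrite -(ger0_norm dL) -sqrtr_sqr ler_sqrt ?sqr_ge0//.
  apply: (@le_trans _ _ (\sum_(j < d) L ^+ 2)).
    apply: ler_sum => j _; rewrite -(real_normK (num_real (w j))).
    by apply: lerXn2r; rewrite ?nnegrE//; lra.
  rewrite sumr_const card_ord -[_ *+ d]mulr_natl exprMn.
  by have := sqr_ge0 L; nra.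
rewrite /riesz_fun normrM normfV (ger0_norm (exprn_ge0 _ (sqrtr_ge0 _))).
apply: (@le_trans _ _ (1 * Num.sqrt (sqnorm w) ^- d.+1)); last first.
  by apply: ler_wpM2r => //; rewrite invr_ge0 exprn_ge0// ltW.
rewrite mul1r lef_pV2 ?posrE ?exprn_gt0//; last by nra.
by apply: lerXn2r; rewrite ?nnegrE ?(ltW a0)//; nra.
Qed.

End kernel.

(** * Norms of complex vectors and matrices *)

Section norms.
Context (R : realType).
Local Notation C := R[i].

Lemma sqrt_sum_sqr_le (J : finType) (a : J -> R) : (forall j, 0 <= a j) ->
  Num.sqrt (\sum_j a j ^+ 2) <= \sum_j a j.
Proof.
move=> a0; have S0 : 0 <= \sum_j a j by exact: sumr_ge0.
rewrite -(ger0_norm S0) -sqrtr_sqr ler_sqrt ?sqr_ge0//.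
rewrite expr2 mulr_suml; apply: ler_sum => j _; rewrite expr2.
apply: ler_wpM2l => //; rewrite (bigD1 j)//= lerDl; exact: sumr_ge0.
Qed.

Lemma le_sqrt_sum_sqr (J : finType) (a : J -> R) j :
  `|a j| <= Num.sqrt (\sum_j a j ^+ 2).
Proof.
rewrite -sqrtr_sqr ler_sqrt; last by apply: sumr_ge0 => i _; exact: sqr_ge0.
by rewrite (bigD1 j)//= lerDl; apply: sumr_ge0 => i _; exact: sqr_ge0.
Qed.

Lemma normc_ge0 (z : C) : 0 <= Normc.normc z.
Proof. by case: z => a b; exact: sqrtr_ge0. Qed.

Lemma normc_le_ReIm (z : C) :
  Normc.normc z <= `|complex.Re z| + `|complex.Im z|.
Proof.
case: z => a b /=.
have := @sqrt_sum_sqr_le bool (fun c => if c then `|a| else `|b|).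
rewrite !big_bool !real_normK ?num_real//; apply; by case.
Qed.

Lemma Re_le_normc (z : C) : `|complex.Re z| <= Normc.normc z.
Proof.
case: z => a b /=.
have := @le_sqrt_sum_sqr bool (fun c => if c then a else b) true.
by rewrite !big_bool.
Qed.

Lemma Re_sum (J : finType) (z : J -> C) :
  complex.Re (\sum_j z j) = \sum_j complex.Re (z j).
Proof. by apply: (big_morph (@complex.Re R)) => // -[a b] [a' b']. Qed.

Lemma normc_sum_le (J : finType) (z : J -> C) :
  Normc.normc (\sum_j z j) <= \sum_j Normc.normc (z j).
Proof.
elim/big_ind2 : _ => //.
- by rewrite Normc.normc0.
- by move=> a b a' b' ? ?; apply: (le_trans (le_normcD _ _)); exact: lerD.
Qed.

Lemma vnorm_ge0 m (v : 'cV[C]_m) : 0 <= vnorm v.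
Proof. exact: sqrtr_ge0. Qed.

Lemma normc_le_vnorm m (v : 'cV[C]_m) i : Normc.normc (v i 0) <= vnorm v.
Proof.
rewrite -[leLHS]ger0_norm ?normc_ge0//.
exact: (le_sqrt_sum_sqr (fun i => Normc.normc (v i 0))).
Qed.

Lemma vnorm_le_sum m (v : 'cV[C]_m) : vnorm v <= \sum_i Normc.normc (v i 0).
Proof.
by apply: (sqrt_sum_sqr_le (a := fun i => Normc.normc (v i 0))) => i; exact: normc_ge0.
Qed.

Lemma vnorm_scale_delta m (s : R) (j : 'I_m) :
  vnorm (s%:C%C *: (delta_mx j 0 : 'cV[C]_m)) = `|s|.
Proof.
rewrite /vnorm (bigD1 j)//= big1 ?addr0; last first.
  by move=> i ij; rewrite !mxE (negbTE ij) mulr0 Normc.normc0 expr0n.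
rewrite !mxE !eqxx mulr1 /= expr0n addr0 sqr_sqrtr ?sqr_ge0//.
by rewrite sqrtr_sqr.
Qed.

Lemma opnorm_le_sum m (A : 'M[C]_m) :
  opnorm A <= \sum_i \sum_j Normc.normc (A i j).
Proof.
apply: ge_sup.
  exists (vnorm (A *m 0)), 0 => //=.
  rewrite /vnorm big1 ?sqrtr0// => i _.
  by rewrite mxE Normc.normc0 expr0n.
move=> _ [v /= v1 <-]; apply: (le_trans (vnorm_le_sum _)); apply: ler_sum => i _.
rewrite mxE; apply: (le_trans (normc_sum_le _)); apply: ler_sum => j _.
rewrite Normc.normcM ler_piMr ?normc_ge0//.
exact: le_trans (normc_le_vnorm _ _) v1.
Qed.

Lemma opnorm_ge0 m (A : 'M[C]_m) : 0 <= opnorm A.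
Proof.
have A0 : [set vnorm (A *m v) | v in [set v : 'cV_m | vnorm v <= 1]] (vnorm (A *m 0)).
  exists 0 => //=; rewrite /vnorm big1 ?sqrtr0// => i _.
  by rewrite mxE Normc.normc0 expr0n.
apply: le_trans (vnorm_ge0 (A *m 0)) _; apply: ub_le_sup => //.
exists (\sum_i \sum_j Normc.normc (A i j)) => _ [v /= v1 <-].
apply: (le_trans (vnorm_le_sum _)); apply: ler_sum => i _.
rewrite mxE; apply: (le_trans (normc_sum_le _)); apply: ler_sum => j _.
rewrite Normc.normcM ler_piMr ?normc_ge0//.
exact: le_trans (normc_le_vnorm _ _) v1.
Qed.

End norms.

(** * Riesz transforms off the support *)

Section off_diagonal.
Context (R : realType) (d : nat).
Local Notation E := (Rd R d).
Local Notation mu := (leb R d).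
Local Notation C := R[i].

Lemma coord_le_dist2 (x y : E) l : `|tnth x l - tnth y l| <= dist2 x y.
Proof. exact: (le_sqrt_sum_sqr (fun i => tnth x i - tnth y i)). Qed.

(** When u vanishes near x, the truncated integrals are all equal for small radii. *)
Lemma riesz_off_support l (u : E -> R) x (e0 : R) : 0 < e0 ->
  (forall y, u y != 0 -> e0 <= dist2 x y) ->
  riesz l u x = \int[mu]_y (riesz_kernel l x y * u y).
Proof.
move=> e00 ux; rewrite /riesz; apply: lim_near_cst => //.
near=> e; rewrite Rintegral_mkcond; apply: eq_Rintegral => y _.
rewrite patchE; case: ifPn => // /negP ye.
have [->|u0] := eqVneq (u y) 0; first by rewrite mulr0.
exfalso; apply: ye; apply: mem_set => /=; apply: lt_le_trans (ux y u0).
near: e; exact: nbhs_right_lt.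
Unshelve. all: by end_near. Qed.

Lemma Re_mulmx_riesz m l (A : 'M[C]_m) (f : E -> 'cV[C]_m) x i (e0 : R) : 0 < e0 ->
  (forall y, f y != 0 -> e0 <= dist2 x y) ->
  complex.Re ((A *m @riesz_vec R d l m f x) i 0) = \sum_k
   (complex.Re (A i k) * (\int[mu]_y (riesz_kernel l x y * complex.Re (f y k 0))) -
    complex.Im (A i k) * (\int[mu]_y (riesz_kernel l x y * complex.Im (f y k 0)))).
Proof.
move=> e00 fx; rewrite mxE Re_sum; apply: eq_bigr => k _.
rewrite Re_mulc [@riesz_vec R d l m f x k 0]mxE /=.
congr (_ * _ - _ * _); apply: (riesz_off_support _ e00) => y u0.
- by apply: fx; apply: contraNneq u0 => ->; rewrite mxE.
- by apply: fx; apply: contraNneq u0 => ->; rewrite mxE.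
Qed.

Lemma mulmx_commutator m l (A : 'M[C]_m) (B : E -> 'M[C]_m) (f : E -> 'cV[C]_m) x :
  A *m commutator (mulop B) (@riesz_vec R d l m) f x =
  (A *m B x) *m @riesz_vec R d l m f x - A *m @riesz_vec R d l m (mulop B f) x.
Proof. by rewrite /commutator mulmxBr mulmxA. Qed.

End off_diagonal.

(** * The commutator between two separated cells *)

Section entries.
Context (F : fieldType) (m : nat).

Lemma scale_mulmx_entry n (c : F) (A : 'M[F]_m) (v : 'M[F]_(m, n)) i k :
  c * (A *m v) i k = ((c *: A) *m v) i k.
Proof. by rewrite -scalemxAl [RHS]mxE. Qed.

(** Separates the variables: A and U depend on different points, as do B and B'. *)
Lemma bilinear_entry (c : F) (A B B' U : 'M[F]_m) i j :
  c * (A *m (B - B') *m U) i j =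
  \sum_k ((c *: A) *m B) i k * U k j + \sum_k - (c *: A) i k * (B' *m U) k j.
Proof.
have -> : c * (A *m (B - B') *m U) i j =
    ((c *: A) *m B *m U - (c *: A) *m (B' *m U)) i j.
  by rewrite mulmxBr mulmxBl !mulmxA -!scalemxAl -scalerBr [RHS]mxE.
rewrite [LHS]mxE [X in X + _]mxE; congr (_ + _).
by rewrite [LHS]mxE mxE -sumrN; apply: eq_bigr => k _; rewrite mulNr.
Qed.

End entries.

Lemma Re_sub_entry (R : realType) m (v w : 'cV[R[i]]_m) i :
  complex.Re ((v - w) i 0) = complex.Re (v i 0) - complex.Re (w i 0).
Proof. by rewrite mxE [X in _ + X]mxE; case: (v i 0) (w i 0) => [? ?] [? ?]. Qed.

Section pair.
Context (R : realType) (m d : nat).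
Local Notation E := (Rd R d).
Local Notation mu := (leb R d).
Local Notation C := R[i].
Variables (p q : R).
Hypotheses (p1 : 1 < p) (q1 : 1 < q) (pq : p^-1 + q^-1 = 1).
Let p0 : 0 < p. Proof. exact: lt_trans p1. Qed.
Variables (U V B : E -> 'M[C]_m).
Hypotheses (mU : mxmeas U) (mV : mxmeas V) (mB : mxmeas B).
Hypotheses (pU : forall x, posdefmx (U x)) (pV : forall x, posdefmx (V x)).
Variables (l : 'I_d) (N : R).
Hypothesis N0 : 0 < N.
Hypothesis HN : (Lp_opnorm p U V (commutator (mulop B) (@riesz_vec R d l m)) <= N%:E)%E.

Let V1 x := mxpow (V x) p^-1.
Let Ui y := mxpow (U y) (- p^-1).
Let mV1 : mxmeas V1. Proof. exact: mxmeas_mxpow. Qed.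
Let mUi : mxmeas Ui. Proof. exact: mxmeas_mxpow. Qed.

(** The weight U^(1/p) turns this into 1_Y g times the j-th unit vector, so its norm in
    L^p(U) is the norm of g on Y. *)
Definition test_fun (Y : set E) (j : 'I_m) (g : E -> R) : E -> 'cV[C]_m :=
  fun y => (\1_Y y * g y)%:C%C *: col j (Ui y).

Lemma test_funE Y j g y k : test_fun Y j g y k 0 = (\1_Y y * g y)%:C%C * Ui y k j.
Proof. by rewrite /test_fun mxE [col j _ k 0]mxE. Qed.

Lemma mulmx_test_fun Y j g (A : 'M[C]_m) y k :
  (A *m test_fun Y j g y) k 0 = (\1_Y y * g y)%:C%C * (A *m Ui y) k j.
Proof. by rewrite /test_fun -scalemxAr mxE colE mulmxA -colE mxE. Qed.

Lemma cmeas_real (h : E -> R) : measurable_fun [set: E] h ->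
  cmeas (fun x => (h x)%:C%C).
Proof. by move=> mh; split => //=; exact: measurable_cst. Qed.

(** The bound on the entries of U^(-1/p) on Y makes the test function bounded. *)
Lemma test_fun_bound (Y : set E) (j : 'I_m) (g : E -> R) (n : R) c2 h :
  measurable Y -> Y `<=` hbox c2 h ->
  (forall y k, Y y -> `|complex.Re (Ui y k j)| <= n /\ `|complex.Im (Ui y k j)| <= n) ->
  nice mu g -> (pint mu p g <= 1)%E ->
  (\int[mu]_x (vnorm (V1 x *m commutator (mulop B) (@riesz_vec R d l m)
      (test_fun Y j g) x) `^ p)%:E <= (N `^ p)%:E)%E.
Proof.
move=> mY Yh Yn [mg [G gG] _] g1; set f := test_fun Y j g; set T := commutator _ _.
have bf : bounded_compact_supp f.
  split.
  - exists f; split; last by exists set0; split => //= x; apply.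
    move=> i k; have H : cmeas (fun y => (\1_Y y * g y)%:C%C * Ui y i j).
      apply: cmeasM; last exact: mUi.
      by apply: cmeas_real; apply: measurable_funM => //; exact: measurable_indic.
    have E : (fun y => (\1_Y y * g y)%:C%C * Ui y i j) = (fun y => f y i k).
      by apply/funext => y; rewrite (ord1 k) /f test_funE.
    by move: H; rewrite E.
  - exists (\sum_(k < m) (`|G| * (`|n| + `|n|))) => y.
    apply: (le_trans (vnorm_le_sum _)); apply: ler_sum => k _.
    rewrite /f test_funE Normc.normcM /= expr0n addr0 sqrtr_sqr normrM indicE.
    have [/set_mem Yy|_] := boolP (y \in Y); last first.
      by rewrite normr0 !mul0r mulr_ge0 ?addr_ge0.
    rewrite normr1 mul1r; apply: ler_pM => //; first exact: normc_ge0.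
      exact: le_trans (gG y) (ler_norm _).
    have [H1 H2] := Yn y k Yy; apply: (le_trans (normc_le_ReIm _)).
    by apply: lerD; [apply: (le_trans H1)|apply: (le_trans H2)]; exact: ler_norm.
  - exists (\sum_(k < d) (`|c2 k| + `|h|)) => y yr; rewrite /f /test_fun indicE.
    have [/set_mem Yy|_] := boolP (y \in Y); last by rewrite mul0r scale0r.
    exfalso; move: yr; apply/negP; rewrite -leNgt /norm2.
    rewrite (eq_bigr (fun k => `|tnth y k| ^+ 2)); last first.
      by move=> k _; rewrite real_normK ?num_real.
    apply: (le_trans (sqrt_sum_sqr_le (a := fun k => `|tnth y k|) _)) => //.
    apply: ler_sum => k _; have /andP[H1 H2] := Yh y Yy k.
    rewrite ler_norml; have := ler_norm (c2 k); have := ler_norm (- c2 k).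
    have := ler_norm h; rewrite normrN; lra.
have fU : (wLnorm p U f <= 1)%E.
  rewrite /wLnorm unlock -[leRHS](poweR1r p^-1); apply: le_poweR.
  - by rewrite invr_ge0 ltW.
  - by apply: integral_ge0 => x _; exact: poweR_ge0.
  apply: le_trans g1; apply: ge0_le_lower_integral => y _; first exact: poweR_ge0.
  rewrite abse_EFin poweR_EFin lee_fin.
  have -> : mxpow (U y) p^-1 *m f y = (\1_Y y * g y)%:C%C *: delta_mx j 0.
    rewrite /f /test_fun -scalemxAr colE mulmxA /Ui (mxpowVr p^-1 (pU y)).
    by rewrite mul1mx.
  rewrite vnorm_scale_delta normr_id; apply: ge0_ler_powR; rewrite ?nnegrE ?(ltW p0)//.
  rewrite normrM indicE; case: (y \in Y); first by rewrite normr1 mul1r.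
  by rewrite normr0 mul0r.
have TN : (wLnorm p V (T f) <= N%:E)%E.
  by apply: le_trans HN; apply: ereal_sup_ubound; exists f.
move: TN; rewrite /wLnorm unlock => TN.
rewrite (_ : (\int[mu]_x _)%E = (\int[mu]_x
    `|(vnorm (mxpow (V x) p^-1 *m T f x))%:E| `^ p)%E); last first.
  by apply: eq_integral => x _; rewrite abse_EFin poweR_EFin ger0_norm ?vnorm_ge0.
rewrite -poweR_EFin -[leLHS](@poweRVK _ _ p)//; last first.
  by apply: integral_ge0 => x _; exact: poweR_ge0.
by apply: le_poweR => //; [exact: ltW|exact: poweR_ge0].
Qed.

Variables (i j : 'I_m) (c : C).
Hypothesis c1 : Normc.normc c = 1.

(* The 4m terms of the expansion: the first boolean selects the term with B(x) or
   the one with B(y), the second one the real or the imaginary parts. *)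
Let J := (bool * bool * 'I_m)%type.
Let zA (b : bool) (k : 'I_m) x : C :=
  if b then ((c *: V1 x) *m B x) i k else - (c *: V1 x) i k.
Let zB (b : bool) (k : 'I_m) y : C := if b then Ui y k j else (B y *m Ui y) k j.
Let al (t : J) x : R := if t.1.2 then complex.Re (zA t.1.1 t.2 x)
  else - complex.Im (zA t.1.1 t.2 x).
Let be (t : J) y : R := if t.1.2 then complex.Re (zB t.1.1 t.2 y)
  else complex.Im (zB t.1.1 t.2 y).

(** The values c = 1 and c = -i give the real and imaginary parts of the entry. *)
Definition entry_kernel x y : R :=
  complex.Re (c * (V1 x *m (B x - B y) *m Ui y) i j).

Lemma sum_bool_bool (F : J -> R) : \sum_t F t =
  \sum_k (F (true, true, k) + F (true, false, k)) +
  \sum_k (F (false, true, k) + F (false, false, k)).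
Proof.
rewrite (eq_bigr (fun t : J => F (t.1, t.2))); last by case.
rewrite -(pair_bigA _ (fun bb k => F (bb, k))) /=.
rewrite (eq_bigr (fun bb : bool * bool => \sum_k F (bb.1, bb.2, k))); last by case.
rewrite -(pair_bigA _ (fun b b' => \sum_k F (b, b', k))) /= !big_bool.
by rewrite !big_split.
Qed.

Lemma entry_kernelE x y : entry_kernel x y = \sum_t al t x * be t y.
Proof.
rewrite sum_bool_bool /entry_kernel.
have -> : c * (V1 x *m (B x - B y) *m Ui y) i j =
    \sum_k zA true k x * zB true k y + \sum_k zA false k x * zB false k y.
  exact: bilinear_entry.
rewrite (_ : complex.Re (_ + _) = complex.Re (\sum_k zA true k x * zB true k y) +
   complex.Re (\sum_k zA false k x * zB false k y)); last first.
  by case: (\sum__ _) => ? ?; case: (\sum__ _).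
rewrite !Re_sum; congr (_ + _); apply: eq_bigr => k _.
- by rewrite Re_mulc /al /be /= mulNr.
- by rewrite Re_mulc /al /be /= mulNr.
Qed.

(** At a positive distance from Y the commutator is an integral operator, whose kernel
    is the Riesz kernel times the weighted difference of B. *)
Lemma Re_entry_commutator (Y : set E) (g : E -> R) x (e0 : R) : 0 < e0 ->
  (forall y, Y y -> e0 <= dist2 x y) ->
  complex.Re (c * (V1 x *m commutator (mulop B) (@riesz_vec R d l m)
      (test_fun Y j g) x) i 0) =
  \sum_t al t x * \int[mu]_y (riesz_kernel l x y * (be t y * (\1_Y y * g y))).
Proof.
move=> e00 Yx; set f := test_fun Y j g.
have fx y : f y != 0 -> e0 <= dist2 x y.
  move=> fy; apply: Yx; apply: contrapT => nY; move/eqP: fy; apply.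
  by rewrite /f /test_fun indicE memNset// mul0r scale0r.
have Bfx y : mulop B f y != 0 -> e0 <= dist2 x y.
  by move=> fy; apply: fx; apply: contraNneq fy => fy; rewrite /mulop fy mulmx0.
rewrite (_ : c * _ = ((c *: V1 x) *m commutator (mulop B) (@riesz_vec R d l m) f x) i 0); last first.
  exact: scale_mulmx_entry.
rewrite mulmx_commutator Re_sub_entry.
apply: etrans (congr2 (fun a b => a - b) (Re_mulmx_riesz _ _ _ e00 fx)
  (Re_mulmx_riesz _ _ _ e00 Bfx)) _.
rewrite sum_bool_bool -sumrN; congr (_ + _); apply: eq_bigr => k _.
- rewrite /al /be /zA /zB /= mulNr; congr (_ * _ - _ * _); apply: eq_Rintegral => y _.
  + by rewrite /f test_funE Re_mulc /= mul0r subr0; ring.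
  + by rewrite /f test_funE Im_mulc /= mul0r addr0; ring.
- rewrite /al /be /zA /zB /= raddfN raddfN /= opprK opprB addrC mulNr.
  congr (- (_ * _) + _ * _); apply: eq_Rintegral => y _.
  + by rewrite /mulop mulmx_test_fun Re_mulc /= mul0r subr0; ring.
  + by rewrite /mulop mulmx_test_fun Im_mulc /= mul0r addr0; ring.
Qed.

Let mcV1 : mxmeas (fun x => c *: V1 x).
Proof.
move=> k k'; have H : cmeas (fun x => c * V1 x k k').
  by apply: cmeasM; [exact: cmeas_cst|exact: mV1].
have -> : (fun x => (c *: V1 x) k k') = (fun x => c * V1 x k k').
  by apply/funext => x; rewrite mxE.
exact: H.
Qed.

Let mal t : measurable_fun [set: E] (al t).
Proof.
have H b k : cmeas (zA b k).
  case: b; rewrite /zA /=; first exact: (mxmeasM mcV1 mB).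
  have -> : (fun x => - (c *: V1 x) i k) = (fun x => (-1) * (c *: V1 x) i k).
    by apply/funext => x; rewrite mulN1r.
  by apply: cmeasM; [exact: cmeas_cst|exact: mcV1].
rewrite /al; case: t => [[b b'] k] /=; case: b'; first exact: (H b k).1.
exact: measurable_funN (H b k).2.
Qed.

Let mbe t : measurable_fun [set: E] (be t).
Proof.
have H b k : cmeas (zB b k).
  by case: b; rewrite /zB /=; [exact: mUi|exact: (mxmeasM mB mUi)].
by rewrite /be; case: t => [[b b'] k] /=; case: b'; [exact: (H b k).1|exact: (H b k).2].
Qed.

Variables (a1 a2 : 'I_d -> R) (h : R).
Hypothesis h0 : 0 < h.
Let w k := (a1 k - a2 k) / h.
Variable e : R.
Hypothesis wl : 2 <= `|w l|.
Hypothesis stable : forall w' : 'I_d -> R, (forall k, `|w' k - w k| <= 1) ->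
  `|1 - riesz_fun l w' / riesz_fun l w| <= e.
Hypothesis e0 : 0 <= e.
Let n := #|{: J}|.
Hypothesis ec : 16 * n%:R ^+ 2 * e <= 2^-1.

(* The Riesz kernel at the corners of the two boxes. *)
Let K0 := h ^- d * riesz_fun l w.

Let wl_gt0 : riesz_fun l w != 0.
Proof.
have w0 : w l != 0 by rewrite -normr_gt0; apply: lt_le_trans wl.
rewrite /riesz_fun mulf_neq0// invr_neq0// expf_neq0// gt_eqF// sqrtr_gt0.
by apply: lt_le_trans (sqr_le_sqnorm w l); rewrite lt_def sqrf_eq0 w0 sqr_ge0.
Qed.

Let K0_neq0 : K0 != 0.
Proof. by rewrite /K0 mulf_neq0 ?wl_gt0// invr_neq0// expf_neq0// gt_eqF. Qed.

Let diff_box x y : hbox a1 h x -> hbox a2 h y ->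
  forall k, `|(tnth x k - tnth y k) / h - w k| <= 1.
Proof.
move=> X Y k; have /andP[H1 H2] := X k; have /andP[H3 H4] := Y k.
rewrite /w -mulrBl normrM normfV (gtr0_norm h0) ler_pdivrMr// mul1r ler_norml.
by apply/andP; split; lra.
Qed.

Let rho x y := riesz_kernel l x y / K0.

Let rho_near x y : hbox a1 h x -> hbox a2 h y -> `|1 - rho x y| <= e.
Proof.
move=> X Y; have := stable (diff_box X Y).
rewrite /rho riesz_kernelE.
have -> : riesz_fun l (fun k => tnth x k - tnth y k) =
    h ^- d * riesz_fun l (fun k => (tnth x k - tnth y k) / h).
  rewrite -riesz_funZ//; congr (riesz_fun l _); apply/funext => k.
  by rewrite mulrC divfK// gt_eqF.
set A := riesz_fun l (fun k => _ / h).
have hd : h ^- d != 0 by rewrite invr_neq0// expf_neq0// gt_eqF.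
by rewrite (_ : h ^- d * A / K0 = A / riesz_fun l w)// /K0 -mulf_div divff// mul1r.
Qed.

Let dist_box x y : hbox a1 h x -> hbox a2 h y -> h <= dist2 x y.
Proof.
move=> X Y; apply: le_trans (coord_le_dist2 x y l).
have := diff_box X Y l; set z := tnth x l - tnth y l => H.
have : 1 <= `|z / h|.
  have := ler_normD (w l - z / h) (z / h); rewrite subrK distrC; move: wl H; lra.
by rewrite normrM normfV (gtr0_norm h0) ler_pdivlMr// mul1r.
Qed.

Let mK : measurable_fun [set: E * E] (fun z => riesz_kernel l z.1 z.2).
Proof.
have mt k : measurable_fun [set: E * E] (fun z => tnth z.1 k - tnth z.2 k).
  apply: measurable_funB.
  - exact: (measurableT_comp (measurable_tnth k) measurable_fst).
  - exact: (measurableT_comp (measurable_tnth k) measurable_snd).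
rewrite /riesz_kernel; apply: measurable_funM => //.
apply: measurable_funV_ge0; first by move=> z; rewrite exprn_ge0// sqrtr_ge0.
apply: measurable_funX; rewrite /dist2.
have -> : (fun z : E * E => Num.sqrt (\sum_i (tnth z.1 i - tnth z.2 i) ^+ 2)) =
    (fun z => (\sum_i (tnth z.1 i - tnth z.2 i) ^+ 2) `^ 2^-1).
  by apply/funext => z; rewrite powR12_sqrt// sumr_ge0// => k _; exact: sqr_ge0.
apply: (measurableT_comp (measurable_powR _)).
by apply: measurable_sum => k; exact: measurable_funX.
Qed.

(* The part of a box where all factors f_t are bounded by b. *)
Let small (f : J -> E -> R) (a : 'I_d -> R) (b : nat) : set E :=
  hbox a h `&` [set x | forall t, `|f t x| <= b%:R].

Let msmall f a b : (forall t, measurable_fun [set: E] (f t)) -> measurable (small f a b).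
Proof.
move=> mf; apply: measurableI; first exact: measurable_hbox.
have -> : [set x | forall t, `|f t x| <= b%:R] =
    \bigcap_(t in [set: J]) ((fun x => `|f t x|) @^-1` `]-oo, (b%:R : R)]%classic).
  apply/seteqP; split => x H t; first by move=> _; rewrite /preimage /= in_itv /=; exact: H.
  by have := H t Logic.I; rewrite /preimage /= in_itv /=.
apply: fin_bigcap_measurable => [|t _]; first exact: finite_finset.
rewrite -[X in measurable X]setTI.
have mn : measurable_fun [set: E] (fun x => `|f t x|) by exact: measurableT_comp.
exact: mn.
Qed.

Let small_mono f a b b' : (b <= b')%N -> small f a b `<=` small f a b'.
Proof.
move=> bb x [H1 H2]; split => // t; apply: (le_trans (H2 t)).
by rewrite ler_nat.
Qed.

Let small_cover f a x : hbox a h x -> exists b, small f a b x.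
Proof.
move=> ax; exists (Num.truncn (\sum_t `|f t x|)).+1; split => // t.
apply: (@le_trans _ _ (\sum_t `|f t x|)); last by rewrite ltW// truncnS_gt.
by rewrite (bigD1 t)//= lerDl; apply: sumr_ge0.
Qed.

Let nice_small f a b t : (forall t, measurable_fun [set: E] (f t)) ->
  nice mu (fun x => \1_(small f a b) x * f t x).
Proof.
move=> mf; split.
- by apply: measurable_funM => //; exact: measurable_indic (msmall _ _ _).
- exists b%:R => x; rewrite indicE.
  have [/set_mem [_ H]|_] := boolP (x \in _); first by rewrite mul1r.
  by rewrite mul0r normr0.
- exists (small f a b); split; first exact: msmall.
    apply: le_lt_trans (leb_hbox_lty a h).
    by apply: le_measure; rewrite ?inE; [exact: msmall|exact: measurable_hbox|move=> x []].
  by move=> x nx; rewrite indicE memNset// mul0r.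
Qed.

Let X b := small al a1 b.
Let Y b := small be a2 b.

Let pair_kernel b x y := \1_(X b) x * \1_(Y b) y * entry_kernel x y.

Let pair_kernelE b x y : pair_kernel b x y = \sum_(t < n)
  (\1_(X b) x * al (enum_val t) x) * (\1_(Y b) y * be (enum_val t) y).
Proof.
rewrite /pair_kernel entry_kernelE mulr_sumr.
rewrite (eq_bigl (fun t => t \in {: J})) // big_enum_val.
by apply: eq_bigr => t _; ring.
Qed.

(** The absorption argument, on the sets where all factors are at most b. *)
Lemma pair_truncated b :
  (mixed mu mu q (p - 1) (pair_kernel b) <=
    ((2 * (16 * n%:R ^+ 2) * (N / `|K0|)) `^ p)%:E)%E /\
  (mixed mu mu p (q - 1) (fun y x => pair_kernel b x y) <=
    ((2 * (16 * n%:R ^+ 2) * (N / `|K0|)) `^ q)%:E)%E.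
Proof.
have K00 : 0 < `|K0| by rewrite normr_gt0; exact: K0_neq0.
have -> : pair_kernel b = fun x y => \sum_(t < n)
    (\1_(X b) x * al (enum_val t) x) * (\1_(Y b) y * be (enum_val t) y).
  by apply/funext => x; apply/funext => y; exact: pair_kernelE.
apply: (perturbed_op_bound_mixed_bound (mu1 := mu) (mu2 := mu) p1 q1 pq _ _
  (X := X b) (Y := Y b) (rho := rho) (e := e)) => //.
- by move=> t; exact: nice_small.
- by move=> t; exact: nice_small.
- by move=> t x nx; rewrite indicE memNset// mul0r.
- by move=> t x nx; rewrite indicE memNset// mul0r.
- by apply: measurable_funM => //; exact: measurable_cst.
- by move=> x y [Xx _] [Yy _]; exact: rho_near.
- by rewrite divr_gt0.
move=> g ng g1.
have mg : measurable_fun [set: E] g by case: ng.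
pose s x := \int[mu]_y (riesz_kernel l x y * pair_kernel b x y * g y).
have mpk : measurable_fun [set: E * E] (fun z => pair_kernel b z.1 z.2).
  under eq_fun do rewrite pair_kernelE.
  apply: measurable_sum => t; apply: measurable_funM.
  - have [H _ _] := nice_small a1 b (enum_val t) mal.
    exact: (measurableT_comp H measurable_fst).
  - have [H _ _] := nice_small a2 b (enum_val t) mbe.
    exact: (measurableT_comp H measurable_snd).
have ms : measurable_fun [set: E] s.
  rewrite /s /Rintegral; apply: (measurableT_comp (f := fine)); first exact: fine_measurable.
  apply: (measurable_param_integral mu
    (f := fun z => (riesz_kernel l z.1 z.2 * pair_kernel b z.1 z.2 * g z.2)%:E)).
  apply/measurable_EFinP; apply: measurable_funM; first exact: measurable_funM.
  exact: (measurableT_comp mg measurable_snd).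
have nterm x t : X b x -> nice mu
    (fun y => riesz_kernel l x y * (be t y * (\1_(Y b) y * g y))).
  move=> [Xx _].
  rewrite (_ : (fun y => _) =
    (fun y => (riesz_kernel l x y * (\1_(Y b) y * be t y)) * g y)); last first.
    by apply/funext => y; ring.
  have [mb [G bG] _] := nice_small a2 b t mbe.
  apply: (nice_mul ng).
    apply: measurable_funM => //.
    exact: (@measurable_fun_pair2 _ _ _ _ _ _ (fun z => riesz_kernel l z.1 z.2) x mK).
  exists (`|K0| * (1 + e) * `|G|) => y.
  have [[Yy Yb]|nY] := pselect (Y b y); last first.
    rewrite indicE memNset// mul0r mulr0 normr0; apply: mulr_ge0 => //.
    by apply: mulr_ge0 => //; exact: addr_ge0.
  rewrite normrM; apply: ler_pM => //; last exact: le_trans (bG y) (ler_norm _).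
  have := rho_near Xx Yy; rewrite /rho => H.
  rewrite -[riesz_kernel l x y](divfK K0_neq0) normrM mulrC.
  apply: ler_wpM2l => //; move: H; set z := _ / K0 => H.
  by rewrite -[z](subrK 1); apply: (le_trans (ler_normD _ _)); rewrite normr1 distrC; lra.
have sE x : X b x -> s x =
    complex.Re (c * (V1 x *m commutator (mulop B) (@riesz_vec R d l m)
      (test_fun (Y b) j g) x) i 0).
  move=> Xx; rewrite (@Re_entry_commutator (Y b) g x h h0); last first.
    by move=> y [Yy _]; apply: dist_box => //; case: Xx.
  rewrite -nice_Rintegral_sum; last by move=> t; exact: nterm.
  apply: eq_Rintegral => y _; rewrite /pair_kernel entry_kernelE indicE mem_set//.
  rewrite mul1r !mulr_sumr mulr_suml; apply: eq_bigr => t _; ring.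
have s0 x : ~ X b x -> s x = 0.
  move=> nx; rewrite /s; under eq_Rintegral do
    rewrite /pair_kernel indicE memNset// !mul0r mulr0 mul0r.
  by rewrite Rintegral_cst// mul0r.
have -> : (fun x => (\int[mu]_y (rho x y * (\sum_(t < n)
    (\1_(X b) x * al (enum_val t) x) * (\1_(Y b) y * be (enum_val t) y)) * g y))%R) =
   fun x => K0^-1 * s x.
  apply/funext => x.
  have [Xx|nx] := pselect (X b x); last first.
    rewrite s0// mulr0; under eq_Rintegral do
      rewrite -pair_kernelE /pair_kernel indicE memNset// !mul0r mulr0 mul0r.
    by rewrite Rintegral_cst// mul0r.
  rewrite /s -RintegralZl//; last first.
    apply: nice_integrable.
    rewrite (_ : (fun y => _) = fun y => \sum_t
      (al t x) * (riesz_kernel l x y * (be t y * (\1_(Y b) y * g y)))); last first.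
      apply/funext => y; rewrite /pair_kernel entry_kernelE indicE mem_set//.
      rewrite mul1r !mulr_sumr mulr_suml; apply: eq_bigr => t _; ring.
    by apply: nice_sum => t; apply: niceZ; exact: nterm.
  by apply: eq_Rintegral => y _; rewrite -pair_kernelE /rho; ring.
rewrite pintZ// powRM ?(ltW N0) ?invr_ge0// mulrC EFinM normfV.
apply: lee_wpmul2l; first by rewrite lee_fin powR_ge0.
have tfb := @test_fun_bound (Y b) j g b%:R a2 h (msmall _ _ mbe).
apply: le_trans (tfb _ _ ng g1) => //; last 2 first.
- by move=> y [].
- move=> y k [_ Yb]; split; first exact: (Yb (true, true, k)).
  exact: (Yb (true, false, k)).
apply: ge0_le_lower_integral => x _; first by rewrite lee_fin powR_ge0.
rewrite lee_fin; apply: ge0_ler_powR; rewrite ?nnegrE ?(ltW p0) ?vnorm_ge0//.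
have [Xx|nx] := pselect (X b x); last by rewrite s0// normr0 vnorm_ge0.
rewrite sE//; apply: (le_trans (Re_le_normc _)); rewrite Normc.normcM c1 mul1r.
exact: normc_le_vnorm.
Qed.

Lemma measurable_entry_kernel : measurable_fun [set: E * E] (fun z => entry_kernel z.1 z.2).
Proof.
under eq_fun do rewrite entry_kernelE.
apply: measurable_sum => t; apply: measurable_funM.
- exact: (measurableT_comp (mal t) measurable_fst).
- exact: (measurableT_comp (mbe t) measurable_snd).
Qed.

Lemma pair_bound :
  (\int[mu]_(x in hbox a1 h) (\int[mu]_(y in hbox a2 h)
     (`|entry_kernel x y| `^ q)%:E) `^ (p - 1) <=
    ((2 * (16 * n%:R ^+ 2) * (N / `|K0|)) `^ p)%:E)%E /\
  (\int[mu]_(y in hbox a2 h) (\int[mu]_(x in hbox a1 h)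
     (`|entry_kernel x y| `^ p)%:E) `^ (q - 1) <=
    ((2 * (16 * n%:R ^+ 2) * (N / `|K0|)) `^ q)%:E)%E.
Proof.
have bb (b b' : bool) (r z : R) : 0 < r ->
    `|b%:R * b'%:R * z| `^ r = b%:R * b'%:R * `|z| `^ r.
  move=> r0; have z0 : `|0 : R| `^ r = 0 by rewrite normr0 powR0 ?(gt_eqF r0).
  by case: b; case: b'; rewrite ?mulr1 ?mulr0 ?mul0r ?mul1r.
have q0 : 0 < q by exact: lt_trans q1.
split.
- apply: (mixed_integral_exhaust (k := fun z => (`|entry_kernel z.1 z.2| `^ q)%:E)
    (X := X) (Y := Y)); rewrite ?subr_gt0//.
  + apply/measurable_EFinP/measurable_powR_norm; exact: measurable_entry_kernel.
  + by move=> b; exact: msmall.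
  + by move=> b; exact: msmall.
  + by move=> b b' bb'; exact: small_mono.
  + by move=> b b' bb'; exact: small_mono.
  + by move=> x; exact: small_cover.
  + by move=> x; exact: small_cover.
  + move=> b; apply: le_trans (pair_truncated b).1.
    rewrite /mixed le_eqVlt; apply/orP; left; apply/eqP; apply: eq_integral => x _.
    congr (_ `^ _)%E; apply: eq_integral => y _.
    by rewrite -EFinM /pair_kernel !indicE bb.
- apply: (mixed_integral_exhaust (k := fun z => (`|entry_kernel z.2 z.1| `^ p)%:E)
    (X := Y) (Y := X)); rewrite ?subr_gt0//.
  + apply/measurable_EFinP/measurable_powR_norm.
    apply: (measurableT_comp (f := fun z : E * E => entry_kernel z.1 z.2)
      (g := fun z => (z.2, z.1))); first exact: measurable_entry_kernel.
    exact: measurable_fun_pair measurable_snd measurable_fst.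
  + by move=> b; exact: msmall.
  + by move=> b; exact: msmall.
  + by move=> b b' bb'; exact: small_mono.
  + by move=> b b' bb'; exact: small_mono.
  + by move=> x; exact: small_cover.
  + by move=> x; exact: small_cover.
  + move=> b; apply: le_trans (pair_truncated b).2.
    rewrite /mixed le_eqVlt; apply/orP; left; apply/eqP; apply: eq_integral => x _.
    congr (_ `^ _)%E; apply: eq_integral => y _.
    by rewrite -EFinM /pair_kernel !indicE bb// [_ * (y \in _)%:R]mulrC.
Qed.

End pair.

(** * From cubes to averages *)

Section average_bound.
Context (R : realType) (d : nat).
Local Notation E := (Rd R d).
Local Notation mu := (leb R d).

Lemma measurable_param_integral_in (f : E * E -> \bar R) (A : set E) :
  measurable A -> measurable_fun [set: E * E] f ->
  measurable_fun [set: E] (fun x => \int[mu]_(y in A) f (x, y))%E.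
Proof.
move=> mA mf.
rewrite (_ : (fun x => _) =
    (fun x => \int[mu]_y (f (x, y) * (\1_A y : R)%:E))%E); last first.
  by apply/funext => x; rewrite integral_mkcond epatch_indic.
apply: (measurable_param_integral mu (f := fun z => f z * (\1_A z.2 : R)%:E)%E).
apply: emeasurable_funM => //; apply/measurable_EFinP.
have mA1 : measurable_fun [set: E] (\1_A : E -> R) by exact: measurable_indic.
exact: (measurableT_comp mA1 measurable_snd).
Qed.

Lemma mixed_integral_sum_le (T : finType) (k : T -> E * E -> \bar R) (A B : set E)
    (r : R) : 0 < r -> measurable A -> measurable B ->
  (forall t, measurable_fun [set: E * E] (k t)) -> (forall t z, 0 <= k t z)%E ->
  (\int[mu]_(x in A) (\int[mu]_(y in B) \sum_t k t (x, y)) `^ r <=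
   (#|T|%:R `^ r)%:E * \sum_t \int[mu]_(x in A) (\int[mu]_(y in B) k t (x, y)) `^ r)%E.
Proof.
move=> r0 mA mB mk k0.
have mkB t : measurable_fun A (fun x => (\int[mu]_(y in B) k t (x, y)) `^ r)%E.
  apply: measurable_funTS; apply: (measurableT_comp (measurable_poweR r)).
  exact: measurable_param_integral_in.
have kB0 t x : (0 <= (\int[mu]_(y in B) k t (x, y)) `^ r)%E by exact: poweR_ge0.
rewrite -ge0_integral_sum// -ge0_integralZl//; last 2 first.
- exact: emeasurable_sum.
- by move=> x _; exact: sume_ge0.
apply: ge0_le_lower_integral => x _; first exact: poweR_ge0.
rewrite ge0_integral_sum//; last first.
  by move=> t; apply: measurable_funTS; exact: (measurable_fun_pair2 x (mk t)).
by apply: poweR_sum_le => // t; exact: integral_ge0.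
Qed.

Definition average_const (T : finType) (p q D : R) : R :=
  (#|T|%:R `^ (q * (p - 1)) * (#|T|%:R `^ (p - 1) * (#|T|%:R * D))) `^ p^-1.

(** The factor |Q|^(-1) of the outer average and |Q|^(-(p-1)) of the inner one cancel
    |Q|^p exactly. *)
Lemma average_mixed_le (T : finType) (kk : E -> E -> R) (g : T -> E -> E -> R)
    (p q D N : R) (Q : set E) : 1 < p -> 0 < q -> p / q = p - 1 -> 0 <= D -> 0 < N ->
  (forall x y, 0 <= kk x y) -> (forall x y, kk x y <= \sum_t `|g t x y|) ->
  (forall t, measurable_fun [set: E * E] (fun z => g t z.1 z.2)) ->
  (forall t (a : E) (s : R), (0 < s)%R -> \int[mu]_(x in cube a s)
     (\int[mu]_(y in cube a s) (`|g t x y| `^ q)%:E) `^ (p - 1) <=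
     (D * N `^ p * (s ^+ d) `^ p)%:E)%E ->
  cubes Q ->
  (average Q (fun x => average Q (fun y => (kk x y `^ q)%:E) `^ (p / q)) `^ p^-1 <=
   (average_const T p q D * N)%:E)%E.
Proof.
move=> p1 q0 -> D0 N0 kk0 kkg mg gD [a [s [s0 ->]]].
have p0 : 0 < p by exact: lt_trans p1.
have r0 : 0 < p - 1 by rewrite subr_gt0.
have mQ : measurable (cube a s) by exact: measurable_cube.
set v := s ^+ d; have v0 : 0 < v by exact: exprn_gt0.
rewrite /average leb_cube ?(ltW s0)//= -/v.
pose G t (z : E * E) : \bar R := (`|g t z.1 z.2| `^ q)%:E.
have mG t : measurable_fun [set: E * E] (G t).
  exact/measurable_EFinP/measurable_powR_norm.
have G0 t z : (0 <= G t z)%E by rewrite lee_fin powR_ge0.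
have kG x y : ((kk x y `^ q)%:E <= (#|T|%:R `^ q)%:E * \sum_t G t (x, y))%E.
  rewrite sumEFin -EFinM lee_fin.
  apply: le_trans (powR_sum_le q0 _); last by [].
  by apply: ge0_ler_powR; rewrite ?(ltW q0)// nnegrE// sumr_ge0.
pose n := #|T|%:R : R.
have step : (\int[mu]_(x in cube a s) (v^-1%:E *
     \int[mu]_(y in cube a s) (kk x y `^ q)%:E) `^ (p - 1) <=
   ((v^-1 * n `^ q) `^ (p - 1) * (n `^ (p - 1) * (n * (D * N `^ p * v `^ p))))%:E)%E.
  apply: (@le_trans _ _ (\int[mu]_(x in cube a s)
    (((v^-1 * n `^ q) `^ (p - 1))%:E *
      (\int[mu]_(y in cube a s) \sum_t G t (x, y)) `^ (p - 1)))%E).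
    apply: ge0_le_lower_integral => x _; first exact: poweR_ge0.
    have S0 : (0 <= \int[mu]_(y in cube a s) (\sum_t G t (x, y)))%E.
      by apply: integral_ge0 => y _; exact: sume_ge0.
    rewrite -poweR_EFin -poweRM//; last first.
      by rewrite lee_fin mulr_ge0 ?invr_ge0 ?(ltW v0)// powR_ge0.
    apply: le_poweR; first exact: ltW.
      apply: mule_ge0; first by rewrite lee_fin invr_ge0 ltW.
      by apply: integral_ge0 => y _; rewrite lee_fin powR_ge0.
    rewrite EFinM -muleA; apply: lee_wpmul2l; first by rewrite lee_fin invr_ge0 ltW.
    rewrite -ge0_integralZl//; last 3 first.
    - apply: emeasurable_sum => t; apply: measurable_funTS.
      exact: (measurable_fun_pair2 x (mG t)).
    - by move=> y _; exact: sume_ge0.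
    - by rewrite lee_fin powR_ge0.
    apply: ge0_le_lower_integral => y _; first by rewrite lee_fin powR_ge0.
    exact: kG.
  rewrite ge0_integralZl//; last 3 first.
  - apply: measurable_funTS; apply: (measurableT_comp (measurable_poweR _)).
    apply: (measurable_param_integral_in mQ (f := fun z => (\sum_t G t z)%E)).
    exact: emeasurable_sum.
  - by move=> x _; exact: poweR_ge0.
  - by rewrite lee_fin powR_ge0.
  rewrite EFinM; apply: lee_wpmul2l; first by rewrite lee_fin powR_ge0.
  apply: (le_trans (mixed_integral_sum_le r0 mQ mQ mG G0)).
  rewrite EFinM; apply: lee_wpmul2l; first by rewrite lee_fin powR_ge0.
  rewrite /n -sum_EFin_cst; apply: lee_sum => t _; exact: gD.
rewrite -[leRHS](@poweRK _ _ p)//; last by rewrite lee_fin mulr_ge0 ?powR_ge0 ?(ltW N0).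
apply: le_poweR; first by rewrite invr_ge0 ltW.
  apply: mule_ge0; first by rewrite lee_fin invr_ge0 ltW.
  by apply: integral_ge0 => x _; exact: poweR_ge0.
apply: (@le_trans _ _ (v^-1%:E * ((v^-1 * n `^ q) `^ (p - 1) *
   (n `^ (p - 1) * (n * (D * N `^ p * v `^ p))))%:E)%E).
  by apply: lee_wpmul2l => //; rewrite lee_fin invr_ge0 ltW.
rewrite -EFinM poweR_EFin lee_fin le_eqVlt; apply/orP; left; apply/eqP.
rewrite powRM ?powR_ge0 ?(ltW N0)// /average_const -powRrM mulVf ?gt_eqF// powRr1; last first.
  by rewrite !mulr_ge0 ?powR_ge0.
rewrite powRM ?invr_ge0 ?powR_ge0 ?(ltW v0)// -powRrM -/n.
have -> : v `^ p = v * v `^ (p - 1).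
  have : v `^ (1 + (p - 1)) = v `^ 1 * v `^ (p - 1).
    by apply: powRD; apply/implyP => _; rewrite gt_eqF.
  by rewrite powRr1 ?(ltW v0)// => <-; rewrite [1 + _]addrC subrK.
have vv : v^-1 `^ (p - 1) * v `^ (p - 1) = 1.
  by rewrite -powRM ?invr_ge0 ?(ltW v0)// mulVf ?powR1// gt_eqF.
transitivity ((v^-1 * v) * (v^-1 `^ (p - 1) * v `^ (p - 1)) *
   (n `^ (q * (p - 1)) * (n `^ (p - 1) * (n * D)) * N `^ p)); last first.
  by rewrite vv mulVf ?gt_eqF// !mul1r.
by ring.
Qed.

End average_bound.

(** * The bound for Borel weights *)

Section borel_bound.
Context (R : realType) (m d : nat).
Local Notation E := (Rd R d).
Local Notation mu := (leb R d).
Local Notation C := R[i].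
Hypothesis d0 : (0 < d)%N.
Variables (p q : R).
Hypotheses (p1 : 1 < p) (q1 : 1 < q) (pq : p^-1 + q^-1 = 1).
Let p0 : 0 < p. Proof. exact: lt_trans p1. Qed.
Let q0 : 0 < q. Proof. exact: lt_trans q1. Qed.
Let n : R := #|{: bool * bool * 'I_m}|%:R.

Variables (M : nat) (e : R).
Hypotheses (M1 : (1 < M)%N) (e0 : 0 <= e) (ec : 16 * n ^+ 2 * e <= 2^-1).
Hypothesis stable : forall w : 'I_d -> R, (exists j, M%:R <= `|w j|) ->
  exists l, M%:R <= `|w l| /\ forall w' : 'I_d -> R,
    (forall j, `|w' j - w j| <= 1) ->
    `|1 - riesz_fun l w' / riesz_fun l w| <= e.

(** The last factor bounds the inverse of the Riesz kernel at offsets of size at most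
    2M + 3. *)
Definition cell_const : R :=
  2 * (16 * n ^+ 2) * (d%:R * (2 * M + 3)%:R) ^+ d.+1.

Lemma cell_const_ge0 : 0 <= cell_const.
Proof. by rewrite !mulr_ge0 ?exprn_ge0 ?mulr_ge0. Qed.

Section fixed_weights.
Variables (U V B : E -> 'M[C]_m) (N : R).
Hypotheses (mU : mxmeas U) (mV : mxmeas V) (mB : mxmeas B).
Hypotheses (pU : forall x, posdefmx (U x)) (pV : forall x, posdefmx (V x)).
Hypothesis N0 : 0 < N.
Hypothesis HN : forall l : 'I_d,
  (Lp_opnorm p U V (commutator (mulop B) (@riesz_vec R d l m)) <= N%:E)%E.

Section entry.
Variables (i j : 'I_m) (c : C).
Hypothesis c1 : Normc.normc c = 1.
Local Notation kij := (entry_kernel p U V B i j c).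

Lemma cell_bound (a1 a2 : 'I_d -> R) (h : R) : 0 < h ->
  (exists j, M%:R <= `|(a1 j - a2 j) / h|) ->
  (forall j, `|(a1 j - a2 j) / h| <= (2 * M + 3)%:R) ->
  (\int[mu]_(x in hbox a1 h) (\int[mu]_(y in hbox a2 h)
     (`|kij x y| `^ q)%:E) `^ (p - 1) <= ((cell_const * N * h ^+ d) `^ p)%:E)%E /\
  (\int[mu]_(y in hbox a2 h) (\int[mu]_(x in hbox a1 h)
     (`|kij x y| `^ p)%:E) `^ (q - 1) <= ((cell_const * N * h ^+ d) `^ q)%:E)%E.
Proof.
move=> h0 far near; have [l [wl wst]] := stable far.
have M2 : 2 <= M%:R :> R by rewrite ler_nat.
have w2 : 2 <= `|(a1 l - a2 l) / h| by exact: le_trans wl.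
have w1 : 1 <= `|(a1 l - a2 l) / h| by apply: le_trans w2; rewrite ler1n.
have low := riesz_fun_lower (w := fun k => (a1 k - a2 k) / h) w1 near.
have hd : 0 < h ^+ d by exact: exprn_gt0.
set b := 2 * (16 * n ^+ 2) * (N / `|h ^- d * riesz_fun l (fun k => (a1 k - a2 k) / h)|).
have b0 : 0 <= b.
  by rewrite /b mulr_ge0// ?mulr_ge0 ?exprn_ge0 ?divr_ge0 ?(ltW N0).
have bc : b <= cell_const * N * h ^+ d.
  rewrite /b /cell_const -!mulrA; do 4 apply: ler_wpM2l => //.
  rewrite [leRHS]mulrCA; apply: ler_wpM2l; first exact: ltW.
  rewrite normrM invfM normfV invrK (gtr0_norm hd) [leRHS]mulrC.
  apply: ler_wpM2l; first exact: ltW.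
  rewrite -[leRHS]invrK lef_pV2 ?posrE ?invr_gt0//.
  - apply: lt_le_trans low; rewrite invr_gt0 exprn_gt0// mulr_gt0 ?ltr0n//.
    by rewrite addn_gt0 orbT.
  - by rewrite exprn_gt0// mulr_gt0 ?ltr0n// addn_gt0 orbT.
have cN : 0 <= cell_const * N * h ^+ d by exact: le_trans bc.
have [H1 H2] := pair_bound p1 q1 pq mU mV mB pU pV N0 (HN l) i j c1 h0 w2 wst e0 ec.
split.
- apply: (le_trans H1); rewrite lee_fin.
  by apply: ge0_ler_powR; rewrite ?(ltW p0) ?nnegrE.
- apply: (le_trans H2); rewrite lee_fin.
  by apply: ge0_ler_powR; rewrite ?(ltW q0) ?nnegrE.
Qed.

Let dvd_shifted (a : 'I_d -> R) h o k : 0 < h ->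
  (shifted a h o k - a k) / h = (o k)%:~R.
Proof. by move=> h0; rewrite /shifted addrC addKr mulrC mulKf ?gt_eqF. Qed.

Let dvd_shiftedN (a : 'I_d -> R) h o k : 0 < h ->
  (a k - shifted a h o k) / h = - (o k)%:~R.
Proof. by move=> h0; rewrite -opprB mulNr dvd_shifted. Qed.

Let cell_volume (h r : R) : 0 < h -> 0 < r ->
  (cell_const * N * h ^+ d) `^ r = (cell_const * N) `^ r * (h ^+ d) `^ (1 + (r - 1)).
Proof.
move=> h0 r0; rewrite addrC subrK powRM// ?exprn_ge0 ?(ltW h0)//.
by rewrite mulr_ge0 ?cell_const_ge0 ?(ltW N0).
Qed.

Let volume_const (r s : R) : 0 < r ->
  whitney_const d M (r - 1) * (cell_const * N) `^ r * (s ^+ d) `^ (1 + (r - 1)) =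
  whitney_const d M (r - 1) * cell_const `^ r * N `^ r * (s ^+ d) `^ r.
Proof.
move=> r0; rewrite [1 + _]addrC subrK powRM ?cell_const_ge0 ?(ltW N0)//.
by rewrite !mulrA.
Qed.

(** The two estimates call for opposite offsets, since the roles of the two cells are
    exchanged. *)
Lemma entry_cube_bound (a : E) (s : R) : 0 < s ->
  (\int[mu]_(x in cube a s) (\int[mu]_(y in cube a s)
     (`|kij x y| `^ q)%:E) `^ (p - 1) <=
   (whitney_const d M (p - 1) * cell_const `^ p * N `^ p * (s ^+ d) `^ p)%:E)%E /\
  (\int[mu]_(y in cube a s) (\int[mu]_(x in cube a s)
     (`|kij x y| `^ p)%:E) `^ (q - 1) <=
   (whitney_const d M (q - 1) * cell_const `^ q * N `^ q * (s ^+ d) `^ q)%:E)%E.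
Proof.
move=> s0; have M0 : (0 < M)%N by exact: ltn_trans M1.
have mk : measurable_fun [set: E * E] (fun z => kij z.1 z.2).
  exact: measurable_entry_kernel.
split.
- rewrite -volume_const//.
  apply: (whitney_sum d0 M0 (k := fun z => (`|kij z.1 z.2| `^ q)%:E)) => //.
  + by rewrite subr_gt0.
  + by rewrite powR_ge0.
  + exact/measurable_EFinP/measurable_powR_norm.
  move=> c' h o h0 [j0 far] near; rewrite -cell_volume//.
  apply: (cell_bound h0 _ _).1; first by exists j0; rewrite dvd_shiftedN// normrN.
  by move=> j'; rewrite dvd_shiftedN// normrN; exact: near.
- rewrite -volume_const//.
  apply: (whitney_sum d0 M0 (k := fun z => (`|kij z.2 z.1| `^ p)%:E)) => //.
  + by rewrite subr_gt0.
  + by rewrite powR_ge0.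
  + apply/measurable_EFinP/measurable_powR_norm.
    apply: (measurableT_comp (f := fun z : E * E => kij z.1 z.2)
      (g := fun z => (z.2, z.1))) => //.
    exact: measurable_fun_pair measurable_snd measurable_fst.
  move=> c' h o h0 [j0 far] near; rewrite -cell_volume//.
  apply: (cell_bound h0 _ _).2; first by exists j0; rewrite dvd_shifted.
  by move=> j'; rewrite dvd_shifted//; exact: near.
Qed.

End entry.

Let T := ('I_m * 'I_m * bool)%type.
Let g (t : T) : E -> E -> R :=
  entry_kernel p U V B t.1.1 t.1.2 (if t.2 then 1 else (0 -i* 1)%C).

Let kernel_le_entries x y : bmo_kernel p V U B x y <= \sum_t `|g t x y|.
Proof.
apply: (le_trans (opnorm_le_sum _)).
rewrite (eq_bigr (fun t : T => `|g (t.1, t.2) x y|)); last by case.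
rewrite -(pair_bigA _ (fun ij b => `|g (ij, b) x y|)) /=.
rewrite (eq_bigr (fun ij : 'I_m * 'I_m =>
  \sum_(b : bool) `|g (ij.1, ij.2, b) x y|)); last by case.
rewrite -(pair_bigA _ (fun i j => \sum_(b : bool) `|g (i, j, b) x y|)) /=.
apply: ler_sum => i _; apply: ler_sum => j _; rewrite big_bool /g /entry_kernel /=.
apply: (le_trans (normc_le_ReIm _)); rewrite mul1r; apply: lerD => //.
by rewrite Re_mulc /= mul0r sub0r mulN1r opprK.
Qed.

Let g1 (b : bool) : Normc.normc (if b then 1 else (0 -i* 1)%C : C) = 1.
Proof. by case: b; rewrite /= ?sqrrN expr0n expr1n ?addr0 ?add0r sqrtr1. Qed.

Let mg t : measurable_fun [set: E * E] (fun z => g t z.1 z.2).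
Proof. exact: measurable_entry_kernel. Qed.

Definition bmo_const (r s : R) : R :=
  average_const ('I_m * 'I_m * bool)%type r s
    (whitney_const d M (r - 1) * cell_const `^ r).

Lemma whitney_const_ge0 (r : R) : 0 < r -> 0 <= @whitney_const R d M r.
Proof.
move=> r0; rewrite /whitney_const !mulr_ge0 ?powR_ge0 ?exprn_ge0//.
have : (3 / 4 : R) `^ r <= 1 `^ r.
  by apply: ge0_ler_powR; rewrite ?nnegrE ?(ltW r0)//; lra.
by rewrite powR1 invr_ge0 subr_ge0.
Qed.

Lemma borel_bmo_le : (bmo p q V U B <= (bmo_const p q * N)%:E)%E.
Proof.
have qp : q * (p - 1) = p by exact: conj_mulB1 q1 p1 (etrans (addrC _ _) pq).
apply: ub_ereal_sup => _ [Q cQ <-].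
apply: (average_mixed_le (g := g)).
- exact: p1.
- exact: q0.
- by rewrite -{1}qp mulrC mulKf// gt_eqF.
- by rewrite mulr_ge0 ?powR_ge0// whitney_const_ge0// subr_gt0.
- exact: N0.
- by move=> x y; exact: opnorm_ge0.
- exact: kernel_le_entries.
- exact: mg.
- move=> t a s s0; exact: (entry_cube_bound _ _ (g1 _) _ s0).1.
- exact: cQ.
Qed.

Lemma borel_bmo_dual_le : (bmo_dual p q V U B <= (bmo_const q p * N)%:E)%E.
Proof.
have qp : p * (q - 1) = q by exact: conj_mulB1 p1 q1 pq.
apply: ub_ereal_sup => _ [Q cQ <-].
apply: (average_mixed_le (kk := fun y x => bmo_kernel p V U B x y)
  (g := fun t y x => g t x y)).
- exact: q1.
- exact: p0.
- by rewrite -{1}qp mulrC mulKf// gt_eqF.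
- by rewrite mulr_ge0 ?powR_ge0// whitney_const_ge0// subr_gt0.
- exact: N0.
- by move=> y x; exact: opnorm_ge0.
- by move=> y x; exact: kernel_le_entries.
- move=> t; apply: (measurableT_comp (f := fun z : E * E => g t z.1 z.2)
      (g := fun z => (z.2, z.1))); first exact: mg.
  exact: measurable_fun_pair measurable_snd measurable_fst.
- move=> t a s s0; exact: (entry_cube_bound _ _ (g1 _) _ s0).2.
- exact: cQ.
Qed.

End fixed_weights.
End borel_bound.

Lemma conj_dot_gt0 (F : numClosedFieldType) m (v : 'cV[F]_m) : v != 0 ->
  0 < ((map_mx Num.conj v)^T *m 1%:M *m v) 0 0.
Proof.
move=> v0; rewrite mulmx1 mxE.
have [k vk] : exists k, v k 0 != 0.
  by have /matrix0Pn[i [j vij]] := v0; exists i; rewrite (ord1 j) in vij.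
rewrite (bigD1 k)//= !mxE mulrC; apply: ltr_wpDr; last by rewrite mul_conjC_gt0.
by apply: sumr_ge0 => i _; rewrite !mxE mulrC mul_conjC_ge0.
Qed.

Lemma hermsymmx1 (F : numClosedFieldType) m : (1%:M : 'M[F]_m) \is hermsymmx.
Proof. by apply/is_hermitianmxP; rewrite expr0 scale1r trmx1 map_mx1. Qed.

(** * Reduction to Borel weights *)

Section borel_reduction.
Context (R : realType) (d : nat).
Local Notation E := (Rd R d).
Local Notation mu := (leb R d).
Local Notation C := R[i].

Lemma posdefmx1 m : posdefmx (1%:M : 'M[C]_m).
Proof. split; [exact: hermsymmx1|exact: conj_dot_gt0]. Qed.

(** The exceptional points lie in a measurable null set, on which the identity can take
    the place of W. *)
Lemma borel_weight m (W : E -> 'M[C]_m) : matrix_weight W ->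
  exists W', [/\ mxmeas W', forall x, posdefmx (W' x) &
    {ae mu, forall x, W x = W' x}].
Proof.
move=> [[g [mg Wg]] pW].
have [A [mA A0 nA]] : {ae mu, forall x, W x = g x /\ posdefmx (W x)}.
  by apply: filterS2 Wg pW => x.
have AP x : ~ A x -> W x = g x /\ posdefmx (W x).
  by move=> nx; apply: contrapT => H; apply: nx; apply: nA.
exists (fun x => if x \in A then 1%:M else g x); split.
- have mem : measurable_fun [set: E] (fun x => x \in A).
    apply: (measurable_fun_bool true); rewrite setTI.
    rewrite (_ : _ @^-1` _ = A)//.
    by apply/seteqP; split => x; [exact: set_mem|exact: mem_set].
  move=> i j.
  have Ei : (fun x => (if x \in A then 1%:M else g x) i j) =
      (fun x => if x \in A then (1%:M : 'M[C]_m) i j else g x i j).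
    by apply/funext => x; case: ifP.
  rewrite Ei; have [H1 H2] := mg i j; split.
  + rewrite (_ : (fun x => _) = (fun x => if x \in A
      then complex.Re ((1%:M : 'M[C]_m) i j) else complex.Re (g x i j))).
      by apply: measurable_fun_ifT => //; exact: measurable_cst.
    by apply/funext => x; case: ifP.
  + rewrite (_ : (fun x => _) = (fun x => if x \in A
      then complex.Im ((1%:M : 'M[C]_m) i j) else complex.Im (g x i j))).
      by apply: measurable_fun_ifT => //; exact: measurable_cst.
    by apply/funext => x; case: ifP.
- move=> x; case: ifPn => [_|/negP nx]; first exact: posdefmx1.
  by have [<- ] := AP x (fun Ax => nx (mem_set Ax)).
- exists A; split => // x /= nx; apply: contrapT => Ax; apply: nx.
  by rewrite memNset//; have [] := AP x Ax.
Qed.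

Section ae_equal.
Variables (m : nat) (U V B U' V' B' : E -> 'M[C]_m).
Hypotheses (UU : {ae mu, forall x, U x = U' x}) (VV : {ae mu, forall x, V x = V' x})
  (BB : {ae mu, forall x, B x = B' x}).

Let kernel_ae p : {ae mu, forall x, {ae mu, forall y,
  bmo_kernel p V U B x y = bmo_kernel p V' U' B' x y}}.
Proof.
apply: filterS2 VV BB => x Vx Bx; apply: filterS2 UU BB => y Uy By.
by rewrite /bmo_kernel Vx Bx Uy By.
Qed.

Let kernel_ae_swap p : {ae mu, forall y, {ae mu, forall x,
  bmo_kernel p V U B x y = bmo_kernel p V' U' B' x y}}.
Proof.
apply: filterS2 UU BB => y Uy By; apply: filterS2 VV BB => x Vx Bx.
by rewrite /bmo_kernel Vx Bx Uy By.
Qed.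

Let average_ae Q (f g : E -> \bar R) : {ae mu, forall x, f x = g x} ->
  average Q f = average Q g.
Proof.
by move=> fg; congr (_ * _)%E; apply: ae_congr_integral; apply: filterS fg.
Qed.

Lemma ae_congr_bmo p q : bmo p q V U B = bmo p q V' U' B'.
Proof.
rewrite /bmo; apply: (congr1 (@ereal_sup R)); apply: eq_imagel => Q _.
apply: (congr1 (fun z => poweR z (p^-1))); apply: average_ae.
apply: filterS (kernel_ae p) => x H.
apply: (congr1 (fun z => poweR z (p / q))); apply: average_ae.
by apply: filterS H => y ->.
Qed.

Lemma ae_congr_bmo_dual p q : bmo_dual p q V U B = bmo_dual p q V' U' B'.
Proof.
rewrite /bmo_dual; apply: (congr1 (@ereal_sup R)); apply: eq_imagel => Q _.
apply: (congr1 (fun z => poweR z (q^-1))); apply: average_ae.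
apply: filterS (kernel_ae_swap p) => y H.
apply: (congr1 (fun z => poweR z (q / p))); apply: average_ae.
by apply: filterS H => x ->.
Qed.

Lemma ae_congr_wLnorm p (W W' : E -> 'M[C]_m) (f f' : E -> 'cV[C]_m) :
  {ae mu, forall x, W x = W' x} -> {ae mu, forall x, f x = f' x} ->
  wLnorm p W f = wLnorm p W' f'.
Proof.
move=> WW ff; rewrite /wLnorm unlock; apply: (congr1 (fun z => poweR z p^-1)).
apply: ae_congr_integral.
by apply: filterS2 WW ff => x -> ->.
Qed.

(** The truncated integrals, hence the principal values at every point, depend only on
    the almost everywhere class of f. *)
Lemma ae_congr_riesz_vec l (f f' : E -> 'cV[C]_m) : {ae mu, forall x, f x = f' x} ->
  @riesz_vec R d l m f = @riesz_vec R d l m f'.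
Proof.
move=> ff; have H (F : C -> R) i x :
    riesz l (fun y => F (f y i 0)) x = riesz l (fun y => F (f' y i 0)) x.
  rewrite /riesz; apply: (congr1 (fun h : R -> R => lim (h @ 0^'+))).
  apply/funext => e; apply: (congr1 fine); apply: ae_congr_integral.
  by apply: filterS ff => y ->.
apply/funext => x; apply/colP => i; rewrite /riesz_vec [LHS]mxE [RHS]mxE.
exact: (congr2 (fun a b : R => (a +i* b)%C) (H (@complex.Re R) i x) (H (@complex.Im R) i x)).
Qed.

Lemma ae_congr_Lp_opnorm p l :
  Lp_opnorm p U V (commutator (mulop B) (@riesz_vec R d l m)) =
  Lp_opnorm p U' V' (commutator (mulop B') (@riesz_vec R d l m)).
Proof.
have E1 f : wLnorm p U f = wLnorm p U' f.
  by apply: ae_congr_wLnorm UU _; exact: aeW.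
have E2 f : wLnorm p V (commutator (mulop B) (@riesz_vec R d l m) f) =
    wLnorm p V' (commutator (mulop B') (@riesz_vec R d l m) f).
  apply: ae_congr_wLnorm VV _; apply: filterS BB => x Bx.
  rewrite /commutator (_ : @riesz_vec R d l m (mulop B f) =
    @riesz_vec R d l m (mulop B' f)); first by rewrite /mulop Bx.
  by apply: ae_congr_riesz_vec; apply: filterS BB => y; rewrite /mulop => ->.
rewrite /Lp_opnorm; apply: (congr1 (@ereal_sup R)); apply/seteqP; split.
- by move=> _ [f [bf fU] <-]; exists f; [split; last rewrite -E1|rewrite E2].
- by move=> _ [f [bf fU] <-]; exists f; [split; last rewrite E1|rewrite E2].
Qed.

End ae_equal.

Lemma wLnorm_ge0 p m (W : E -> 'M[C]_m) (f : E -> 'cV[C]_m) :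
  (0 <= wLnorm p W f)%E.
Proof. by rewrite /wLnorm unlock; exact: poweR_ge0. Qed.

(** The zero function is an admissible test function, so the supremum is not -oo. *)
Lemma Lp_opnorm_ge0 p m (U V : E -> 'M[C]_m) T : 0 < p -> (0 <= Lp_opnorm p U V T)%E.
Proof.
move=> p0; apply: (le_trans (wLnorm_ge0 p V (T (fun=> 0)))).
apply: ereal_sup_ubound; exists (fun=> 0) => //; split.
  split.
  - exists (fun=> 0); split; last exact: aeW.
    move=> i j; rewrite (_ : (fun _ : E => _) = fun=> 0); last by apply/funext => x; rewrite mxE.
    rewrite (_ : (fun _ : E => complex.Im _) = fun=> 0); last by apply/funext => x; rewrite mxE.
    by split; exact: measurable_cst.
  - exists 0 => x; apply: (le_trans (vnorm_le_sum _)).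
    by rewrite big1// => i _; rewrite mxE Normc.normc0.
  - by exists 0.
have v0 x : vnorm (mxpow (U x) p^-1 *m 0) = 0.
  apply/eqP; rewrite eq_le vnorm_ge0 andbT; apply: (le_trans (vnorm_le_sum _)).
  by rewrite big1// => i _; rewrite mulmx0 mxE Normc.normc0.
rewrite /wLnorm unlock -[leRHS](poweR1r p^-1); apply: le_poweR.
- by rewrite invr_ge0 ltW.
- by apply: integral_ge0 => x _; exact: poweR_ge0.
rewrite integral0_eq// => x _; rewrite v0 abse0 poweR0r// gt_eqF//.
Qed.

End borel_reduction.

Theorem theorem1p6 (R : realType) (m d : nat) (p p' : R)
    (hm : (0 < m)%N) (hd : (0 < d)%N)
    (hp : 1 < p) (hpp' : p^-1 + p'^-1 = 1) :
  exists C : R, 0 < C /\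
    forall U V B : Rd R d -> 'M[R[i]]_m,
      matrix_weight U -> matrix_weight V -> loc_integrable_mx B ->
      (maxe (bmo p p' V U B) (bmo_dual p p' V U B) <=
       C%:E * \big[maxe/-oo]_(l < d)
                Lp_opnorm p U V (commutator (mulop B) (@riesz_vec R d l m)))%E.
Proof.
have p0 : 0 < p by exact: lt_trans hp.
have q1 : 1 < p'.
  have qE : p'^-1 = 1 - p^-1 by lra.
  have ip1 : p^-1 < 1 by rewrite invf_lt1.
  have ip0 : 0 < p^-1 by rewrite invr_gt0.
  have q0 : 0 < p' by rewrite -invr_gt0; lra.
  by rewrite -invf_lt1//; lra.
pose n : R := #|{: bool * bool * 'I_m}|%:R.
have n0 : 0 <= n ^+ 2 by exact: sqr_ge0.
(* This accuracy makes the error absorbable for kernels of rank n. *)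
pose e : R := (32 * (n ^+ 2 + 1))^-1.
have e0 : 0 < e by rewrite invr_gt0 mulr_gt0// ltr_wpDl.
have ec : 16 * n ^+ 2 * e <= 2^-1.
  by rewrite /e ler_pdivrMr; lra.
have [M [M1 stable]] := @riesz_fun_stable R d e e0.
pose c1 := bmo_const m d M p p'; pose c2 := bmo_const m d M p' p.
have c10 : 0 <= c1 by exact: powR_ge0.
have c20 : 0 <= c2 by exact: powR_ge0.
have C0 : 0 < c1 + c2 + 1 by lra.
exists (c1 + c2 + 1); split=> // U V B wU wV [lB _].
have [U' [mU pU UU]] := borel_weight wU; have [V' [mV pV VV]] := borel_weight wV.
have [B' [mB BB]] := lB.
rewrite (ae_congr_bmo UU VV BB) (ae_congr_bmo_dual UU VV BB).
set S := \big[maxe/-oo%E]_(l < d) _.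
have lS l : (Lp_opnorm p U' V' (commutator (mulop B') (@riesz_vec R d l m)) <= S)%E.
  rewrite -(ae_congr_Lp_opnorm UU VV BB).
  exact: (le_bigmax _ (fun l => Lp_opnorm p U V (commutator (mulop B) (@riesz_vec R d l m)))).
have S0 : (0 <= S)%E.
  by apply: le_trans (lS (Ordinal hd)); exact: Lp_opnorm_ge0.
(* The estimates above need a positive finite N, whereas S may be 0 or +oo. *)
have bound (N : R) : 0 < N -> (S <= N%:E)%E ->
    (maxe (bmo p p' V' U' B') (bmo_dual p p' V' U' B') <= ((c1 + c2 + 1) * N)%:E)%E.
  move=> N0 SN; have HN l := le_trans (lS l) SN.
  rewrite ge_max; apply/andP; split.
  - apply: (le_trans (borel_bmo_le hd hp q1 hpp' M1 (ltW e0) ec stable mU mV mB pU pV N0 HN)).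
    by rewrite lee_fin; apply: ler_wpM2r; [exact: ltW|rewrite -/c1; lra].
  - apply: (le_trans (borel_bmo_dual_le hd hp q1 hpp' M1 (ltW e0) ec stable mU mV mB pU pV N0 HN)).
    by rewrite lee_fin; apply: ler_wpM2r; [exact: ltW|rewrite -/c2; lra].
move: S S0 {lS} bound => [r|_ _|//]; last by rewrite gt0_muley ?leey.
rewrite lee_fin => r0 bound; apply/lee_addgt0Pr => t t0.
have tC : 0 < t / (c1 + c2 + 1) by exact: divr_gt0.
apply: le_trans (bound (r + t / (c1 + c2 + 1)) _ _) _.
- exact: ltr_wpDl.
- by rewrite lee_fin lerDl ltW.
by rewrite -EFinM -EFinD lee_fin mulrDr [_ * (t / _)]mulrC divfK// gt_eqF.
Qed.
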